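(* Let $f$ be an analytic function in the unit disc $\mathbb D$ such that: (a) $f\in\mathcal N_+$, i.e. $$\log|f(z)|\le \int_{\mathbb T} \log|f(\zeta)| \,\mathrm{Re} \left(\frac{\zeta+z}{\zeta-z}\right) dm(\zeta)\quad \text{for all } z\in\mathbb D;$$ (b) $\mathrm{Re} f\in L^1(\mathbb T)$ and $f(0)\in\mathbb R$; (c) $\displaystyle \liminf_{R\to\infty} R\int_R^\infty \frac{m_f(t)}{t}\, dt < \infty.$ Then there exists a finite real Borel measure $\mu$ on $\mathbb T$ such that $$f(z)=\int_{\mathbb T}\frac{\zeta+z}{\zeta-z}\,d\mu(\zeta),\qquad z\in\mathbb D,$$ and $$\|\mu\| \le \|\mathrm{Re} f\|_{L^1(\mathbb T)} + C \liminf_{R\to\infty} R\int_R^\infty \frac{m_f(t)}{t}\, dt,$$ where $C$ is a positive numerical constant (independent of $f$) and $\|\mu\|$ is the total variation of $\mu$.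
   Context: $\mathbb D$ is the open unit disc, $\mathbb T$ the unit circle, and $m$ the normalized Lebesgue measure on $\mathbb T$ ($m(\mathbb T)=1$). For an analytic function $f$ on $\mathbb D$ with non-tangential boundary values a.e. on $\mathbb T$, the same letter $f$ denotes these boundary values (in particular $\mathrm{Re} f$ on $\mathbb T$ denotes the real part of the boundary values), and $m_f(t)=m\{\zeta\in\mathbb T : |f(\zeta)|\ge t\}$ for $t>0$. $\|\cdot\|_{L^1(\mathbb T)}$ is taken with respect to $m$. *)

(* Defs.v *)
From HB Require Import structures.
From mathcomp Require Import all_boot all_order all_algebra.
From mathcomp Require Import all_classical all_reals all_analysis.
From mathcomp.real_closed Require Import complex.
Set Implicit Arguments. Unset Strict Implicit. Unset Printing Implicit Defensive.
Import Order.TTheory GRing.Theory Num.Theory.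
Import numFieldNormedType.Exports.
Local Open Scope classical_set_scope.
Local Open Scope ring_scope.

(* The unit circle T is parametrized by theta in [0,1) via
   theta |-> exp(2 pi i theta); the normalized Lebesgue measure m on T is the
   pushforward of Lebesgue measure on [0,1). *)
Section Defs.
Variable R : realType.
Local Notation C := R[i].
Local Notation normc := (@Normc.normc R).

Definition expi (theta : R) : C :=
  (cos (2 * pi * theta) +i* sin (2 * pi * theta))%C.

Definition holomorphic_on_disc (f : C -> C) : Prop :=
  forall z : C, normc z < 1 ->
  exists l : C, forall eps : R, 0 < eps -> exists delta : R, 0 < delta /\
    forall h : C, 0 < normc h -> normc h < delta ->
      normc ((f (z + h) - f z) / h - l) < eps.

Definition nontangential_limit (f : C -> C) (theta : R) (w : C) : Prop :=
  forall alpha : R, 1 < alpha -> forall eps : R, 0 < eps ->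
  exists delta : R, 0 < delta /\
    forall z : C, normc z < 1 -> normc (z - expi theta) < alpha * (1 - normc z) ->
      normc (z - expi theta) < delta -> normc (f z - w) < eps.

Definition elog (x : R) : \bar R := if x == 0 then -oo%E else (ln x)%:E.

Definition distrib (fb : R -> C) (t : R) : \bar R :=
  lebesgue_measure (`[0, 1[ `&` [set theta | t <= normc (fb theta)]).

Definition liminf_pinfty (g : R -> \bar R) : \bar R :=
  ereal_sup [set ereal_inf (g @` `[M, +oo[) | M in [set: R]].

Definition tail_quantity (fb : R -> C) (x : R) : \bar R :=
  (x%:E * \int[lebesgue_measure]_(t in `[x, +oo[) (distrib fb t * (t^-1)%:E))%E.

Definition cintegral (mu : set R -> \bar R) (g : R -> C) : C :=
  (fine (\int[mu]_(theta in `[0, 1[) (complex.Re (g theta))%:E) +i*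
   fine (\int[mu]_(theta in `[0, 1[) (complex.Im (g theta))%:E))%C.

Definition signed_total_variation (mu1 mu2 : set R -> \bar R) : \bar R :=
  ereal_sup [set s : \bar R | exists (n : nat) (E : 'I_n -> set R),
    [/\ (forall i, measurable (E i)), trivIset [set: 'I_n] E,
        \bigcup_(i in [set: 'I_n]) E i = `[0, 1[%classic &
        s = (\sum_(i < n) `| mu1 (E i) - mu2 (E i) |)%E]].
End Defs.
Arguments expi {R}.
Arguments holomorphic_on_disc {R}.
Arguments nontangential_limit {R}.
Arguments elog {R}.
Arguments distrib {R}.
Arguments liminf_pinfty {R}.
Arguments tail_quantity {R}.
Arguments cintegral {R}.
Arguments signed_total_variation {R}.

(* Main.v *)
(* For R > 0 let Psi = |Re f| + c log^+(|f| / R) on T, with c = 4 R / log 2, and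
   let K be the Poisson integral of Psi. Condition (a) gives
   K >= c log(|f| / R), so K >= 4 R wherever |f| >= 2 R. Hence
   max(0, min(|Re f|, 4 R) - K) is submean at every point of the disc: where it
   is positive, |f| < 2 R, the truncation is inactive nearby, and |Re f| is
   subharmonic while K is harmonic. Its means over circles are nondecreasing in
   the radius, and they tend to 0 at the boundary by dominated convergence, since
   the truncation is bounded and min(|Re f|, 4 R) <= Psi on T. So it vanishes,
   and on a circle where |f| <= 4 R the mean of |Re f| is at most the mean of
   Psi, in which the mean of R log^+(|f| / R) equals the tail integral
   R int_R^oo m_f(t) / t dt. Taking R to infinity along the lower limit bounds
   the mean of |Re f| on all circles at once. The positive and negative parts of
   Re f(r zeta) dm(zeta) then have weak limits mu1 and mu2 along an ultrafilter,
   and the Schwarz formula for the dilates f(r z) passes to the limit. *)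
Require Import Defs.
From HB Require Import structures.
From mathcomp Require Import all_boot all_order all_algebra.
From mathcomp Require Import all_classical all_reals all_analysis.
From mathcomp.real_closed Require Import complex.
From mathcomp Require Import measurable_realfun ring lra.
Set Implicit Arguments. Unset Strict Implicit. Unset Printing Implicit Defensive.
Import Order.TTheory GRing.Theory Num.Theory.
Import numFieldNormedType.Exports.
Local Open Scope classical_set_scope.
Local Open Scope ring_scope.

(** The obstacle is that $\mathrm{Re} f$ need not be the Poisson integral of its boundary values:
    for $(1+z)/(1-z)$ they vanish almost everywhere and $\mu$ is a point mass. So $|\mathrm{Re} f|$
    has to be compared with something larger than the Poisson integral of its trace; the logarithmic
    term is a barrier where $|f|$ is large, and the tail integral is its price. The two levels $2R$
    and $4R$ leave a gap: from a point where $|f| < 2R$, $f$ can move by $2R$ before the truncation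
    acts. The final constant is $c/R = 4/\log 2$.

    No boundary limit theorem for $K$ enters. The truncated trace is approximated in $L^1$ by the
    truncation on an inner circle, a continuous function whose Poisson integral converges uniformly.

    Along an ultrafilter the cumulative functions of the densities converge at every point at once,
    so no subsequence is extracted. The circle is cut at one point: mass may gather at either end of
    $[0,1)$, and the limit measures are first built on a longer interval and then wrapped.

    The mean value property comes from Goursat's argument in polar coordinates, where concentric
    circles are opposite sides of a rectangle. *)

(** * Moduli, continuity and complex differentiability at a point *)

Section complex_basics.
Context {R : realType}.
Local Notation C := R[i].
Local Notation normc := (@Normc.normc R).
Local Notation Re := (@complex.Re R).
Local Notation Im := (@complex.Im R).
Implicit Types (z w a b : C) (f g : C -> C).

Lemma sqr_normc_ReIm z : normc z ^+ 2 = Re z ^+ 2 + Im z ^+ 2.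
Proof. by case: z => x y /=; rewrite sqr_sqrtr// addr_ge0// sqr_ge0. Qed.

Lemma normc_ge0 z : 0 <= normc z.
Proof. by case: z => x y; exact: sqrtr_ge0. Qed.

Lemma normc_gt0 z : (0 < normc z) = (z != 0).
Proof.
rewrite lt_def normc_ge0 andbT; congr negb; apply/eqP/eqP => [|->].
  exact: Normc.eq0_normc.
exact: Normc.normc0.
Qed.

Lemma normcB z w : normc (z - w) = normc (w - z).
Proof. by rewrite -normcN opprB. Qed.

Lemma le_normcB z w : normc (z - w) <= normc z + normc w.
Proof. by rewrite -(normcN w) le_normcD. Qed.

Lemma normc_dist z w : normc z - normc w <= normc (z - w).
Proof. by rewrite lerBlDr (le_trans _ (le_normcD _ _)) ?subrK. Qed.

Lemma normc_Re z : `|Re z| <= normc z.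
Proof.
rewrite -(@ler_pXn2r _ 2)// ?nnegrE ?normc_ge0//.
by rewrite real_normK ?num_real// sqr_normc_ReIm lerDl sqr_ge0.
Qed.

Lemma normc_Im z : `|Im z| <= normc z.
Proof.
rewrite -(@ler_pXn2r _ 2)// ?nnegrE ?normc_ge0//.
by rewrite real_normK ?num_real// sqr_normc_ReIm lerDr sqr_ge0.
Qed.

Lemma normc_le_ReIm z : normc z <= `|Re z| + `|Im z|.
Proof.
rewrite -(@ler_pXn2r _ 2)// ?nnegrE ?normc_ge0 ?addr_ge0//.
rewrite sqr_normc_ReIm -(real_normK (num_real (Re z))).
rewrite -(real_normK (num_real (Im z))).
have := mulr_ge0 (normr_ge0 (Re z)) (normr_ge0 (Im z)); nra.
Qed.

Lemma normc_real (x : R) : normc x%:C%C = `|x|.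
Proof. by rewrite /= expr0n addr0 sqrtr_sqr. Qed.

Lemma normc_conj z : normc (z^*)%C = normc z.
Proof. by case: z => x y /=; rewrite sqrrN. Qed.

Lemma ReD z w : Re (z + w) = Re z + Re w.
Proof. by case: z w => [? ?] [? ?]. Qed.
Lemma ImD z w : Im (z + w) = Im z + Im w.
Proof. by case: z w => [? ?] [? ?]. Qed.
Lemma ReN z : Re (- z) = - Re z.
Proof. by case: z. Qed.
Lemma ImN z : Im (- z) = - Im z.
Proof. by case: z. Qed.
Lemma ReM z w : Re (z * w) = Re z * Re w - Im z * Im w.
Proof. by case: z w => [? ?] [? ?]. Qed.
Lemma ImM z w : Im (z * w) = Re z * Im w + Im z * Re w.
Proof. by case: z w => [? ?] [? ?]. Qed.
Lemma ReB z w : Re (z - w) = Re z - Re w.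
Proof. by rewrite ReD ReN. Qed.
Lemma ImB z w : Im (z - w) = Im z - Im w.
Proof. by rewrite ImD ImN. Qed.

Lemma complexP z w : Re z = Re w -> Im z = Im w -> z = w.
Proof. by case: z w => [? ?] [? ?] /= -> ->. Qed.

Lemma normc_expi (t : R) : normc (expi t) = 1.
Proof. by rewrite /expi /= cos2Dsin2 sqrtr1. Qed.

Lemma expi_neq0 (t : R) : expi t != 0.
Proof. by rewrite -normc_gt0 normc_expi. Qed.

Lemma expiD (s t : R) : expi (s + t) = expi s * expi t.
Proof.
apply: complexP; first by rewrite ReM /= mulrDr cosD.
by rewrite ImM /= mulrDr sinD addrC.
Qed.

Lemma expi0 : expi (0 : R) = 1.
Proof. by rewrite /expi mulr0 cos0 sin0. Qed.

Lemma expi1 : expi (1 : R) = 1.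
Proof. by rewrite /expi mulr1 mulr_natl cos2pi sin2pi. Qed.

Lemma expiD1 (t : R) : expi (t + 1) = expi t.
Proof. by rewrite expiD expi1 mulr1. Qed.

Lemma conj_expi (t : R) : ((expi t)^*)%C = (expi t)^-1.
Proof.
apply: (mulfI (expi_neq0 t)); rewrite divff ?expi_neq0//.
by apply: complexP; rewrite /expi; simpc => /=;
  rewrite ?opprK -?expr2 ?cos2Dsin2//; ring.
Qed.

Definition ccont f z := forall e : R, 0 < e ->
  exists2 d : R, 0 < d & forall w, normc (w - z) < d -> normc (f w - f z) < e.

(* Caratheodory's form of complex differentiability: closure under products,
   inverses and composition reduces to that of continuity. *)
Definition cdiff f z := exists2 p : C -> C, ccont p z &
  forall w, f w - f z = p w * (w - z).

Lemma ccont_cst a z : ccont (fun=> a) z.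
Proof.
by move=> e e0; exists 1 => // w _; rewrite subrr Normc.normc0.
Qed.

Lemma ccont_id z : ccont id z.
Proof. by move=> e e0; exists e. Qed.

Lemma ccontD f g z : ccont f z -> ccont g z -> ccont (fun w => f w + g w) z.
Proof.
move=> cf cg e e0.
have [d d0 fd] := cf _ (divr_gt0 e0 (ltr0n _ 2)).
have [d' d'0 gd] := cg _ (divr_gt0 e0 (ltr0n _ 2)).
exists (Num.min d d'); first by rewrite lt_min d0.
move=> w; rewrite lt_min => /andP[/fd + /gd].
rewrite (_ : f w + g w - (f z + g z) = (f w - f z) + (g w - g z)); last by ring.
have := le_normcD (f w - f z) (g w - g z); lra.
Qed.

Lemma ccontM f g z : ccont f z -> ccont g z -> ccont (fun w => f w * g w) z.
Proof.
move=> cf cg e e0.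
pose M := normc (f z) + normc (g z) + 1.
have M0 : 0 < M by rewrite /M; have := normc_ge0 (f z); have := normc_ge0 (g z); lra.
have e1 : 0 < Num.min 1 (e / (M * 2)).
  by rewrite lt_min ltr01 divr_gt0// mulr_gt0.
have [d d0 fd] := cf _ e1.
have [d' d'0 gd] := cg _ e1.
exists (Num.min d d'); first by rewrite lt_min d0.
move=> w; rewrite lt_min => /andP[/fd + /gd]; rewrite !lt_min.
move=> /andP[f1 f2] /andP[g1 g2].
rewrite [X in normc X](_ : _ = f w * (g w - g z) + (f w - f z) * g z);
  last by ring.
apply: le_lt_trans (le_normcD _ _) _; rewrite !Normc.normcM.
have fwM : normc (f w) <= M.
  have := normc_dist (f w) (f z); rewrite /M; have := normc_ge0 (g z); lra.
have gzM : normc (g z) <= M by rewrite /M; have := normc_ge0 (f z); lra.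
have -> : e = M * (e / (M * 2)) + (e / (M * 2)) * M by field; exact: lt0r_neq0.
rewrite ltr_leD//.
  by rewrite (le_lt_trans (ler_wpM2r (normc_ge0 _) fwM))// ltr_pM2l.
by rewrite ler_pM ?normc_ge0// ltW.
Qed.

Lemma ccontN f z : ccont f z -> ccont (fun w => - f w) z.
Proof.
by move=> cf e /cf[d d0 fd]; exists d => // w /fd; rewrite -opprD normcN.
Qed.

Lemma ccontB f g z : ccont f z -> ccont g z -> ccont (fun w => f w - g w) z.
Proof. by move=> cf cg; apply: ccontD => //; exact: ccontN. Qed.

Lemma ccont_neq0 f z : ccont f z -> f z != 0 ->
  exists2 d : R, 0 < d & forall w, normc (w - z) < d -> normc (f z) / 2 < normc (f w).
Proof.
rewrite -normc_gt0 => cf fz.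
have [d d0 fd] := cf _ (divr_gt0 fz (ltr0n _ 2)).
exists d => // w /fd; rewrite normcB; have := normc_dist (f z) (f w); lra.
Qed.

Lemma ccontV f z : ccont f z -> f z != 0 -> ccont (fun w => (f w)^-1) z.
Proof.
move=> cf fz0 e e0; have [d d0 fd] := ccont_neq0 cf fz0.
have nfz : 0 < normc (f z) by rewrite normc_gt0.
have e1 : 0 < e * (normc (f z) / 2 * normc (f z)).
  by rewrite mulr_gt0// mulr_gt0// divr_gt0.
have [d' d'0 fd'] := cf _ e1.
exists (Num.min d d'); first by rewrite lt_min d0.
move=> w; rewrite lt_min => /andP[/fd h1 /fd' h2].
have fw0 : f w != 0 by rewrite -normc_gt0 (lt_trans _ h1)// divr_gt0.
have nfw : 0 < normc (f w) by rewrite normc_gt0.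
rewrite [X in normc X](_ : _ = - (f w - f z) / (f w * f z)); last first.
  by field; apply/andP.
rewrite Normc.normcM normcN Normc.normcV Normc.normcM ltr_pdivrMr ?mulr_gt0//.
by apply: lt_trans h2 _; rewrite ltr_pM2l// ltr_pM2r.
Qed.

Lemma ccont_comp f g z : ccont g z -> ccont f (g z) -> ccont (f \o g) z.
Proof.
by move=> cg cf e /cf[d /cg[d' d'0 gd] fd]; exists d' => // w /gd /fd.
Qed.

Lemma cdiff_ccont f z : cdiff f z -> ccont f z.
Proof.
move=> [p cp pE].
have -> : f = (fun w => p w * (w - z) + f z).
  by apply/funext => w; rewrite -pE subrK.
apply: ccontD (ccont_cst _ _); apply: ccontM => //.
by apply: ccontB (ccont_cst _ _); exact: ccont_id.
Qed.

Lemma cdiff_cst a z : cdiff (fun=> a) z.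
Proof.
by exists (fun=> 0); [exact: ccont_cst|move=> w; rewrite subrr mul0r].
Qed.

Lemma cdiff_id z : cdiff id z.
Proof. by exists (fun=> 1); [exact: ccont_cst|move=> w; rewrite mul1r]. Qed.

Lemma cdiffD f g z : cdiff f z -> cdiff g z -> cdiff (fun w => f w + g w) z.
Proof.
move=> [p cp pE] [q cq qE]; exists (fun w => p w + q w); first exact: ccontD.
by move=> w; rewrite mulrDl -pE -qE; ring.
Qed.

Lemma cdiffM f g z : cdiff f z -> cdiff g z -> cdiff (fun w => f w * g w) z.
Proof.
move=> df [q cq qE]; have cf := cdiff_ccont df; case: df => p cp pE.
exists (fun w => p w * g z + f w * q w).
  by apply: ccontD; apply: ccontM => //; exact: ccont_cst.
move=> w.
rewrite [RHS](_ : _ = p w * (w - z) * g z + f w * (q w * (w - z))); last by ring.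
by rewrite -pE -qE; ring.
Qed.

Lemma cdiffN f z : cdiff f z -> cdiff (fun w => - f w) z.
Proof.
move=> [p cp pE]; exists (fun w => - p w); first exact: ccontN.
by move=> w; rewrite mulNr -pE; ring.
Qed.

Lemma cdiffB f g z : cdiff f z -> cdiff g z -> cdiff (fun w => f w - g w) z.
Proof. by move=> df dg; apply: cdiffD => //; exact: cdiffN. Qed.

Lemma cdiff_comp f g z : cdiff g z -> cdiff f (g z) -> cdiff (f \o g) z.
Proof.
move=> dg [q cq qE]; have cg := cdiff_ccont dg; case: dg => p cp pE.
exists (fun w => q (g w) * p w); first by apply: ccontM => //; exact: (ccont_comp cg).
by move=> w /=; rewrite qE pE mulrA.
Qed.

Lemma cdiff_inv z : z != 0 -> cdiff (fun w => w^-1) z.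
Proof.
move=> z0; pose p w := - (w^-1 * z^-1).
(* The slope identity must hold at every [w], including 0, where [0^-1 = 0] turns it into
   [- z^-1 = q 0 * (- z)] and so fixes the value of [q 0]. The point 0 is away from [z], so
   continuity at [z] does not see this value. *)
pose q w := if w == 0 then z^-1 * z^-1 else p w.
exists q => [|w].
  have cp : ccont p z.
    apply: ccontN; apply: ccontM (ccont_cst _ _); apply: ccontV => //.
    exact: ccont_id.
  have nz : 0 < normc z by rewrite normc_gt0.
  move=> e /cp[d d0 pd]; exists (Num.min d (normc z)); first by rewrite lt_min d0.
  move=> w; rewrite lt_min => /andP[/pd + wz]; rewrite /q (negbTE z0).
  by case: eqP => // w0; move: wz; rewrite w0 sub0r normcN ltxx.
rewrite /q; case: eqP => [->|/eqP w0].
  by rewrite invr0; field.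
by rewrite /p; field; rewrite w0 z0.
Qed.

Lemma cdiffV f z : cdiff f z -> f z != 0 -> cdiff (fun w => (f w)^-1) z.
Proof. by move=> df fz; apply: (cdiff_comp df); exact: cdiff_inv. Qed.

(* The difference quotient of [f] at [z], extended by its limit, is continuous
   at [z]; the value at [z] is irrelevant to the identity it satisfies. *)
Lemma cdiff_local f z (l : C) :
  (forall e : R, 0 < e -> exists d : R, 0 < d /\ forall h,
    0 < normc h -> normc h < d -> normc ((f (z + h) - f z) / h - l) < e) ->
  cdiff f z.
Proof.
move=> fl; exists (fun w => if w == z then l else (f w - f z) / (w - z)).
  move=> e e0; have [d [d0 fd]] := fl _ e0; exists d => // w wd; rewrite eqxx.
  have [wz|wz] := eqVneq w z; first by rewrite subrr Normc.normc0.
  by have := fd (w - z); rewrite normc_gt0 subr_eq0 wz subrKC; exact.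
move=> w; have [->|wz] := eqVneq w z; first by rewrite !subrr mulr0.
by rewrite mulfVK// subr_eq0.
Qed.

End complex_basics.

(** * Bisection of rectangles *)

Section bisection.
Context {R : realType}.

Lemma half_pow_lt (c d : R) : 0 < d -> exists n : nat, c / 2 ^+ n < d.
Proof.
move=> d0; have [n nE] : exists n : nat, c / d < n%:R.
  have [c0|c0] := ltP (c / d) 0; first by exists 0%N.
  by exists (Num.bound (c / d)); rewrite archi_boundP.
exists n; rewrite ltr_pdivrMr ?exprn_gt0// mulrC -ltr_pdivrMr//.
by rewrite (lt_le_trans nE)// -natrX ler_nat ltnW// ltn_expl.
Qed.

Variable P : R -> R -> R -> R -> Prop.
Hypothesis split4 : forall a b c d, a <= b -> c <= d ->
  P a ((a + b) / 2) c ((c + d) / 2) -> P a ((a + b) / 2) ((c + d) / 2) d ->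
  P ((a + b) / 2) b c ((c + d) / 2) -> P ((a + b) / 2) b ((c + d) / 2) d ->
  P a b c d.

(** Compactness in the form of nested quarters: if [P] failed, some quarter would fail at each
    stage, and the quarters shrink to a point where the local hypothesis contradicts this. It serves
    Goursat's estimate and, with the second side degenerate, the uniform continuity statements on
    segments and circles. *)
Lemma rect_bisection (x1 x2 y1 y2 : R) : x1 <= x2 -> y1 <= y2 ->
  (forall x y, x1 <= x <= x2 -> y1 <= y <= y2 -> exists2 e, 0 < e &
     forall a b c d, x1 <= a -> b <= x2 -> y1 <= c -> d <= y2 ->
       a <= x <= b -> c <= y <= d -> b - a < e -> d - c < e -> P a b c d) ->
  P x1 x2 y1 y2.
Proof.
move=> x12 y12 loc; apply: contrapT => nP.
pose T := (R * R * (R * R))%type.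
pose Q (r : T) := P r.1.1 r.1.2 r.2.1 r.2.2.
pose ok (r : T) := r.1.1 <= r.1.2 /\ r.2.1 <= r.2.2.
pose sub (r s : T) := [/\ r.1.1 <= s.1.1, s.1.2 <= r.1.2, r.2.1 <= s.2.1,
  s.2.2 <= r.2.2 & s.1.2 - s.1.1 = (r.1.2 - r.1.1) / 2 /\
                   s.2.2 - s.2.1 = (r.2.2 - r.2.1) / 2].
have step (r : T) : exists s : T, ok r -> ~ Q r -> [/\ ok s, ~ Q s & sub r s].
  have [[okr nQ]|nr] := pselect (ok r /\ ~ Q r); last first.
    by exists r => okr nQ; exfalso; apply: nr.
  case: r okr nQ => [[a b] [c d]] [/= ab cd] nQ.
  have [h1|h1] := pselect (P a ((a + b) / 2) c ((c + d) / 2)); last first.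
    by exists (a, (a + b) / 2, (c, (c + d) / 2)) => _ _; do !split => //=; lra.
  have [h2|h2] := pselect (P a ((a + b) / 2) ((c + d) / 2) d); last first.
    by exists (a, (a + b) / 2, ((c + d) / 2, d)) => _ _; do !split => //=; lra.
  have [h3|h3] := pselect (P ((a + b) / 2) b c ((c + d) / 2)); last first.
    by exists ((a + b) / 2, b, (c, (c + d) / 2)) => _ _; do !split => //=; lra.
  have [h4|h4] := pselect (P ((a + b) / 2) b ((c + d) / 2) d); last first.
    by exists ((a + b) / 2, b, ((c + d) / 2, d)) => _ _; do !split => //=; lra.
  by exfalso; apply: nQ; apply: split4.
have [F FE] := choice step.
pose r n := iter n F ((x1, x2), (y1, y2)).
have okr n : ok (r n) /\ ~ Q (r n).
  elim: n => [//|n [h1 h2]]; rewrite /r iterS -/(r n).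
  by have [] := FE _ h1 h2.
have subr n : sub (r n) (r n.+1).
  by have [h1 h2] := okr n; rewrite /r iterS -/(r n); have [] := FE _ h1 h2.
have mono n m : (n <= m)%N -> [/\ (r n).1.1 <= (r m).1.1, (r m).1.2 <= (r n).1.2,
    (r n).2.1 <= (r m).2.1 & (r m).2.2 <= (r n).2.2].
  elim: m => [|m IH]; first by rewrite leqn0 => /eqP ->.
  rewrite leq_eqVlt => /predU1P[->//|]; rewrite ltnS => /IH[h1 h2 h3 h4].
  have [k1 k2 k3 k4 _] := subr m; split; first exact: le_trans k1.
  - exact: le_trans k2 _.
  - exact: le_trans k3.
  - exact: le_trans k4 _.
have size n : (r n).1.2 - (r n).1.1 = (x2 - x1) / 2 ^+ n /\
              (r n).2.2 - (r n).2.1 = (y2 - y1) / 2 ^+ n.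
  elim: n => [|n [IH1 IH2]]; first by rewrite expr0 !divr1.
  have [_ _ _ _ [-> ->]] := subr n; rewrite IH1 IH2 exprSr.
  by rewrite !invfM !mulrA; split.
have nest n m : (r n).1.1 <= (r m).1.2 /\ (r n).2.1 <= (r m).2.2.
  have [[h1 h2] _] := okr (maxn n m).
  have [a1 _ a3 _] := mono _ _ (leq_maxl n m).
  have [_ b2 _ b4] := mono _ _ (leq_maxr n m); split; lra.
(* By [nest] every lower end is below every upper end, so the suprema of the lower ends give a point
   common to all the rectangles. *)
pose x := sup (range (fun n => (r n).1.1)).
pose y := sup (range (fun n => (r n).2.1)).
have xb n : (r n).1.1 <= x <= (r n).1.2.
  apply/andP; split.
    apply: ub_le_sup; last by exists n.
    by exists x2 => _ [m _ <-]; have [] := nest m 0%N.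
  apply: ge_sup; first by exists (r 0%N).1.1; exists 0%N.
  by move=> _ [m _ <-]; have [] := nest m n.
have yb n : (r n).2.1 <= y <= (r n).2.2.
  apply/andP; split.
    apply: ub_le_sup; last by exists n.
    by exists y2 => _ [m _ <-]; have [] := nest m 0%N.
  apply: ge_sup; first by exists (r 0%N).2.1; exists 0%N.
  by move=> _ [m _ <-]; have [] := nest m n.
have [e e0 he] := loc x y (xb 0%N) (yb 0%N).
have [n hn] := half_pow_lt (x2 - x1) e0.
have [m hm] := half_pow_lt (y2 - y1) e0.
pose k := maxn n m.
have [_ nQ] := okr k; apply: nQ.
have [h1 h2 h3 h4] := mono _ _ (leq0n k).
have [n1 n2 n3 n4] := mono _ _ (leq_maxl n m).
have [m1 m2 m3 m4] := mono _ _ (leq_maxr n m).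
have [sn _] := size n; have [_ sm] := size m.
apply: he => //; first by rewrite -/k in n1 n2; lra.
by rewrite -/k in m3 m4; lra.
Qed.

End bisection.

(** * Integrals over segments *)

Section segment_integral.
Context {R : realType}.
Local Notation mu := (@lebesgue_measure R).
Local Notation I a b f := (\int[mu]_(t in `[a, b]) f t).
Implicit Types (f g : R -> R) (a b c k M : R).

Lemma continuous_segment_integrable f a b :
  (forall t, a <= t <= b -> {for t, continuous f}) ->
  mu.-integrable `[a, b] (EFin \o f).
Proof.
move=> cf; apply: continuous_compact_integrable; first exact: segment_compact.
by apply: continuous_in_subspaceT => t; rewrite inE/= in_itv/=; exact: cf.
Qed.

Lemma integrable_cst_segment a b k : mu.-integrable `[a, b] (EFin \o cst k).
Proof. by apply: continuous_segment_integrable => t _; exact: cst_continuous. Qed.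

Lemma segment_integral_split f a b c : a <= b -> b <= c ->
  mu.-integrable `[a, c] (EFin \o f) -> I a c f = I a b f + I b c f.
Proof.
move=> ab bc fi; rewrite -(@Rintegral_itv_obnd_cbnd _ b); last first.
  by apply: integrableS fi => //; apply: subset_itv; rewrite bnd_simp.
by rewrite -(Rintegral_itvB fi) ?bnd_simp// subrKC.
Qed.

Lemma segment_integral_cst a b k : a <= b -> I a b (cst k) = k * (b - a).
Proof.
move=> ab; rewrite Rintegral_cst//= lebesgue_measure_itv/= lte_fin.
by case: ltP => [_//|ba]; have -> : a = b; [lra|rewrite subrr].
Qed.

Lemma segment_integral_near f a b k M : a <= b ->
  mu.-integrable `[a, b] (EFin \o f) ->
  (forall t, a <= t <= b -> `|f t - k| <= M) ->
  `|I a b f - k * (b - a)| <= M * (b - a).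
Proof.
move=> ab fi fM; have mI : measurable (`[a, b] : set R) by [].
rewrite -(segment_integral_cst k ab) -RintegralB//; last first.
  exact: integrable_cst_segment.
have di : mu.-integrable `[a, b] (EFin \o (fun t => f t - k)).
  by rewrite (_ : _ \o _ = (EFin \o f) \- (EFin \o cst k))%E;
    [apply: integrableB => //; exact: integrable_cst_segment|].
apply: le_trans (le_normr_Rintegral _ di) _ => //.
rewrite -(segment_integral_cst M ab); apply: le_Rintegral => //.
- exact: (integrable_norm di).
- exact: integrable_cst_segment.
Qed.

End segment_integral.

(** * Goursat's theorem and circle means *)
Section goursat.
Context {R : realType}.
Local Notation mu := (@lebesgue_measure R).
Local Notation I a b f := (\int[mu]_(t in `[a, b]) f t).

Definition has_grad (u : R -> R -> R) (x y p q : R) :=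
  forall e : R, 0 < e -> exists2 d : R, 0 < d & forall x' y',
    `|x' - x| < d -> `|y' - y| < d ->
    `|u x' y' - u x y - (p * (x' - x) + q * (y' - y))|
      <= e * (`|x' - x| + `|y' - y|).

Lemma affine_continuous_at (f : R -> R) x k (d : R) : 0 < d ->
  (forall x', `|x' - x| < d -> `|f x' - f x - k * (x' - x)| <= `|x' - x|) ->
  {for x, continuous f}.
Proof.
move=> d0 fd; apply/cvgrPdist_lt => e e0.
have k0 : 0 < `|k| + 1 by rewrite ltr_wpDl.
have m0 : 0 < Num.min d (e / (`|k| + 1)) by rewrite lt_min d0 divr_gt0.
exists (Num.min d (e / (`|k| + 1))) => // z /=; rewrite distrC.
rewrite lt_min => /andP[/fd h1]; rewrite ltr_pdivlMr// => h2.
rewrite distrC; apply: le_lt_trans h2.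
rewrite mulrDr mulr1 -(subrK (k * (z - x)) (f z - f x)).
rewrite (le_trans (ler_normD _ _))// normrM (mulrC `|k|).
by rewrite addrC lerD2l.
Qed.

Lemma has_grad_continuous1 u x y p q :
  has_grad u x y p q -> {for x, continuous (u^~ y)}.
Proof.
move=> /(_ 1 ltr01)[d d0 ud]; apply: (@affine_continuous_at _ _ p d) => // x' x'd.
by have := ud x' y x'd; rewrite subrr normr0 mulr0 !addr0 mul1r; exact.
Qed.

Lemma has_grad_continuous2 u x y p q :
  has_grad u x y p q -> {for y, continuous (u x)}.
Proof.
move=> /(_ 1 ltr01)[d d0 ud]; apply: (@affine_continuous_at _ _ q d) => // y' y'd.
by have := ud x y'; rewrite subrr normr0 mulr0 !add0r mul1r; exact.
Qed.

(* Goursat's bisection argument for the divergence-free field [(u, - v)]: no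
   continuity of the partial derivatives is needed. *)
Theorem goursat_rectangle (u v : R -> R -> R) (x1 x2 y1 y2 : R) :
  x1 <= x2 -> y1 <= y2 ->
  (forall x y, x1 <= x <= x2 -> y1 <= y <= y2 -> exists p q r,
     has_grad u x y p q /\ has_grad v x y r p) ->
  \int[mu]_(t in `[y1, y2]) (u x2 t - u x1 t) =
  \int[mu]_(t in `[x1, x2]) (v t y2 - v t y1).
Proof.
move=> x12 y12 uv.
have uc x y : x1 <= x <= x2 -> y1 <= y <= y2 -> {for y, continuous (u x)}.
  by move=> hx hy; have [p [q [r [/has_grad_continuous2]]]] := uv _ _ hx hy.
have vc x y : x1 <= x <= x2 -> y1 <= y <= y2 -> {for x, continuous (v^~ y)}.
  by move=> hx hy; have [p [q [r [_ /has_grad_continuous1]]]] := uv _ _ hx hy.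
have ui x c d : x1 <= x <= x2 -> y1 <= c -> d <= y2 ->
    mu.-integrable `[c, d] (EFin \o u x).
  move=> hx hc hd; apply: continuous_segment_integrable => t ht.
  by apply: uc => //; lra.
have vi y a b : y1 <= y <= y2 -> x1 <= a -> b <= x2 ->
    mu.-integrable `[a, b] (EFin \o v^~ y).
  move=> hy ha hb; apply: (@continuous_segment_integrable _ (v^~ y)) => t ht.
  by apply: vc => //; lra.
pose J a b c d := (I c d (u b) - I c d (u a)) - (I a b (v^~ d) - I a b (v^~ c)).
have JE a b c d : x1 <= a <= b -> b <= x2 -> y1 <= c <= d -> d <= y2 ->
    J a b c d = I c d (fun t => u b t - u a t) - I a b (fun t => v t d - v t c).
  move=> h1 h2 h3 h4; rewrite /J !RintegralB//; first [apply: ui|apply: vi]; lra.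
(* [J] is the flux through the boundary, additive under quartering. The squared half-perimeter is
   additive too, as each quarter has half the half-perimeter, so the bound passes from the four
   quarters to the whole. *)
suff J0 e : 0 < e -> `|J x1 x2 y1 y2| <= e * ((x2 - x1) + (y2 - y1)) ^+ 2.
  apply/eqP; rewrite -subr_eq0 -JE ?lexx ?x12 ?y12// -normr_le0.
  set s := (x2 - x1 + (y2 - y1)) ^+ 2 in J0.
  apply/ler_addgt0Pr => e e0; rewrite add0r.
  have s0 : 0 < s + 1 by rewrite ltr_wpDl// sqr_ge0.
  apply: le_trans (J0 (e / (s + 1)) _) _; first by rewrite divr_gt0.
  by rewrite mulrAC ler_pdivrMr// ler_pM2l// lerDl.
move=> e0.
pose P a b c d := x1 <= a -> b <= x2 -> y1 <= c -> d <= y2 ->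
  `|J a b c d| <= e * ((b - a) + (d - c)) ^+ 2.
suff: P x1 x2 y1 y2 by apply.
apply: rect_bisection => //.
  move=> a b c d ab cd.
  set m := (a + b) / 2; set n := (c + d) / 2 => P1 P2 P3 P4 h1 h2 h3 h4.
  have [am mb] : a <= m /\ m <= b by rewrite /m; lra.
  have [cn nd] : c <= n /\ n <= d by rewrite /n; lra.
  have : J a b c d = J a m c n + J a m n d + J m b c n + J m b n d.
    rewrite /J.
    rewrite (@segment_integral_split _ (u b) c n d)//; last by apply: ui; lra.
    rewrite (@segment_integral_split _ (u a) c n d)//; last by apply: ui; lra.
    rewrite (@segment_integral_split _ (v^~ d) a m b)//; last by apply: vi; lra.
    rewrite (@segment_integral_split _ (v^~ c) a m b)//; last by apply: vi; lra.
    by ring.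
  move=> ->.
  have -> : e * (b - a + (d - c)) ^+ 2 = e * (m - a + (n - c)) ^+ 2 +
    e * (m - a + (d - n)) ^+ 2 + e * (b - m + (n - c)) ^+ 2 +
    e * (b - m + (d - n)) ^+ 2 by rewrite /m /n; field.
  have := P1 h1 (le_trans mb h2) h3 (le_trans nd h4).
  have := P2 h1 (le_trans mb h2) (le_trans h3 cn) h4.
  have := P3 (le_trans h1 am) h2 h3 (le_trans nd h4).
  have := P4 (le_trans h1 am) h2 (le_trans h3 cn) h4.
  move=> q4 q3 q2 q1.
  by do 3 (apply: le_trans (ler_normD _ _) _; apply: lerD => //).
move=> x y hx hy; have [p [q [r [ug vg]]]] := uv _ _ hx hy.
have e40 : 0 < e / 4 by rewrite divr_gt0.
have [d1 d10 ud] := ug _ e40; have [d2 d20 vd] := vg _ e40.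
exists (Num.min d1 d2); first by rewrite lt_min d10.
move=> a b c d h1 h2 h3 h4 /andP[ax xb] /andP[cy yd].
rewrite !lt_min => /andP[bd1 bd2] /andP[dd1 dd2] _ _ _ _.
rewrite JE ?h1 ?h2 ?h3 ?h4 ?(le_trans ax xb) ?(le_trans cy yd)//.
set s := b - a + (d - c).
have [ab cd] : a <= b /\ c <= d by split; [exact: le_trans xb|exact: le_trans yd].
have xa : x1 <= a <= x2 by rewrite h1 (le_trans ab).
have xb' : x1 <= b <= x2 by rewrite (le_trans h1 ab).
have yc : y1 <= c <= y2 by rewrite h3 (le_trans cd).
have yd' : y1 <= d <= y2 by rewrite (le_trans h3 cd).
have near1 x' y' : a <= x' <= b -> c <= y' <= d ->
    `|u x' y' - u x y - (p * (x' - x) + q * (y' - y))| <= e / 4 * s /\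
    `|v x' y' - v x y - (r * (x' - x) + p * (y' - y))| <= e / 4 * s.
  move=> hx' hy'.
  have l1 : `|x' - x| <= b - a by rewrite ler_norml; lra.
  have l2 : `|y' - y| <= d - c by rewrite ler_norml; lra.
  have l3 : e / 4 * (`|x' - x| + `|y' - y|) <= e / 4 * s.
    by rewrite ler_pM2l// lerD.
  split; apply: le_trans l3.
    by apply: ud; [exact: le_lt_trans bd1|exact: le_lt_trans dd1].
  by apply: vd; [exact: le_lt_trans bd2|exact: le_lt_trans dd2].
(* Up to a small error each of the two fluxes is [p] times the area, with the same [p]: this is
   where the relation between the two gradients is used, and the main terms cancel. *)
have E1 : `|I c d (fun t => u b t - u a t) - (p * (b - a)) * (d - c)|
    <= (e / 2 * s) * (d - c).
  apply: segment_integral_near => //.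
    rewrite (_ : _ \o _ = (EFin \o u b) \- (EFin \o u a))%E//.
    by apply: integrableB => //; exact: ui.
  move=> t ht.
  have [] := near1 b t _ ht; first by rewrite ab lexx.
  move=> k1 _; have [] := near1 a t _ ht; first by rewrite ab lexx.
  move=> k2 _; rewrite [X in `|X|](_ : _ =
    (u b t - u x y - (p * (b - x) + q * (t - y))) -
    (u a t - u x y - (p * (a - x) + q * (t - y)))); last by ring.
  rewrite (le_trans (ler_normB _ _))// (le_trans (lerD k1 k2))//.
  by rewrite -mulrDl (_ : e / 4 + e / 4 = e / 2)//; field.
have E2 : `|I a b (fun t => v t d - v t c) - (p * (d - c)) * (b - a)|
    <= (e / 2 * s) * (b - a).
  apply: segment_integral_near => //.
    rewrite (_ : _ \o _ = (EFin \o (v^~ d)) \- (EFin \o (v^~ c)))%E//.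
    by apply: integrableB => //; exact: vi.
  move=> t ht.
  have [] := near1 t d ht; first by rewrite cd lexx.
  move=> _ k1; have [] := near1 t c ht; first by rewrite cd lexx.
  move=> _ k2; rewrite [X in `|X|](_ : _ =
    (v t d - v x y - (r * (t - x) + p * (d - y))) -
    (v t c - v x y - (r * (t - x) + p * (c - y)))); last by ring.
  rewrite (le_trans (ler_normB _ _))// (le_trans (lerD k1 k2))//.
  by rewrite -mulrDl (_ : e / 4 + e / 4 = e / 2)//; field.
rewrite [X in `|X|](_ : _ =
  (I c d (fun t => u b t - u a t) - p * (b - a) * (d - c)) -
  (I a b (fun t => v t d - v t c) - p * (d - c) * (b - a))); last by ring.
apply: le_trans (ler_normB _ _) _; apply: le_trans (lerD E1 E2) _.
have -> : e / 2 * s * (d - c) + e / 2 * s * (b - a) = e / 2 * s ^+ 2.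
  by rewrite /s; ring.
rewrite ler_wpM2r ?sqr_ge0//.
by move: e0; clear; lra.
Qed.

End goursat.

(** * Circle means in polar coordinates *)

Section circle_mean.
Context {R : realType}.
Local Notation C := R[i].
Local Notation normc := (@Normc.normc R).
Local Notation Re := (@complex.Re R).
Local Notation Im := (@complex.Im R).
Local Notation mu := (@lebesgue_measure R).
Implicit Types (g p q : C -> C) (z : C) (h : R -> R).

(** The pair of real parameters (x', y') is encoded as the complex number [x' +i* y'], so that
    [ccont] also expresses continuity of the slopes in two real variables. The increment formula is
    asked for only when x' is near x, since the polar slopes divide by x'. *)
Lemma has_grad_Re (u : R -> R -> R) (p q : C -> C) (x y d : R) : 0 < d ->
  (forall x' y', `|x' - x| < d -> u x' y' - u x y =
     Re (p (x' +i* y')%C) * (x' - x) + Re (q (x' +i* y')%C) * (y' - y)) ->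
  ccont p (x +i* y)%C -> ccont q (x +i* y)%C ->
  has_grad u x y (Re (p (x +i* y)%C)) (Re (q (x +i* y)%C)).
Proof.
move=> d0 uE cp cq e e0.
have [d1 d10 pd] := cp _ e0; have [d2 d20 qd] := cq _ e0.
exists (Num.min d (Num.min (d1 / 2) (d2 / 2))).
  by rewrite !lt_min d0 !divr_gt0.
move=> x' y'; rewrite !lt_min => /and3P[xd x1 x2] /and3P[_ y1 y2].
rewrite uE// [X in `|X|](_ : _ =
  (Re (p (x' +i* y')%C) - Re (p (x +i* y)%C)) * (x' - x) +
  (Re (q (x' +i* y')%C) - Re (q (x +i* y)%C)) * (y' - y)); last by ring.
rewrite (le_trans (ler_normD _ _))// [leRHS]mulrDr !normrM.
have xy : normc ((x' +i* y') - (x +i* y))%C <= `|x' - x| + `|y' - y|.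
  exact: le_trans (normc_le_ReIm _) _.
rewrite -!ReB lerD// ler_wpM2r// (le_trans (normc_Re _))// ltW//.
  by apply: pd; apply: le_lt_trans xy _; lra.
by apply: qd; apply: le_lt_trans xy _; lra.
Qed.

(** The real counterpart of the slope form of [cdiff], needed to combine the derivatives of [cos]
    and [sin] with complex slopes. *)
Lemma is_derive_slope h (x l : R) : is_derive x 1 h l ->
  exists q : R -> R, [/\ q x = l, forall t, h t - h x = q t * (t - x) &
   forall e, 0 < e -> exists2 d, 0 < d &
     forall t, `|t - x| < d -> `|q t - q x| < e].
Proof.
move=> [hd hl].
exists (fun t => if t == x then l else (h t - h x) / (t - x)).
split=> [|t|e e0]; first by rewrite eqxx.
  by have [->|tx] := eqVneq t x; rewrite ?subrr ?mulr0// mulfVK// subr_eq0.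
have := hd; rewrite /derivable => /cvgrPdist_lt /(_ e e0)[d /= d0 dh].
exists d => // t td; rewrite eqxx; have [_|tx] := eqVneq t x.
  by rewrite subrr normr0.
have := dh (t - x); rewrite /= sub0r normrN => /(_ td).
rewrite subr_eq0 tx => /(_ isT).
rewrite -[X in `|X - _|]/('D_1 h x) hl distrC.
by rewrite [_ *: 1](_ : _ = t - x) ?subrK 1?[_ *: (_ - _)]mulrC// /GRing.scale/= mulr1.
Qed.

Lemma expi_slope (y : R) : exists p : R -> C,
  [/\ p y = (0 +i* (2 * pi))%C * expi y, forall t, expi t - expi y = p t * (t - y)%:C%C &
  forall x : R, ccont (fun w => p (Im w)) (x +i* y)%C].
Proof.
have dl : is_derive y 1 (fun t => 2 * pi * t) (2 * pi).
  rewrite -[X in is_derive _ _ _ X]mulr1.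
  exact: (@is_deriveZ _ _ _ id (2 * pi : R)).
have dc := @is_derive1_comp _ cos (fun t => 2 * pi * t) _ _ _ (is_derive_cos _) dl.
have ds := @is_derive1_comp _ sin (fun t => 2 * pi * t) _ _ _ (is_derive_sin _) dl.
have [c [cl cE cc]] := is_derive_slope dc.
have [s [sl sE sc]] := is_derive_slope ds.
exists (fun t => (c t +i* s t)%C); split.
- by rewrite cl sl; apply: complexP; rewrite /expi ?ReM ?ImM/=; ring.
- move=> t; apply: complexP.
    by rewrite ReM ReB /= mulr0 subr0 cE.
  by rewrite ImM ImB /= mulr0 add0r sE.
- move=> x e e0; have [d1 d10 cd] := cc _ (divr_gt0 e0 (ltr0n _ 2)).
  have [d2 d20 sd] := sc _ (divr_gt0 e0 (ltr0n _ 2)).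
  exists (Num.min d1 d2); first by rewrite lt_min d10.
  move=> w; rewrite lt_min => /andP[w1 w2].
  have wy : `|Im w - y| <= normc (w - (x +i* y)%C).
    by have := normc_Im (w - (x +i* y)%C); rewrite ImB.
  rewrite (le_lt_trans (normc_le_ReIm _))// (splitr e) ltrD//.
    exact/cd/(le_lt_trans wy).
  exact/sd/(le_lt_trans wy).
Qed.

Lemma ccont_ReC z : ccont (fun w => (Re w)%:C%C) z.
Proof.
move=> e e0; exists e => // w we.
rewrite (_ : (Re w)%:C%C - _ = (Re (w - z))%:C%C); last first.
  by apply: complexP => /=; rewrite ?ReB ?subrr.
by rewrite normc_real (le_lt_trans (normc_Re _)).
Qed.

(** The Cauchy-Riemann equation in polar form: if G(x, y) is the value of [g] at x exp(2 pi i y),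
    then the y-derivative of G is 2 pi i x times its x-derivative. Dividing by 2 pi i x gives a
    function whose y-derivative is the x-derivative of G, which is the relation between [u] and [v]
    in Goursat's theorem. *)
Lemma has_grad_polar g (x y : R) : 0 < x -> cdiff g (x%:C%C * expi y) ->
  exists a b c : R, has_grad (fun x y => Re (g (x%:C%C * expi y))) x y a b /\
    has_grad (fun x y => Re (g (x%:C%C * expi y) / (0 +i* (2 * pi * x))%C)) x y c a.
Proof.
move=> x0 [phi cphi phiE]; have [psi [psiy psiE cpsi]] := expi_slope y.
pose w (t : C) := (Re t)%:C%C * expi (Im t).
pose k (x : R) : C := (0 +i* (2 * pi * x))%C^-1.
have px : (2 * pi * x) != 0 by rewrite !mulf_neq0 ?pnatr_eq0// gt_eqF// pi_gt0.
have p0' : (0 +i* (2 * pi))%C != 0 :> C.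
  by rewrite eq_complex /= eqxx mulf_neq0 ?pnatr_eq0// lt0r_neq0// pi_gt0.
have cpsi1 := cpsi x.
have ce : ccont (fun t : C => expi (Im t)) (x +i* y)%C.
  rewrite (_ : (fun t : C => _) = (fun t : C => psi (Im t) * ((Im t) - y)%:C%C + expi y)).
    apply: ccontD (ccont_cst _ _); apply: ccontM => //.
    move=> e e0; exists e => // t te.
    rewrite (_ : _ - _ = (Im t - y)%:C%C); last by apply: complexP => /=; ring.
    rewrite normc_real.
    have := normc_Im (t - (x +i* y)%C); rewrite ImB => h.
    exact: le_lt_trans te.
  by apply/funext => t; rewrite -psiE subrK.
have cw : ccont w (x +i* y)%C by apply: ccontM => //; exact: ccont_ReC.
have cphiw : ccont (fun t => phi (w t)) (x +i* y)%C by apply: (@ccont_comp _ phi w).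
have ck : ccont (fun t => k (Re t)) (x +i* y)%C.
  apply: (@ccontV _ (fun t => (0 +i* (2 * pi * Re t))%C)); last first.
    by rewrite eq_complex /= eqxx.
  rewrite (_ : (fun t : C => _) = (fun t : C => (0 +i* (2 * pi))%C * (Re t)%:C%C)).
    by apply: ccontM (ccont_cst _ _) (ccont_ReC _).
  by apply/funext => t; apply: complexP; rewrite ?ReM ?ImM/=; ring.
have wE (x' y' : R) : w (x' +i* y')%C - x%:C%C * expi y =
    expi y' * (x' - x)%:C%C + x%:C%C * psi y' * (y' - y)%:C%C.
  rewrite -mulrA -psiE /w /= (_ : (x' - x)%:C%C = x'%:C%C - x%:C%C); first by ring.
  by apply: complexP => /=; ring.
(* [p], [q] are the slopes of the composite in x and y; [p'], [q'] are those after division by 2 pi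
   i x. The second term of [p'] comes from [k x' - k x = - k x' * (x' - x) / x]. *)
pose p t := phi (w t) * expi (Im t).
pose q t := phi (w t) * (x%:C%C * psi (Im t)).
pose p' t := p t * k (Re t) - g (x%:C%C * expi y) * (k (Re t) * (x%:C%C)^-1).
pose q' t := q t * k (Re t).
have q'E : q' (x +i* y)%C = p (x +i* y)%C.
  rewrite /q' /q /p /k /w /= psiy.
  rewrite [(0 +i* (2 * pi * x))%C](_ : _ = x%:C%C * (0 +i* (2 * pi))%C).
    have x0' : x%:C%C != 0 :> C by rewrite eq_complex /= gt_eqF.
    by field; rewrite x0' p0'.
  by apply: complexP; rewrite ?ReM ?ImM/=; ring.
exists (Re (p (x +i* y)%C)), (Re (q (x +i* y)%C)), (Re (p' (x +i* y)%C)).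
have ReMr (a : C) (s : R) : Re (a * s%:C%C) = Re a * s by rewrite ReM /= mulr0 subr0.
split.
  apply: (@has_grad_Re _ p q x y x) => //; last 2 first.
  - exact: ccontM.
  - by apply: ccontM => //; apply: ccontM (ccont_cst _ _) _.
  move=> x' y' _; rewrite -ReB phiE wE -!ReMr -ReD /p /q /=; congr Re; ring.
rewrite -q'E.
apply: (@has_grad_Re _ p' q' x y x) => //; last 2 first.
- apply: ccontB; apply: ccontM => //; [exact: ccontM|exact: ccont_cst|].
  by apply: ccontM (ccont_cst _ _).
- by apply: ccontM => //; apply: ccontM => //; apply: ccontM (ccont_cst _ _) _.
move=> x' y' x'x; have x'0 : x' != 0.
  by apply/eqP => x'0; move: x'x; rewrite x'0 sub0r normrN gtr0_norm// ltxx.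
rewrite -!ReMr -ReB -ReD; congr Re.
rewrite -[g (x'%:C%C * _)](subrK (g (x%:C%C * expi y))) phiE (wE x' y').
rewrite /p' /q' /p /q /=.
have kE (s : R) : s != 0 -> k s = (0 +i* (2 * pi))%C^-1 * (s%:C%C)^-1.
  move=> s0; rewrite -invfM /k; congr (_^-1).
  by apply: complexP; rewrite ?ReM ?ImM/=; ring.
rewrite -/(k x') -/(k x) (kE _ x'0) kE ?gt_eqF//.
have x0' : x%:C%C != 0 :> C by rewrite eq_complex /= gt_eqF.
have x'0' : x'%:C%C != 0 :> C by rewrite eq_complex /= negb_and x'0.
rewrite (_ : (x' - x)%:C%C = x'%:C%C - x%:C%C); last first.
  by apply: complexP => /=; ring.
by field; rewrite x0' x'0' p0'.
Qed.

Local Notation mean h := (\int[mu]_(t in `[0, 1[) h t).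

Lemma continuous_integrable01 h : continuous h ->
  mu.-integrable `[0, 1[ (EFin \o h).
Proof.
move=> ch; have : mu.-integrable `[0, 1] (EFin \o h).
  by apply: continuous_segment_integrable => t _; exact: ch.
by apply: integrableS => //; apply: subset_itv; rewrite bnd_simp.
Qed.

Lemma mean01E h : continuous h -> mean h = \int[mu]_(t in `[0, 1]) h t.
Proof. by move=> ch; rewrite -Rintegral_itv_bndo_bndc//; exact: continuous_integrable01. Qed.

Lemma mean_cst (k : R) : mean (cst k) = k.
Proof.
rewrite mean01E; last by move=> ?; exact: cst_continuous.
by rewrite segment_integral_cst// subr0 mulr1.
Qed.

Lemma expi_ccont (x y : R) : ccont (fun t : C => expi (Im t)) (x +i* y)%C.
Proof.
have [p [_ pE cp]] := expi_slope y.
rewrite (_ : (fun t : C => _) = (fun t : C => p (Im t) * ((Im t) - y)%:C%C + expi y)).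
  apply: ccontD (ccont_cst _ _); apply: ccontM => //.
  move=> e e0; exists e => // t te.
  rewrite (_ : _ - _ = (Im t - y)%:C%C); last by apply: complexP => /=; ring.
  rewrite normc_real; have := normc_Im (t - (x +i* y)%C); rewrite ImB => h.
  exact: le_lt_trans te.
by apply/funext => t; rewrite -pE subrK.
Qed.

Lemma expi_cont (y e : R) : 0 < e ->
  exists2 d : R, 0 < d & forall t, `|t - y| < d -> normc (expi t - expi y) < e.
Proof.
move=> /(@expi_ccont 0 y)[d d0 hd]; exists d => // t td.
apply: (hd (0 +i* t)%C); rewrite (_ : _ - _ = (0 +i* (t - y))%C).
  by apply: le_lt_trans td; rewrite (le_trans (normc_le_ReIm _))//= normr0 add0r.
by apply: complexP => /=; ring.
Qed.

Lemma circle_cont (z a : C) (y e : R) : 0 < e ->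
  exists2 d : R, 0 < d & forall t, `|t - y| < d ->
    normc ((z + a * expi t) - (z + a * expi y)) < e.
Proof.
move=> e0; have a0 : 0 < normc a + 1 by rewrite ltr_wpDl// normc_ge0.
have [d d0 hd] := expi_cont y (divr_gt0 e0 a0); exists d => // t /hd.
rewrite ltr_pdivlMr// => h; rewrite opprD addrACA subrr add0r -mulrBr Normc.normcM.
apply: le_lt_trans h; rewrite mulrC ler_wpM2l ?normc_ge0//; lra.
Qed.

Lemma continuous_circle (F : C -> R) (z a : C) :
  (forall t e, 0 < e -> exists2 d : R, 0 < d & forall w,
     normc (w - (z + a * expi t)) < d -> `|F w - F (z + a * expi t)| < e) ->
  continuous (fun t => F (z + a * expi t)).
Proof.
move=> cF t; apply/cvgrPdist_lt => e e0; have [d d0 hd] := cF t e e0.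
have [d' d'0 hd'] := circle_cont z a t d0.
by exists d' => // s /=; rewrite distrC => /hd'/hd; rewrite distrC.
Qed.

Lemma continuous_circle_Re g (z a : C) :
  (forall t, ccont g (z + a * expi t)) ->
  continuous (fun t => Re (g (z + a * expi t))).
Proof.
move=> cg; apply: (continuous_circle (F := Re \o g)) => t e /(cg t)[d d0 hd].
exists d => // w /hd; rewrite -ReB; exact/le_lt_trans/normc_Re.
Qed.

(** Goursat's theorem on the rectangle of radii in [r1, r2] and angles in [0, 1]: the sides of
    constant radius give the two means. *)
Lemma circle_mean_annulus g (r1 r2 : R) : 0 < r1 -> r1 <= r2 ->
  (forall z, r1 <= normc z <= r2 -> cdiff g z) ->
  mean (fun t => Re (g (r1%:C%C * expi t))) = mean (fun t => Re (g (r2%:C%C * expi t))).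
Proof.
move=> r10 r12 dg.
have nr (r t : R) : 0 < r -> normc (r%:C%C * expi t) = r.
  by move=> r0; rewrite Normc.normcM normc_real normc_expi mulr1 gtr0_norm.
have dgr (r t : R) : r1 <= r <= r2 -> cdiff g (r%:C%C * expi t).
  by move=> /andP[h1 h2]; apply: dg; rewrite nr ?h1// (lt_le_trans r10).
have cg (r : R) : r1 <= r <= r2 -> continuous (fun t => Re (g (r%:C%C * expi t))).
  move=> hr; have := @continuous_circle_Re g 0 r%:C%C.
  under eq_fun do rewrite add0r; apply => t; rewrite add0r.
  exact/cdiff_ccont/dgr.
have /cg c1 : r1 <= r1 <= r2 by rewrite lexx.
have /cg c2 : r1 <= r2 <= r2 by rewrite r12 lexx.
rewrite !mean01E; [|exact: c2|exact: c1].
have := @goursat_rectangle R (fun x y => Re (g (x%:C%C * expi y)))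
  (fun x y => Re (g (x%:C%C * expi y) / (0 +i* (2 * pi * x))%C)) r1 r2 0 1 r12 ler01.
(* Angles 0 and 1 are the same ray, so the other two sides cancel. *)
rewrite expi0 expi1 [X in (_ -> _ = X) -> _](_ : _ = 0); last first.
  by under eq_Rintegral do rewrite subrr; rewrite Rintegral_cst// mul0r.
move=> G; have {G} := G _; rewrite RintegralB//; last 2 first.
- by apply: continuous_segment_integrable => t _; exact: c2.
- by apply: continuous_segment_integrable => t _; exact: c1.
move=> G; apply/esym/eqP; rewrite -subr_eq0 G// => x y hx hy.
apply: has_grad_polar; [lra|exact: dgr].
Qed.

End circle_mean.

(** * The mean value property *)

Section mean_value.
Context {R : realType}.
Local Notation C := R[i].
Local Notation normc := (@Normc.normc R).
Local Notation Re := (@complex.Re R).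
Local Notation mu := (@lebesgue_measure R).
Local Notation mean h := (\int[mu]_(t in `[0, 1[) h t).
Implicit Types (g : C -> C) (z a : C) (h : R -> R).

Lemma le_mean h1 h2 : continuous h1 -> continuous h2 ->
  (forall t, 0 <= t < 1 -> h1 t <= h2 t) -> mean h1 <= mean h2.
Proof.
by move=> c1 c2 h12; apply: le_Rintegral => //; exact: continuous_integrable01.
Qed.

Lemma meanB h1 h2 : continuous h1 -> continuous h2 ->
  mean (fun t => h1 t - h2 t) = mean h1 - mean h2.
Proof. by move=> c1 c2; apply: RintegralB => //; exact: continuous_integrable01. Qed.

Lemma meanD h1 h2 : continuous h1 -> continuous h2 ->
  mean (fun t => h1 t + h2 t) = mean h1 + mean h2.
Proof. by move=> c1 c2; apply: RintegralD => //; exact: continuous_integrable01. Qed.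

Lemma meanZ k h : continuous h -> mean (fun t => k * h t) = k * mean h.
Proof. by move=> c1; apply: RintegralZl => //; exact: continuous_integrable01. Qed.

Lemma continuousD h1 h2 : continuous h1 -> continuous h2 ->
  continuous (fun t => h1 t + h2 t).
Proof. by move=> c1 c2 t; apply: cvgD; [exact: c1|exact: c2]. Qed.

Lemma continuousB h1 h2 : continuous h1 -> continuous h2 ->
  continuous (fun t => h1 t - h2 t).
Proof. by move=> c1 c2 t; apply: cvgB; [exact: c1|exact: c2]. Qed.

Lemma continuous_abs h : continuous h -> continuous (fun t => `|h t|).
Proof. by move=> c1 t; apply: cvg_norm; exact: c1. Qed.

Lemma mean_near h1 h2 e : continuous h1 -> continuous h2 ->
  (forall t, 0 <= t < 1 -> `|h1 t - h2 t| <= e) -> `|mean h1 - mean h2| <= e.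
Proof.
move=> c1 c2 he; rewrite -meanB//; have c12 := continuousB c1 c2.
rewrite (le_trans (le_normr_Rintegral _ (continuous_integrable01 c12)))//.
rewrite -[leRHS](@mean_cst R); apply: le_mean => //.
- exact: continuous_abs.
- by move=> ?; exact: cst_continuous.
Qed.

Lemma circle_uniform g z a : (forall t, ccont g (z + a * expi t)) ->
  forall e : R, 0 < e -> exists2 d : R, 0 < d & forall t w, 0 <= t <= 1 ->
    normc (w - (z + a * expi t)) < d -> normc (g w - g (z + a * expi t)) < e.
Proof.
move=> cg e e0.
pose P (x y _ _ : R) := exists2 d : R, 0 < d & forall t w, x <= t <= y ->
    normc (w - (z + a * expi t)) < d -> normc (g w - g (z + a * expi t)) < e.
suff: P 0 1 0 0 by [].
apply: rect_bisection => //.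
  move=> x y u v xy _ [d d0 hd] _ [d' d'0 hd'] _.
  exists (Num.min d d'); first by rewrite lt_min d0.
  move=> t w /andP[xt ty]; rewrite lt_min => /andP[w1 w2].
  have [tm|mt] := leP t ((x + y) / 2); first by apply: hd => //; rewrite xt.
  by apply: hd' => //; rewrite ltW.
move=> x v _ _; have [d d0 hd] := cg x _ (divr_gt0 e0 (ltr0n _ 2)).
have [d' d'0 hd'] := circle_cont z a x (divr_gt0 d0 (ltr0n _ 2)).
exists d' => // p q u1 u2 _ _ _ _ /andP[px xq] _ qp _; exists (d / 2).
  by rewrite divr_gt0.
move=> t w /andP[pt tq] wt.
have tx : normc (z + a * expi t - (z + a * expi x)) < d / 2.
  by apply: hd'; rewrite ltr_norml; lra.
have wx : normc (w - (z + a * expi x)) < d.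
  rewrite -[w](subrK (z + a * expi t)) -addrA (le_lt_trans (le_normcD _ _))//.
  by rewrite (splitr d) ltrD.
rewrite (_ : _ - _ = (g w - g (z + a * expi x)) -
  (g (z + a * expi t) - g (z + a * expi x))); last by ring.
rewrite (le_lt_trans (le_normcB _ _))// (splitr e) ltrD//; first exact: hd.
by apply: hd; apply: lt_trans tx _; lra.
Qed.

Lemma circle_mean_cont g (r : R) : (forall t, ccont g (0 + r%:C%C * expi t)) ->
  forall e : R, 0 < e -> exists2 d : R, 0 < d & forall s, `|s - r| < d ->
    (forall t, ccont g (0 + s%:C%C * expi t)) ->
    `|mean (fun t => Re (g (0 + s%:C%C * expi t))) -
      mean (fun t => Re (g (0 + r%:C%C * expi t)))| <= e.
Proof.
move=> cg e e0; have [d d0 hd] := circle_uniform cg e0.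
exists d => // s sr cs; apply: mean_near; try exact: continuous_circle_Re.
move=> t /andP[t0 t1]; rewrite -ReB (le_trans (normc_Re _))// ltW//.
apply: hd; first by rewrite t0 ltW.
rewrite (_ : _ - _ = (s - r)%:C%C * expi t).
  by rewrite Normc.normcM normc_expi normc_real mulr1.
by rewrite (_ : (s - r)%:C%C = s%:C%C - r%:C%C); [ring|
  apply: complexP => /=; ring].
Qed.

(* The circle [normc z = r0] may carry non-differentiability; this is what
   Cauchy's formula needs, with the difference quotient as [g]. *)
Lemma mean_value_except g (B r0 : R) :
  (forall z, normc z < B -> ccont g z) ->
  (forall z, normc z < B -> normc z != r0 -> cdiff g z) ->
  forall r : R, 0 <= r < B -> mean (fun t => Re (g (r%:C%C * expi t))) = Re (g 0).
Proof.
move=> cg dg r /andP[r_ge0 rB].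
pose M (r : R) := mean (fun t => Re (g (0 + r%:C%C * expi t))).
have nr (s t : R) : 0 <= s -> normc (s%:C%C * expi t) = s.
  by move=> s0; rewrite Normc.normcM normc_real normc_expi mulr1 ger0_norm.
have M0 : M 0 = Re (g 0).
  rewrite /M -[RHS](@mean_cst R); apply: eq_Rintegral => t _.
  by rewrite mul0r addr0.
have cgr (s t : R) : 0 <= s < B -> ccont g (0 + s%:C%C * expi t).
  by move=> /andP[s0 sB]; apply: cg; rewrite add0r nr.
have ME (s : R) : M s = mean (fun t => Re (g (s%:C%C * expi t))).
  by rewrite /M; under eq_Rintegral do rewrite add0r.
have cst (s1 s2 : R) : 0 < s1 -> s1 <= s2 -> s2 < B ->
    (forall x, s1 <= x <= s2 -> x != r0) -> M s1 = M s2.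
  move=> s10 s12 s2B hx; rewrite !ME.
  apply: circle_mean_annulus => // z /andP[z1 z2].
  by apply: dg; [exact: le_lt_trans s2B|apply: hx; rewrite z1].
have eqM (s1 s2 : R) : (forall e, 0 < e -> `|M s1 - M s2| <= e) -> M s1 = M s2.
  by move=> h; apply/eqP; rewrite -subr_eq0 -normr_le0; apply/ler_addgt0Pr => e /h;
    rewrite add0r.
(* The annulus argument gives constancy of [M] only on positive radii other than [r0]; continuity of
   [M] extends it to an end radius, here on the left, where [s1] may be 0 or [r0], and below in
   [liml] on the right. *)
have limr (s1 s2 : R) : 0 <= s1 -> s1 < s2 -> s2 < B ->
    (forall x, s1 < x <= s2 -> x != r0) -> M s1 = M s2.
  move=> s10 s12 s2B hx; apply/esym/eqM => e e0.
  have s1B : 0 <= s1 < B by rewrite s10 (lt_trans s12).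
  have [d d0 hd] := circle_mean_cont (cgr s1 ^~ s1B) e0.
  pose s := s1 + Num.min (d / 2) (s2 - s1).
  have h1 : 0 < Num.min (d / 2) (s2 - s1) by rewrite lt_min divr_gt0// subr_gt0.
  have h2 : Num.min (d / 2) (s2 - s1) <= d / 2 by rewrite ge_min lexx.
  have h3 : Num.min (d / 2) (s2 - s1) <= s2 - s1 by rewrite ge_min lexx orbT.
  have s1s : s1 < s by rewrite ltrDl.
  have ss2 : s <= s2 by rewrite /s; lra.
  rewrite -(@cst s s2)//; first last.
  - by move=> x /andP[sx xs]; apply: hx; rewrite xs (lt_le_trans s1s).
  - exact: le_lt_trans s1s.
  apply: hd; first by rewrite /s addrAC subrr add0r gtr0_norm//; lra.
  by move=> t; apply: cgr; rewrite (le_trans s10 (ltW s1s)) (le_lt_trans ss2).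
have liml (s1 s2 : R) : 0 < s1 -> s1 < s2 -> s2 < B ->
    (forall x, s1 <= x < s2 -> x != r0) -> M s1 = M s2.
  move=> s10 s12 s2B hx; apply/eqM => e e0.
  have s2B' : 0 <= s2 < B by rewrite s2B (le_trans (ltW s10)) ?ltW.
  have [d d0 hd] := circle_mean_cont (cgr s2 ^~ s2B') e0.
  pose s := s2 - Num.min (d / 2) (s2 - s1).
  have h1 : 0 < Num.min (d / 2) (s2 - s1) by rewrite lt_min divr_gt0// subr_gt0.
  have h2 : Num.min (d / 2) (s2 - s1) <= d / 2 by rewrite ge_min lexx.
  have h3 : Num.min (d / 2) (s2 - s1) <= s2 - s1 by rewrite ge_min lexx orbT.
  have s1s : s < s2 by rewrite ltrBlDr ltrDl.
  have ss2 : s1 <= s by rewrite /s; lra.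
  rewrite (@cst s1 s)//; first last.
  - by move=> x /andP[sx xs]; apply: hx; rewrite sx (le_lt_trans xs).
  - exact: lt_trans s2B.
  apply: hd; first by rewrite distrC /s opprB addrCA subrr addr0 gtr0_norm//; lra.
  move=> t; apply: cgr; rewrite (lt_trans s1s)// andbT.
  exact: le_trans (ltW s10) _.
suff : M r = M 0.
  by rewrite M0 ME.
move: r_ge0; rewrite le_eqVlt => /predU1P[<-//|r_gt0].
have [/andP[r00 r0r]|nr0] := boolP (0 < r0 <= r); last first.
  apply/esym/limr => // x /andP[x0 xr]; apply: contra nr0 => /eqP <-.
  by rewrite x0.
have r02 : 0 < r0 / 2 by rewrite divr_gt0.
have r0B : r0 < B by exact: le_lt_trans rB.
have -> : M 0 = M (r0 / 2).
  apply: limr => //; first by lra.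
  by move=> x hx; apply/eqP => xr; lra.
have -> : M (r0 / 2) = M r0.
  apply: liml => //; first by lra.
  by move=> x hx; apply/eqP => xr; lra.
move: r0r; rewrite le_eqVlt => /predU1P[<-//|r0r].
by apply/esym/limr => //; [exact: ltW|move=> x /andP[x0 xr]; rewrite gt_eqF].
Qed.

Lemma mean_value g (B : R) : (forall z, normc z < B -> cdiff g z) ->
  forall r : R, 0 <= r < B -> mean (fun t => Re (g (r%:C%C * expi t))) = Re (g 0).
Proof.
move=> dg; apply: (@mean_value_except g B 0) => z zB; first exact/cdiff_ccont/dg.
by move=> _; exact: dg.
Qed.

Lemma mean_value_at g z (B : R) : (forall w, normc (w - z) < B -> cdiff g w) ->
  forall r : R, 0 <= r < B -> mean (fun t => Re (g (z + r%:C%C * expi t))) = Re (g z).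
Proof.
move=> dg r rB; rewrite -[in RHS](addr0 z).
apply: (@mean_value (fun w => g (z + w)) B) => // w wB.
apply: (@cdiff_comp _ g (fun w => z + w)).
  by apply: cdiffD; [exact: cdiff_cst|exact: cdiff_id].
by apply: dg; rewrite addrAC subrr add0r.
Qed.

End mean_value.

(** * The Schwarz formula *)
Section schwarz.
Context {R : realType}.
Local Notation C := R[i].
Local Notation normc := (@Normc.normc R).
Local Notation Re := (@complex.Re R).
Local Notation Im := (@complex.Im R).
Local Notation mu := (@lebesgue_measure R).
Local Notation mean h := (\int[mu]_(t in `[0, 1[) h t).
Implicit Types (f g : C -> C) (z w a : C) (h : R -> R).

Lemma cdiff_near f g z (d : R) : 0 < d ->
  (forall w, normc (w - z) < d -> f w = g w) -> cdiff g z -> cdiff f z.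
Proof.
move=> d0 fg [p cp pE].
exists (fun w => if normc (w - z) < d then p w else (f w - f z) / (w - z)).
  move=> e /cp[d' d'0 hp]; exists (Num.min d d'); first by rewrite lt_min d0.
  move=> w; rewrite lt_min => /andP[wd /hp].
  by rewrite wd subrr Normc.normc0 d0.
move=> w; case: ifPn => [wd|].
  by rewrite !fg ?pE// subrr Normc.normc0.
rewrite -leNgt => dw; rewrite mulfVK// -normc_gt0; exact: lt_le_trans dw.
Qed.

Definition herglotz z (t : R) : C := (expi t + z) / (expi t - z).

Lemma expi_neq z (t : R) : normc z < 1 -> expi t - z != 0.
Proof.
move=> z1; rewrite -normc_gt0; have := normc_dist (expi t) z.
rewrite normc_expi; lra.
Qed.

Lemma Re_conj z : Re (z^*)%C = Re z.
Proof. by case: z. Qed.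

Lemma conjcM z w : conjc (z * w) = conjc z * conjc w.
Proof. by case: z w => [? ?] [? ?]; apply: complexP => /=; ring. Qed.

Lemma conjcD z w : conjc (z + w) = conjc z + conjc w.
Proof. by case: z w => [? ?] [? ?]; apply: complexP => /=; ring. Qed.

Lemma addc_conj z : z + conjc z = (2 * Re z)%:C%C.
Proof. by case: z => ? ?; apply: complexP => /=; ring. Qed.

Lemma continuous_expi_Re g : (forall t, ccont g (expi t)) ->
  continuous (fun t => Re (g (expi t))).
Proof.
move=> cg; have := @continuous_circle_Re _ g 0 1.
by under eq_fun do rewrite add0r mul1r; apply => t; rewrite add0r mul1r.
Qed.

(** The integrand is the real part on the circle of a function [F] that is continuous on a larger
    disc and differentiable off [z], so the integral is [Re (F 0)]. Conjugating the middle term of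
    [F], which keeps its real part, turns [1 - z^* w] into [(w - z) / w] on the circle; the two
    singular terms then combine to [c * (w / (w - z))] times [g w] plus its conjugate, which is
    twice [Re (g w)]. The free factor [c] gives the real part of [g z] with 1 and the imaginary part
    with -i. *)
Theorem schwarz_formula g (B : R) z (c : C) : 1 < B ->
  (forall w, normc w < B -> cdiff g w) -> normc z < 1 ->
  mean (fun t => Re (g (expi t)) * Re (c * herglotz z t)) =
  Re (c * g z) + Im c * Im (g 0).
Proof.
move=> B1 dg z1; have [p cp pE] := dg _ (lt_trans z1 B1).
pose F w := c * (p w * w) +
  (((c * g z)^*)%C + (c^*)%C * g w) / (1 - (z^*)%C * w) - (Re c)%:C%C * g w.
(* The radius 2 / (1 + |z|) exceeds 1, but its product with |z| is less than 1, so [1 - z^* w] has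
   no zero in the disc of radius [B']. *)
pose B' := Num.min B (2 / (1 + normc z)).
have nz := normc_ge0 z.
have B'1 : 1 < B' by rewrite lt_min B1 ltr_pdivlMr; lra.
have B'B w : normc w < B' -> normc w < B by rewrite lt_min => /andP[].
have den w : normc w < B' -> 1 - (z^*)%C * w != 0.
  rewrite lt_min => /andP[_ wz]; apply/eqP => /eqP; rewrite subr_eq0 => /eqP zw.
  have : normc ((z^*)%C * w) = 1 by rewrite -zw Normc.normc1.
  rewrite Normc.normcM normc_conj => zw1.
  have : normc z * normc w <= normc z * (2 / (1 + normc z)).
    by rewrite ler_wpM2l// ltW.
  rewrite zw1 mulrA ler_pdivlMr; lra.
have dG w : normc w < B' -> cdiff (fun w =>
    (((c * g z)^*)%C + (c^*)%C * g w) / (1 - (z^*)%C * w) - (Re c)%:C%C * g w) w.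
  move=> wB; have dgw := dg _ (B'B _ wB); apply: cdiffB; last first.
    by apply: cdiffM => //; exact: cdiff_cst.
  apply: cdiffM.
    by apply: cdiffD; [|apply: cdiffM]; rewrite //; exact: cdiff_cst.
  apply: cdiffV; last exact: den.
  apply: cdiffB; [exact: cdiff_cst|apply: cdiffM; [exact: cdiff_cst|exact: cdiff_id]].
have pdq w : w != z -> p w = (g w - g z) / (w - z).
  by move=> wz; rewrite pE mulfK// subr_eq0.
have dp w : normc w < B' -> w != z -> cdiff p w.
  move=> wB wz; have nwz : 0 < normc (w - z) by rewrite normc_gt0 subr_eq0.
  apply: (@cdiff_near _ (fun w => (g w - g z) / (w - z)) _ _ nwz).
    move=> v vw; apply: pdq; apply/eqP => vz; move: vw.
    by rewrite vz normcB ltxx.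
  apply: cdiffM.
    by apply: cdiffB; [exact/dg/B'B|exact: cdiff_cst].
  apply: cdiffV; last by rewrite subr_eq0.
  by apply: cdiffB; [exact: cdiff_id|exact: cdiff_cst].
have cpw w : normc w < B' -> ccont p w.
  by move=> wB; have [->//|wz] := eqVneq w z; exact/cdiff_ccont/dp.
have cF w : normc w < B' -> ccont F w.
  move=> wB; rewrite /F; under eq_fun do rewrite -addrA.
  apply: ccontD; last exact/cdiff_ccont/dG.
  apply: ccontM; [exact: ccont_cst|apply: ccontM; [exact: cpw|exact: ccont_id]].
have dF w : normc w < B' -> normc w != normc z -> cdiff F w.
  move=> wB wz; rewrite /F; under eq_fun do rewrite -addrA.
  apply: cdiffD; last exact/dG.
  apply: cdiffM; [exact: cdiff_cst|apply: cdiffM; [apply: dp|exact: cdiff_id]] => //.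
  by apply: contra wz => /eqP ->.
have := @mean_value_except _ F B' (normc z) cF dF 1.
rewrite ler01 B'1 => /(_ isT) MF.
transitivity (Re (F 0)); last first.
  rewrite /F !mulr0 subr0 add0r divr1 !(ReB, ReD) Re_conj !ReM /=.
  by case: c {F dG cF dF MF} => ? ? /=; ring.
rewrite -MF; apply: eq_Rintegral => t _; rewrite mul1r /F /herglotz.
have e0 := expi_neq0 t; have ez := expi_neq t z1.
have ez' : 1 - (z^*)%C * expi t != 0 by apply: den; rewrite normc_expi.
rewrite pdq; last by apply: contraNneq ez => ->; rewrite subrr.
set e := expi t in e0 ez ez' *; set G := g e.
rewrite !(ReB, ReD).
have denE : ((1 - (z^*)%C * e)^*)%C = (e - z) / e.
  rewrite conjcD /= [in RHS]mulrBl divff//; congr (_ + _).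
    by apply: complexP => /=; rewrite ?oppr0.
  rewrite (_ : conjc (- (conjc z * e)) = - conjc (conjc z * e)).
    by rewrite conjcM conjcK conj_expi.
  by case: (conjc z * e) => ? ?; apply: complexP.
rewrite -[Re (_ / (1 - _))]Re_conj (conjcM (_ + _)) conjcD conjcK (conjcM (c^*)%C).
rewrite conjcK conjc_inv denE.
rewrite -!ReD [X in _ = Re X - _](_ : _ = (c * (e / (e - z))) * (G + (G^*)%C)); last first.
  by field; rewrite ez e0.
rewrite addc_conj (_ : (e + z) / (e - z) = 2 * (e / (e - z)) - 1); last by field.
rewrite mulrBr mulr1 mulrCA ReB !ReM /=; ring.
Qed.

End schwarz.

(** * Submean functions *)
Section iterated_integrals.
Context {R : realType}.
Local Notation mu := (@lebesgue_measure R).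
Local Notation mean h := (\int[mu]_(t in `[0, 1[) h t).
Implicit Types (h : R -> R).

(** [F] is the pointwise limit of its values at [a n x], the abscissa rounded down to a multiple of
    1/(n+1), by continuity in the first variable. For fixed [n] the preimages are countable unions
    of products of an interval and a measurable set. *)
Lemma joint_measurable (F : R -> R -> R) :
  (forall x, measurable_fun setT (F x)) -> (forall y, continuous (F^~ y)) ->
  measurable_fun setT (fun p : R * R => F p.1 p.2).
Proof.
move=> mF cF.
pose a (n : nat) (x : R) : R := (Num.floor (n.+1%:R * x))%:~R / n.+1%:R.
pose h (n : nat) (p : R * R) := F (a n p.1) p.2.
apply: (@measurable_fun_cvg _ _ _ _ h) => [n _ B mB|[x y] _ /=].
  rewrite setTI (_ : h n @^-1` B = \bigcup_(k : int)
    ([set x | k%:~R <= n.+1%:R * x < (k + 1)%:~R] `*`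
     (F (k%:~R / n.+1%:R) @^-1` B))).
    apply: countable_bigcupT_measurable => // k; apply: measurableX.
      rewrite (_ : [set _ | _] = `[k%:~R / n.+1%:R, (k + 1)%:~R / n.+1%:R[%classic).
        exact: measurable_itv.
      apply/seteqP; split => x /=;
        by rewrite in_itv/= ler_pdivrMr// ltr_pdivlMr// mulrC.
    by have := mF (k%:~R / n.+1%:R) measurableT _ mB; rewrite setTI.
  apply/seteqP; split => [[x y] hB|[x y] [k _ [/= kx hB]]].
    by exists (Num.floor (n.+1%:R * x)) => //; split => //=; exact: floor_itv.
  by rewrite /h /a /= (floor_def kx).
apply: (@cvg_comp _ _ _ (fun n => a n x) (F^~ y)); last exact: cF.
apply/cvgrPdist_le => e e0; near=> n.
have n0 : 0 < n.+1%:R :> R by [].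
have /andP[f1 f2] := floor_itv (n.+1%:R * x).
have ie : n.+1%:R^-1 <= e.
  by apply: ltW; near: n; exact: near_infty_natSinv_lt (PosNum e0).
set k : R := (Num.floor _)%:~R in f1; set N : R := n.+1%:R in n0 ie f1 f2 *.
have i0 : 0 < N^-1 by rewrite invr_gt0.
have xE : x = N * x / N by rewrite mulrC mulKf// gt_eqF.
have h1 : 0 <= (N * x - k) / N by apply: mulr_ge0; [rewrite subr_ge0|exact: ltW].
have h2 : (N * x - k) / N <= 1 / N.
  by rewrite ler_wpM2r ?(ltW i0)// lerBlDl -(intrD _ _ 1) ltW.
rewrite mulrBl -xE div1r in h1 h2.
by have -> : a n x = k / N by []; rewrite ger0_norm// (le_trans h2).
Unshelve. all: by end_near. Qed.

Lemma tonelli_set (D1 D2 : set R) (F : R * R -> \bar R) :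
  measurable D1 -> measurable D2 -> measurable_fun setT F ->
  (forall p, 0 <= F p)%E ->
  [/\ measurable_fun D1 (fun x => \int[mu]_(y in D2) F (x, y))%E,
      measurable_fun D2 (fun y => \int[mu]_(x in D1) F (x, y))%E &
  (\int[mu]_(x in D1) \int[mu]_(y in D2) F (x, y) =
   \int[mu]_(y in D2) \int[mu]_(x in D1) F (x, y))%E].
Proof.
move=> mD1 mD2 mF F0.
have mD : measurable (D1 `*` D2) by exact: measurableX.
pose G := F \_ (D1 `*` D2).
have mG : measurable_fun setT G.
  by apply/(measurable_restrictT _ mD); exact: measurable_funS mF.
have G0 p : (0 <= G p)%E by rewrite /G patchE; case: ifP.
have GE x y : G (x, y) = if (x \in D1) && (y \in D2) then F (x, y) else 0%E.
  by rewrite /G patchE in_setX.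
have E1 x : (\int[mu]_y G (x, y))%E =
    ((fun x => \int[mu]_(y in D2) F (x, y)) \_ D1)%E x.
  rewrite patchE; case: ifPn => xD; last first.
    by rewrite integral0_eq// => y _; rewrite GE (negbTE xD).
  rewrite [RHS]integral_mkcond; apply: eq_integral => y _.
  by rewrite GE xD patchE.
have E2 y : (\int[mu]_x G (x, y))%E =
    ((fun y => \int[mu]_(x in D1) F (x, y)) \_ D2)%E y.
  rewrite patchE; case: ifPn => yD; last first.
    by rewrite integral0_eq// => x _; rewrite GE (negbTE yD) andbF.
  rewrite [RHS]integral_mkcond; apply: eq_integral => x _.
  by rewrite GE yD andbT patchE.
split.
- apply/(measurable_restrictT _ mD1).
  have := @measurable_fun_fubini_tonelli_F _ _ _ _ _ mu G mG G0.
  by congr measurable_fun; apply/funext => x; rewrite -E1.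
- apply/(measurable_restrictT _ mD2).
  have := @measurable_fun_fubini_tonelli_G _ _ _ _ _ mu G mG G0.
  by congr measurable_fun; apply/funext => x; rewrite -E2.
- rewrite integral_mkcond [RHS]integral_mkcond.
  under eq_integral do rewrite -E1.
  by under [RHS]eq_integral do rewrite -E2; exact: fubini_tonelli.
Qed.

Lemma segment_integral_shift h (a b c : R) : a <= b -> continuous h ->
  \int[mu]_(t in `[a + c, b + c]) h t = \int[mu]_(t in `[a, b]) h (t + c).
Proof.
move=> ab ch.
have dF (x : R) : is_derive x 1 (fun t : R => t + c) 1.
  by rewrite -[X in is_derive _ _ _ X]addr0; exact: is_deriveD.
have dE : (fun t : R => t + c)^`()%classic = cst 1.
  by apply/funext => x; rewrite derive1E; exact: derive_val.
have cF (x : R) : {for x, continuous (fun t : R => t + c)}.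
  by apply: cvgD; [exact: cvg_id|exact: cvg_cst].
rewrite /Rintegral (@integration_by_substitution_increasing _ (fun t => t + c))//.
- by rewrite dE; apply: congr1; apply: eq_integral => x _ /=; rewrite mulr1.
- by move=> x y _ _ xy; rewrite ltrD2r.
- by move=> x _; rewrite dE; exact: cst_continuous.
- by rewrite dE; exact: is_cvg_cst.
- by rewrite dE; exact: is_cvg_cst.
- split; first by move=> x _; exact: ex_derive.
  + by apply: cvg_at_right_filter; exact: cF.
  + by apply: cvg_at_left_filter; exact: cF.
- by apply: continuous_subspaceT.
Qed.

Lemma mean_rotate h (c : R) : 0 <= c <= 1 -> continuous h ->
  (forall t, h (t + 1) = h t) -> mean (fun t => h (t + c)) = mean h.
Proof.
move=> /andP[c0 c1] ch h1.
have chc : continuous (fun t => h (t + c)).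
  move=> t; apply: (@cvg_comp _ _ _ (fun t => t + c) h); last exact: ch.
  by apply: cvgD; [exact: cvg_id|exact: cvg_cst].
rewrite !mean01E// -segment_integral_shift// add0r.
have ih a b : mu.-integrable `[a, b] (EFin \o h).
  by apply: continuous_segment_integrable => t _; exact: ch.
rewrite (@segment_integral_split _ h c 1 (1 + c))//; last by rewrite lerDl.
rewrite (@segment_integral_split _ h 0 c 1)// addrC; congr (_ + _).
rewrite -{1}(add0r 1) (addrC 1 c) segment_integral_shift//.
by apply: eq_Rintegral => t _; rewrite h1.
Qed.

End iterated_integrals.

(** * Monotonicity of the circle means of submean functions *)

Section submean.
Context {R : realType}.
Local Notation C := R[i].
Local Notation normc := (@Normc.normc R).
Local Notation Re := (@complex.Re R).
Local Notation Im := (@complex.Im R).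
Local Notation mu := (@lebesgue_measure R).
Local Notation mean h := (\int[mu]_(t in `[0, 1[) h t).
Implicit Types (z w : C) (h : R -> R).

Lemma polar_form z : exists2 a : R, 0 <= a <= 1 & z = (normc z)%:C%C * expi a.
Proof.
have [->|z0] := eqVneq z 0.
  by exists 0; rewrite ?lexx ?ler01// Normc.normc0 mul0r.
have n0 : 0 < normc z by rewrite normc_gt0.
pose x := Re z / normc z.
have x1 : -1 <= x <= 1.
  rewrite ler_pdivlMr// ler_pdivrMr// mulN1r mul1r -ler_norml.
  exact: normc_Re.
have sE : sin (acos x) = `|Im z| / normc z.
  rewrite sin_acos// -(ger0_norm (ltW n0)) -normf_div -sqrtr_sqr; congr Num.sqrt.
  have := sqr_normc_ReIm z; rewrite /x !expr_div_n => nE.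
  have n20 : normc z ^+ 2 != 0 by rewrite expf_neq0// gt_eqF.
  by apply: (mulIf n20); rewrite mulrBl !mulfVK// mul1r nE addrC addKr.
have a0 := acos_ge0 x1; have api := acos_lepi x1; have p0 := @pi_gt0 R.
pose a := acos x / (2 * pi).
have aE : 2 * pi * a = acos x.
  by rewrite mulrC mulfVK// mulf_neq0 ?pnatr_eq0// gt_eqF.
have a01 : 0 <= a <= 1.
  have p2 : 0 < 2 * pi :> R by rewrite mulr_gt0.
  by rewrite divr_ge0 ?(ltW p2)// ler_pdivrMr//; lra.
have zE : z = (normc z)%:C%C * (x +i* (Im z / normc z))%C.
  by apply: complexP; rewrite ?ReM ?ImM /= mul0r ?subr0 ?addr0 mulrC mulfVK// gt_eqF.
have [Im0|Im0] := leP 0 (Im z).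
  exists a => //; rewrite [LHS]zE; congr (_ * _).
  by rewrite /expi aE acosK ?in_itv//= sE ger0_norm.
exists (1 - a); first by lra.
rewrite [LHS]zE; congr (_ * _).
have -> : expi (1 - a) = conjc (expi a).
  rewrite expiD expi1 mul1r conj_expi; apply: (mulfI (expi_neq0 a)).
  by rewrite -expiD subrr expi0 divff// expi_neq0.
by rewrite /expi /= aE acosK ?in_itv//= sE ltr0_norm// mulNr opprK.
Qed.

Definition rcont (s : C -> R) z := ccont (fun w => (s w)%:C%C) z.

Lemma rcontE (s : C -> R) z (e : R) : rcont s z -> 0 < e ->
  exists2 d : R, 0 < d & forall w, normc (w - z) < d -> `|s w - s z| < e.
Proof.
move=> cs /cs[d d0 hd]; exists d => // w /hd.
rewrite (_ : _ - _ = (s w - s z)%:C%C) ?normc_real//.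
by apply: complexP => /=; ring.
Qed.

Lemma continuous_circle_real (s : C -> R) z (a : C) :
  (forall t, rcont s (z + a * expi t)) -> continuous (fun t => s (z + a * expi t)).
Proof. by move=> cs; apply: continuous_circle => t e; exact: rcontE. Qed.

Lemma continuous_circle0 (s : C -> R) (a : C) :
  (forall t, rcont s (a * expi t)) -> continuous (fun t => s (a * expi t)).
Proof.
move=> cs; have := @continuous_circle_real s 0 a.
by under eq_fun do rewrite add0r; apply => t; rewrite add0r.
Qed.

(** On the circle the integrand is r^2 + p^2 plus the real part of a multiple of zeta. The surplus
    p^2 over the value at the centre is the strict gain in the maximum principle for circle
    means. *)
Lemma mean_sqr_dist (r p : R) :
  mean (fun t => normc (r%:C%C + p%:C%C * expi t) ^+ 2) = r ^+ 2 + p ^+ 2.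
Proof.
have dg w : normc w < 2 -> cdiff (fun w => (2 * r * p)%:C%C * w + (r ^+ 2 + p ^+ 2)%:C%C) w.
  move=> _; apply: cdiffD; last exact: cdiff_cst.
  by apply: cdiffM; [exact: cdiff_cst|exact: cdiff_id].
have := @mean_value _ _ 2 dg 1; rewrite ler01 ltr1n => /(_ isT).
rewrite mulr0 add0r /= => <-; apply: eq_Rintegral => t _.
rewrite sqr_sqrtr ?addr_ge0 ?sqr_ge0//.
have := cos2Dsin2 (2 * pi * t); set c := cos _; set s := sin _ => cs.
rewrite [LHS](_ : _ = r ^+ 2 + 2 * r * p * c + p ^+ 2 * (c ^+ 2 + s ^+ 2));
  first by rewrite cs; ring.
by ring.
Qed.

Lemma EFin_mean h : continuous h ->
  (\int[mu]_(t in `[0%R, 1%R[) (h t)%:E = (mean h)%:E)%E.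
Proof.
move=> ch; rewrite /Rintegral fineK//; apply: integrable_fin_num => //.
exact: continuous_integrable01.
Qed.

Lemma mean_iterated_le (F : R -> R -> R) (a b : R -> R) :
  (forall t q, 0 <= F t q) -> (forall q, continuous (F^~ q)) ->
  (forall t, continuous (F t)) ->
  continuous a -> continuous b -> (forall t, 0 <= a t) ->
  (forall t, 0 <= t < 1 -> a t <= mean (F t)) ->
  (forall q, 0 <= q < 1 -> mean (F^~ q) <= b q) -> mean a <= mean b.
Proof.
move=> F0 cF1 cF2 ca cb a0 aF Fb.
have mF : measurable_fun setT (fun x : R * R => (F x.1 x.2)%:E).
  apply/measurable_EFinP; apply: joint_measurable => // t.
  exact: continuous_measurable_fun.
have F0' (x : R * R) : (0 <= (F x.1 x.2)%:E)%E by rewrite lee_fin.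
have mI : measurable (`[0, 1[ : set R) by exact: measurable_itv.
have [mF1 mF2 FT] := tonelli_set mI mI mF F0'.
rewrite -lee_fin -!EFin_mean//.
apply: (@le_trans _ _ (\int[mu]_(t in `[0%R, 1%R[) \int[mu]_(q in `[0%R, 1%R[) (F t q)%:E)%E).
  apply: ge0_le_integral => //.
  - by move=> t _; rewrite lee_fin.
  - apply/measurable_EFinP; apply: measurable_funTS.
    exact: continuous_measurable_fun.
  - by move=> t /=; rewrite in_itv/= => t01; rewrite EFin_mean// lee_fin aF.
rewrite [leLHS]FT; apply: ge0_le_integral => //.
- by move=> q _; apply: integral_ge0 => t _; rewrite lee_fin.
- apply/measurable_EFinP; apply: measurable_funTS.
  exact: continuous_measurable_fun.
- move=> q /=; rewrite in_itv/= => q01.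
  by rewrite (@EFin_mean (F^~ q))// lee_fin Fb.
Qed.

(** A maximum principle for the mean [M] as a function of the radius, perturbed by e r^2. A maximum
    on [0, r2] at some r < r2 is impossible: the submean inequality, averaged over the circle of
    radius r, bounds [M r] by the average of [M] at the radii |r + p zeta|. The bound [d] is uniform
    in [t] so that this averaging makes sense. *)
Lemma submean_monotone (s : C -> R) (B : R) : (forall z, 0 <= s z) ->
  (forall z, normc z < B -> rcont s z) ->
  (forall r : R, 0 <= r < B -> exists2 d : R, 0 < d & forall p, 0 < p < d ->
     forall t, 0 <= t <= 1 -> s (r%:C%C * expi t) <=
       mean (fun q => s (r%:C%C * expi t + p%:C%C * expi q))) ->
  forall r1 r2 : R, 0 <= r1 <= r2 -> r2 < B ->
    mean (fun t => s (r1%:C%C * expi t)) <= mean (fun t => s (r2%:C%C * expi t)).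
Proof.
move=> s0 cs sub r1 r2 /andP[r10 r12] r2B.
pose M (r : R) := mean (fun t => s (r%:C%C * expi t)).
rewrite -/(M r1) -/(M r2).
have nr (r t : R) : normc (r%:C%C * expi t) = `|r|.
  by rewrite Normc.normcM normc_real normc_expi mulr1.
have ME (r : R) : mean (fun t => Re (s (0 + r%:C%C * expi t))%:C%C) = M r.
  by apply: eq_Rintegral => t _; rewrite add0r.
have cM (r : R) : 0 <= r <= r2 -> {for r, continuous M}.
  move=> /andP[r0 rr2]; apply/cvgrPdist_le => e e0.
  have cr : forall t, ccont (fun w => (s w)%:C%C) (0 + r%:C%C * expi t).
    by move=> t; apply: cs; rewrite add0r nr ger0_norm// (le_lt_trans rr2).
  have [d d0 hd] := circle_mean_cont cr e0.
  exists (Num.min d (B - r2)); first by rewrite /= lt_min d0 subr_gt0.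
  move=> x /=; rewrite lt_min distrC => /andP[xd xB].
  rewrite -!ME distrC; apply: hd => // t; apply: cs; rewrite add0r nr.
  have := ler_distD 0 x r; rewrite !subr0; have := ler_norm x.
  move: xB; rewrite ltr_norml ltr_norml; lra.
have MS z : normc z < B -> mean (fun t => s (z * expi t)) = M (normc z).
  move=> zB; have [a a01 zE] := polar_form z.
  transitivity (mean (fun t => s ((normc z)%:C%C * expi (t + a)))).
    by apply: eq_Rintegral => t _; rewrite [in LHS]zE expiD -mulrA [_ * expi t]mulrC.
  apply: (@mean_rotate _ (fun t => s ((normc z)%:C%C * expi t))) => //.
    apply: continuous_circle0 => t; apply: cs.
    by rewrite nr ger0_norm ?normc_ge0.
  by move=> t; rewrite expiD1.
apply/ler_addgt0Pr => e0 e00.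
(* The perturbation e r^2 is at most [e0] up to radius [r2], where the maximum must lie. *)
pose e := e0 / (r2 ^+ 2 + 1).
have r22 : 0 < r2 ^+ 2 + 1 by rewrite ltr_wpDl// sqr_ge0.
have ep : 0 < e by rewrite divr_gt0.
pose N r := M r + e * r ^+ 2.
have r20 : 0 <= r2 by exact: le_trans r12.
have [r rI rmax] : exists2 c : R, c \in `[0, r2] & forall t : R, t \in `[0, r2] -> N t <= N c.
  apply: EVT_max => //; apply: continuous_in_subspaceT => x.
  rewrite inE/= in_itv/= => hx; apply: cvgD; first exact: cM.
  by apply: cvgM; [exact: cvg_cst|apply: cvgM; exact: cvg_id].
have r1I : r1 \in `[0, r2] by rewrite in_itv/= r10.
move: (rI); rewrite in_itv/= => /andP[r0]; rewrite le_eqVlt => /predU1P[rE|rr2].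
  have := rmax _ r1I; rewrite rE /N => h.
  have : e * r2 ^+ 2 <= e0.
    by rewrite /e mulrAC ler_pdivrMr// ler_pM2l// lerDl.
  have : 0 <= e * r1 ^+ 2 by rewrite mulr_ge0 ?sqr_ge0// ltW.
  lra.
exfalso.
have /sub[d d0 hd] : 0 <= r < B by rewrite r0 (lt_trans rr2).
pose p := Num.min (d / 2) (r2 - r).
have p0 : 0 < p by rewrite lt_min divr_gt0// subr_gt0.
have pd : p < d by rewrite gt_min ltr_pdivrMr//; apply/orP; left; lra.
have pr : p <= r2 - r by rewrite ge_min lexx orbT.
(* In [q] this runs over the circle of radius p about [r * expi t], turned by [t]; in [t] it runs
   over the circle about 0 of radius |r + p zeta|. Exchanging the two means links the local
   hypothesis to [M]. *)
pose F (t q : R) := s ((r%:C%C + p%:C%C * expi q) * expi t).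
have FE t q : F t q = s (r%:C%C * expi t + (p%:C%C * expi t) * expi q).
  by rewrite /F mulrDl; congr (s (_ + _)); ring.
have nrp q : normc (r%:C%C + p%:C%C * expi q) <= r2.
  rewrite (le_trans (le_normcD _ _))// nr normc_real !ger0_norm ?(ltW p0)//.
  by rewrite -lerBrDl.
have cF1 q : continuous (F^~ q).
  apply: continuous_circle0 => t; apply: cs.
  by rewrite Normc.normcM normc_expi mulr1 (le_lt_trans (nrp _)).
have cF2 t : continuous (F t).
  rewrite (_ : F t = fun q => s (r%:C%C * expi t + (p%:C%C * expi t) * expi q));
    last by apply/funext => q; exact: FE.
  apply: continuous_circle_real => q; apply: cs.
  have -> : r%:C%C * expi t + p%:C%C * expi t * expi q =
            (r%:C%C + p%:C%C * expi q) * expi t by rewrite mulrDl; ring.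
  by rewrite Normc.normcM normc_expi mulr1 (le_lt_trans (nrp _)).
have cn2 : continuous (fun q => normc (r%:C%C + p%:C%C * expi q) ^+ 2).
  have cn : continuous (fun q => normc (r%:C%C + p%:C%C * expi q)).
    apply: continuous_circle => t e1 e10; exists e1 => // w.
    apply: le_lt_trans; rewrite ler_norml; apply/andP; split.
      by rewrite lerNl opprB normcB normc_dist.
    exact: normc_dist.
  by move=> q; apply: cvgM; exact: cn.
have cN : continuous (fun q => N r - e * normc (r%:C%C + p%:C%C * expi q) ^+ 2).
  move=> q; apply: cvgB; first exact: cvg_cst.
  by apply: cvgM; [exact: cvg_cst|exact: cn2].
have cr : continuous (fun t => s (r%:C%C * expi t)).
  by apply: continuous_circle0 => t; apply: cs; rewrite nr ger0_norm// (lt_trans rr2).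
have {cF1 cF2} : M r <= mean (fun q => N r - e * normc (r%:C%C + p%:C%C * expi q) ^+ 2).
  apply: (mean_iterated_le (fun t q => s0 _) cF1 cF2) => //.
  - move=> t /andP[t0 t1]; have t01 : 0 <= t <= 1 by rewrite t0 ltW.
    apply: le_trans (hd p _ t t01) _; first by rewrite p0.
    rewrite -(@mean_rotate _ (fun q => s (r%:C%C * expi t + p%:C%C * expi q)) t)//.
    + rewrite le_eqVlt; apply/orP; left; apply/eqP/eq_Rintegral => q _.
      by rewrite expiD; congr s; ring.
    + apply: (@continuous_circle_real s (r%:C%C * expi t) p%:C%C) => q; apply: cs.
      rewrite (le_lt_trans (le_normcD _ _))// !nr !ger0_norm// ?(ltW p0)//.
      by rewrite -ltrBrDl (le_lt_trans pr)// ltrD2r.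
    + by move=> q; rewrite expiD1.
  - move=> q _; rewrite MS ?(le_lt_trans (nrp _))//.
    by rewrite lerBrDr; apply: rmax; rewrite in_itv; apply/andP; split;
      [exact: normc_ge0|exact: nrp].
(* The right side equals N r - e (r^2 + p^2) = M r - e p^2, which is less than M r. *)
rewrite leNgt => /negP; apply.
rewrite (@meanB _ (cst (N r))); last 2 first.
- by move=> ?; exact: cst_continuous.
- by move=> q; apply: cvgM; [exact: cvg_cst|exact: cn2].
rewrite mean_cst meanZ// mean_sqr_dist /N.
have : 0 < e * p ^+ 2 by rewrite mulr_gt0// exprn_gt0.
lra.
Qed.

End submean.

(** * Poisson integrals *)
Section poisson_kernel.
Context {R : realType}.
Local Notation C := R[i].
Local Notation normc := (@Normc.normc R).
Local Notation Re := (@complex.Re R).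
Local Notation Im := (@complex.Im R).
Local Notation mu := (@lebesgue_measure R).
Local Notation mean h := (\int[mu]_(t in `[0, 1[) h t).
Implicit Types (z w : C) (h Psi : R -> R).

Definition poisson z (t : R) : R := Re (herglotz z t).

Definition poisson_integral Psi z : R := mean (fun t => Psi t * poisson z t).

Lemma herglotzE z (t : R) : normc z < 1 ->
  herglotz z t = 2 * (expi t / (expi t - z)) - 1.
Proof. by move=> z1; rewrite /herglotz; field; exact: expi_neq. Qed.

Lemma herglotz_continuous (c z : C) : normc z < 1 ->
  continuous (fun t => Re (c * herglotz z t)).
Proof.
move=> z1; apply: (@continuous_expi_Re _ (fun w => c * ((w + z) / (w - z)))) => t.
apply: ccontM (ccont_cst _ _) _; apply: ccontM.
  by apply: ccontD (ccont_cst _ _); exact: ccont_id.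
apply: ccontV; last exact: expi_neq.
by apply: ccontB (ccont_cst _ _); exact: ccont_id.
Qed.

Lemma poisson_continuous z : normc z < 1 -> continuous (poisson z).
Proof.
move=> z1; have := @herglotz_continuous 1 z z1.
by under eq_fun do rewrite mul1r.
Qed.

Lemma poissonE z (t : R) : normc z < 1 ->
  poisson z t = (1 - normc z ^+ 2) / normc (expi t - z) ^+ 2.
Proof.
move=> z1; have ez := expi_neq t z1.
have n0 : normc (expi t - z) ^+ 2 != 0.
  by rewrite expf_neq0// gt_eqF// normc_gt0.
apply: (mulIf n0); rewrite divfK//.
rewrite sqr_normc_ReIm ReB ImB.
have hE : herglotz z t * (expi t - z) = expi t + z by rewrite /herglotz divfK.
have hR : poisson z t * Re (expi t - z) - Im (herglotz z t) * Im (expi t - z) =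
  Re (expi t + z) by rewrite /poisson -ReM hE.
have hI : poisson z t * Im (expi t - z) + Im (herglotz z t) * Re (expi t - z) =
  Im (expi t + z) by rewrite /poisson -ImM hE.
have nE : Re (expi t) ^+ 2 + Im (expi t) ^+ 2 = 1.
  by rewrite -sqr_normc_ReIm normc_expi expr1n.
rewrite (sqr_normc_ReIm z) -nE; move: hR hI; rewrite !ReB !ReD !ImB !ImD.
set a := Re (expi t); set b := Im (expi t); set x := Re z; set y := Im z.
set P := poisson z t; set Q := Im _ => hR hI.
have -> : P * ((a - x) ^+ 2 + (b - y) ^+ 2) = (P * (a - x) - Q * (b - y)) * (a - x) +
   (P * (b - y) + Q * (a - x)) * (b - y) by ring.
by rewrite hR hI; ring.
Qed.

Lemma poisson_ge0 z (t : R) : normc z < 1 -> 0 <= poisson z t.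
Proof.
move=> z1; rewrite poissonE// divr_ge0 ?sqr_ge0// subr_ge0 expr_le1 ?normc_ge0//.
exact: ltW.
Qed.

Lemma poisson0 (t : R) : poisson 0 t = 1.
Proof. by rewrite poissonE ?Normc.normc0 ?ltr01// subr0 normc_expi expr0n/= subr0 expr1n divr1. Qed.

Lemma poisson_lipschitz (r : R) z w (t : R) : r < 1 -> normc z <= r -> normc w <= r ->
  `|poisson z t - poisson w t| <= 2 / (1 - r) ^+ 2 * normc (z - w).
Proof.
move=> r1 zr wr; have z1 := le_lt_trans zr r1; have w1 := le_lt_trans wr r1.
have ez := expi_neq t z1; have ew := expi_neq t w1.
rewrite /poisson -ReB (le_trans (normc_Re _))// !herglotzE//.
rewrite (_ : _ - _ = 2 * expi t * (z - w) * ((expi t - z)^-1 * (expi t - w)^-1));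
  last by field; rewrite ez ew.
have n2 : normc (2 : C) = 2 by rewrite (_ : 2 = 2%:C%C) ?normc_real ?ger0_norm//;
  apply: complexP => /=; rewrite ?addr0.
rewrite !Normc.normcM n2 normc_expi mulr1 !Normc.normcV.
have dist v : normc v <= r -> (normc (expi t - v))^-1 <= (1 - r)^-1.
  move=> vr; rewrite lef_pV2 ?posrE ?subr_gt0//; last first.
    by rewrite normc_gt0 expi_neq// (le_lt_trans vr).
  by have := normc_dist (expi t) v; rewrite normc_expi; lra.
rewrite mulrAC ler_wpM2r ?normc_ge0// ler_pM2l// expr2 invfM ler_pM ?invr_ge0 ?normc_ge0//;
  exact: dist.
Qed.

Lemma poisson_bounded (r : R) z (t : R) : r < 1 -> normc z <= r ->
  `|poisson z t| <= 1 + 2 / (1 - r) ^+ 2 * r.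
Proof.
move=> r1 zr; have r0 : 0 <= r by rewrite (le_trans _ zr)// normc_ge0.
have := @poisson_lipschitz r z 0 t r1 zr; rewrite Normc.normc0 => /(_ r0).
rewrite poisson0 subr0 => h.
rewrite -[poisson z t](subrK 1) addrC (le_trans (ler_normD _ _))// normr1 lerD2l.
by rewrite (le_trans h)// ler_wpM2l// divr_ge0// sqr_ge0.
Qed.

Lemma poisson_mean_value (t : R) z (p : R) : 0 <= p -> normc z + p < 1 ->
  mean (fun q => poisson (z + p%:C%C * expi q) t) = poisson z t.
Proof.
move=> p0 zp; apply: (@mean_value_at _ (fun w => (expi t + w) / (expi t - w)) z (1 - normc z)).
  move=> w wz; have w1 : normc w < 1 by have := normc_dist w z; lra.
  apply: cdiffM; first by apply: cdiffD (cdiff_cst _ _) (cdiff_id _).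
  apply: cdiffV; last exact: expi_neq.
  by apply: cdiffB (cdiff_cst _ _) (cdiff_id _).
lra.
Qed.

Lemma poisson_formula (g : C -> C) z : (forall w, cdiff g w) -> normc z < 1 ->
  mean (fun t => Re (g (expi t)) * poisson z t) = Re (g z).
Proof.
move=> dg z1; have := @schwarz_formula _ g 2 z 1 (ltr1n _ 2) (fun w _ => dg w) z1.
rewrite mul1r /= mul0r addr0 => <-; apply: eq_Rintegral => t _.
by rewrite mul1r.
Qed.

Lemma mean_poisson z : normc z < 1 -> mean (poisson z) = 1.
Proof.
move=> z1; rewrite -[RHS](_ : Re 1 = 1)// -(@poisson_formula (fun=> 1) z)//.
  by apply: eq_Rintegral => t _; rewrite mul1r.
by move=> w; exact: cdiff_cst.
Qed.

(** For two points of the unit circle |zeta - w|^2 is the real part of 2 - 2 w^* zeta, a polynomial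
    in zeta, so the Poisson formula evaluates it at r w. *)
Lemma poisson_second_moment (w : C) (r : R) : normc w = 1 -> 0 <= r < 1 ->
  mean (fun t => normc (expi t - w) ^+ 2 * poisson (r%:C%C * w) t) = 2 - 2 * r.
Proof.
move=> w1 /andP[r0 r1].
have nw : Re w ^+ 2 + Im w ^+ 2 = 1 by rewrite -sqr_normc_ReIm w1 expr1n.
have rw1 : normc (r%:C%C * w) < 1 by rewrite Normc.normcM normc_real w1 mulr1 ger0_norm.
have := @poisson_formula (fun v => 2 - 2 * conjc w * v) _ _ rw1.
rewrite (_ : Re (2 - _) = 2 - 2 * r); last first.
  rewrite ReB (_ : Re 2 = 2)// !(ReM, ImM) /=.
  case: w w1 nw {rw1} => x y /= _ xy; rewrite [in RHS](_ : r = r * (x ^+ 2 + y ^+ 2)).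
    by ring.
  by rewrite xy mulr1.
move=> <-; last first.
  move=> v; apply: cdiffB (cdiff_cst _ _) _; apply: cdiffM (cdiff_cst _ _) (cdiff_id _).
apply: eq_Rintegral => t _; congr (_ * _).
rewrite sqr_normc_ReIm !ReB !ImB !ReM ImM /=.
case: w w1 nw {rw1} => x y /= _ xy.
have := cos2Dsin2 (2 * pi * t); set c := cos _; set s := sin _ => cs.
transitivity ((c ^+ 2 + s ^+ 2) + (x ^+ 2 + y ^+ 2) - 2 * (c * x + s * y)); first by ring.
by rewrite cs xy; ring.
Qed.

End poisson_kernel.

Section poisson_integral.
Context {R : realType}.
Local Notation C := R[i].
Local Notation normc := (@Normc.normc R).
Local Notation mu := (@lebesgue_measure R).
Local Notation mean h := (\int[mu]_(t in `[0, 1[) h t).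
Local Notation integrable01 h := (mu.-integrable `[0, 1[ (EFin \o h)).
Implicit Types (z w : C) (h Psi : R -> R).

Let mI : measurable (`[0, 1[%classic : set R).
Proof. exact: measurable_itv. Qed.

Lemma integrable_poisson Psi z : integrable01 Psi -> normc z < 1 ->
  integrable01 (fun t => Psi t * poisson z t).
Proof.
move=> Psii z1.
rewrite (_ : _ \o _ = (EFin \o Psi) \* (EFin \o poisson z))%E; last first.
  by apply/funext => t /=; rewrite EFinM.
apply: integrableMl => //.
  apply: measurable_funTS; apply: continuous_measurable_fun.
  exact: poisson_continuous.
exists (1 + 2 / (1 - normc z) ^+ 2 * normc z); split; first exact: num_real.
by move=> M hM t _ /=; apply: le_trans (ltW hM); exact: poisson_bounded.
Qed.

Lemma integrable01_abs Psi : integrable01 Psi -> integrable01 (fun t => `|Psi t|).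
Proof. by move=> /integrable_norm. Qed.

Lemma le_norm_mean Psi : integrable01 Psi -> `|mean Psi| <= mean (fun t => `|Psi t|).
Proof. exact: le_normr_Rintegral. Qed.

Lemma integrable01Z k Psi : integrable01 Psi -> integrable01 (fun t => k * Psi t).
Proof.
move=> hi; rewrite (_ : _ \o _ = (fun t => k%:E * (EFin \o Psi) t)%E).
  exact: integrableZl.
by apply/funext => t /=; rewrite EFinM.
Qed.

Lemma integrable01D Psi Phi : integrable01 Psi -> integrable01 Phi ->
  integrable01 (fun t => Psi t + Phi t).
Proof.
move=> h1 h2; rewrite (_ : _ \o _ = (EFin \o Psi) \+ (EFin \o Phi))%E//.
exact: integrableD.
Qed.

Lemma integrable01B Psi Phi : integrable01 Psi -> integrable01 Phi ->
  integrable01 (fun t => Psi t - Phi t).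
Proof.
move=> h1 h2; rewrite (_ : _ \o _ = (EFin \o Psi) \- (EFin \o Phi))%E//.
exact: integrableB.
Qed.

Lemma EFin_mean_integrable Psi : integrable01 Psi ->
  (\int[mu]_(t in `[0%R, 1%R[) (Psi t)%:E = (mean Psi)%:E)%E.
Proof. by move=> hi; rewrite /Rintegral fineK//; exact: integrable_fin_num. Qed.

Lemma integrable_meanD Psi Phi : integrable01 Psi -> integrable01 Phi ->
  mean (fun t => Psi t + Phi t) = mean Psi + mean Phi.
Proof. by move=> h1 h2; apply: RintegralD. Qed.

Lemma integrable_meanB Psi Phi : integrable01 Psi -> integrable01 Phi ->
  mean (fun t => Psi t - Phi t) = mean Psi - mean Phi.
Proof. by move=> h1 h2; apply: RintegralB. Qed.

Lemma integrable_meanZ k Psi : integrable01 Psi ->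
  mean (fun t => k * Psi t) = k * mean Psi.
Proof. by move=> h1; apply: RintegralZl. Qed.

Lemma integrable_le_mean Psi Phi : integrable01 Psi -> integrable01 Phi ->
  (forall t, 0 <= t < 1 -> Psi t <= Phi t) -> mean Psi <= mean Phi.
Proof. by move=> h1 h2 h; apply: le_Rintegral. Qed.

Lemma poisson_integral_ge0 Psi z : (forall t, 0 <= t < 1 -> 0 <= Psi t) ->
  normc z < 1 -> 0 <= poisson_integral Psi z.
Proof.
move=> P0 z1; apply: Rintegral_ge0 => t /=; rewrite in_itv/= => t01.
by rewrite mulr_ge0 ?P0// poisson_ge0.
Qed.

Lemma poisson_integral_rcont Psi z : integrable01 Psi -> normc z < 1 ->
  rcont (poisson_integral Psi) z.
Proof.
move=> Pi z1 e e0; pose r := (1 + normc z) / 2.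
have r1 : r < 1 by rewrite /r; lra.
have zr : normc z < r by rewrite /r; lra.
pose L := 2 / (1 - r) ^+ 2; pose A := mean (fun t => `|Psi t|).
have L0 : 0 <= L by rewrite divr_ge0// sqr_ge0.
have A0 : 0 <= A by exact: Rintegral_ge0.
have LA : 0 < L * A + 1 by rewrite ltr_wpDl// mulr_ge0.
exists (Num.min (r - normc z) (e / (L * A + 1))).
  by rewrite lt_min subr_gt0 zr divr_gt0.
move=> w; rewrite lt_min => /andP[w1 w2].
have wr : normc w <= r by have := normc_dist w z; lra.
have wlt1 : normc w < 1 by exact: le_lt_trans r1.
rewrite (_ : _ - _ = (poisson_integral Psi w - poisson_integral Psi z)%:C%C); last first.
  by apply: complexP => /=; rewrite ?subrr.
rewrite normc_real /poisson_integral -RintegralB//; try exact: integrable_poisson.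
have iB : integrable01 (fun t => Psi t * poisson w t - Psi t * poisson z t).
  by apply: integrable01B; exact: integrable_poisson.
apply: le_lt_trans (le_norm_mean iB) _.
apply: (@le_lt_trans _ _ (mean (fun t => (L * normc (w - z)) * `|Psi t|))).
  apply: le_Rintegral => //.
  - exact: (integrable01_abs iB).
  - exact/integrable01Z/integrable01_abs.
  - move=> t _; rewrite -mulrBr normrM mulrC ler_wpM2r// poisson_lipschitz// ltW//.
rewrite RintegralZl//; last exact: integrable01_abs.
rewrite -/A mulrAC; move: w2; rewrite ltr_pdivlMr// => w2; apply: le_lt_trans w2.
by rewrite mulrC ler_wpM2l ?normc_ge0// lerDl.
Qed.

(* Tonelli, with the truncation of [Psi] to [0, 1) so that the integrand is
   measurable on the whole plane. *)
Lemma poisson_integral_mean_value Psi z (p : R) : integrable01 Psi ->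
  (forall t, 0 <= t < 1 -> 0 <= Psi t) -> 0 <= p -> normc z + p < 1 ->
  mean (fun q => poisson_integral Psi (z + p%:C%C * expi q)) = poisson_integral Psi z.
Proof.
move=> Pi P0 p0 zp; pose Phi := Psi \_ `[0, 1[%classic.
have z1 : normc z < 1 by lra.
have zq q : normc (z + p%:C%C * expi q) < 1.
  rewrite (le_lt_trans (le_normcD _ _))// Normc.normcM normc_real normc_expi.
  by rewrite mulr1 ger0_norm.
have PhiE t : t \in `[0, 1[%classic -> Phi t = Psi t by move=> t01; rewrite /Phi patchE t01.
have Phi0 t : 0 <= Phi t.
  rewrite /Phi patchE; case: ifPn => //; rewrite inE/= in_itv/=; exact: P0.
have mPhi : measurable_fun setT Phi.
  apply/(measurable_restrictT _ mI); apply/measurable_EFinP; exact: measurable_int Pi.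
have Phii : integrable01 Phi.
  by apply: eq_integrable Pi => // t t01; rewrite /= PhiE.
have KE v : poisson_integral Psi v = poisson_integral Phi v.
  by apply: eq_Rintegral => t t01; rewrite PhiE.
pose F (t q : R) := Phi t * poisson (z + p%:C%C * expi q) t.
have cP t : continuous (fun q => poisson (z + p%:C%C * expi q) t).
  apply: (@continuous_circle _ (fun w => poisson w t)) => q e e0; pose r := (1 + normc (z + p%:C%C * expi q)) / 2.
  have zqr := zq q; have r1 : r < 1 by rewrite /r; lra.
  have L0 : 0 < 2 / (1 - r) ^+ 2 by rewrite divr_gt0// exprn_gt0// subr_gt0.
  exists (Num.min (r - normc (z + p%:C%C * expi q)) (e / (2 / (1 - r) ^+ 2))).
    by rewrite lt_min subr_gt0 divr_gt0// andbT /r; lra.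
  move=> w; rewrite lt_min => /andP[w1]; rewrite ltr_pdivlMr// => w2.
  apply: le_lt_trans w2; rewrite [leRHS]mulrC; apply: poisson_lipschitz => //.
    by have := normc_dist w (z + p%:C%C * expi q); lra.
  by rewrite /r; lra.
have F0 (x : R * R) : (0 <= (F x.2 x.1)%:E)%E.
  by rewrite lee_fin mulr_ge0// poisson_ge0.
have mF : measurable_fun setT (fun x : R * R => (F x.2 x.1)%:E).
  apply/measurable_EFinP; apply: (@joint_measurable _ (fun q t => F t q)).
    move=> q; apply: measurable_funM => //.
    apply: continuous_measurable_fun; exact: poisson_continuous.
  by move=> t q; apply: cvgM; [exact: cvg_cst|exact: cP].
have [_ _ FT] := tonelli_set mI mI mF F0.
transitivity (fine (\int[mu]_(q in `[0%R, 1%R[) \int[mu]_(t in `[0%R, 1%R[) (F t q)%:E)%E).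
  congr fine; apply: eq_integral => q _.
  rewrite KE; exact: (esym (EFin_mean_integrable (integrable_poisson Phii (zq q)))).
rewrite [X in fine X]FT KE; congr fine; apply: eq_integral => t _ /=.
rewrite -(poisson_mean_value t p0 zp) -(meanZ _ (cP t)); apply: EFin_mean.
by move=> q; apply: cvgM; [exact: cvg_cst|exact: cP].
Qed.

Lemma mean_poisson_integral Psi (r : R) : integrable01 Psi ->
  (forall t, 0 <= t < 1 -> 0 <= Psi t) -> 0 <= r < 1 ->
  mean (fun q => poisson_integral Psi (r%:C%C * expi q)) = mean Psi.
Proof.
move=> Pi P0 /andP[r0 r1].
transitivity (poisson_integral Psi 0); last first.
  by apply: eq_Rintegral => t _; rewrite poisson0 mulr1.
have r1' : normc (0 : C) + r < 1 by rewrite Normc.normc0 add0r.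
apply: etrans (poisson_integral_mean_value Pi P0 r0 r1').
by apply: eq_Rintegral => q _; rewrite add0r.
Qed.

Lemma korovkin_constant (c r e : R) : 0 <= c -> r < 1 -> 1 - e / (4 * c + 1) <= r ->
  0 < e -> e / 2 * 1 + c * (2 - 2 * r) <= e.
Proof.
move=> c0 r1 rr e0.
have c4 : 0 < 4 * c + 1 by rewrite ltr_wpDl// mulr_ge0.
have : (1 - r) * (4 * c + 1) <= e by rewrite -ler_pdivlMr//; lra.
nra.
Qed.

(* Korovkin's argument: |H(zeta) - H(w)| <= e + c |zeta - w|^2 on the circle,
   and the second moment of the Poisson kernel at r w about w is 2 - 2 r. *)
Lemma poisson_integral_uniform (H : C -> R) (Q : R) :
  (forall t, rcont H (expi t)) -> (forall t, `|H (expi t)| <= Q) ->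
  forall e : R, 0 < e -> exists2 r0 : R, r0 < 1 & forall r t, 0 <= r < 1 -> r0 <= r ->
    0 <= t < 1 ->
    `|poisson_integral (fun t => H (expi t)) (r%:C%C * expi t) - H (expi t)| <= e.
Proof.
move=> cH HQ e e0.
have cH' t : ccont (fun w => (H w)%:C%C) (0 + 1 * expi t) by rewrite add0r mul1r; exact: cH.
have [d d0 hd] := circle_uniform cH' (divr_gt0 e0 (ltr0n _ 2)).
have cHe : continuous (fun t => H (expi t)).
  have := @continuous_circle0 _ H 1; under eq_fun do rewrite mul1r.
  by apply => t; rewrite mul1r.
have Q0 : 0 <= Q by rewrite (le_trans _ (HQ 0)).
(* Points of the circle at distance at least [d] satisfy 2 Q <= c |zeta - w|^2, and 2 Q bounds every
   difference of values of [H]. *)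
pose c := 2 * Q / d ^+ 2.
have c0 : 0 <= c by apply: divr_ge0; [apply: mulr_ge0|exact: sqr_ge0].
(* Then (1 - r) (4 c + 1) <= e, so the second moment contributes c (2 - 2 r) <= e / 2; the added 1
   covers c = 0. *)
exists (1 - e / (4 * c + 1)).
  by rewrite ltrBlDr ltrDl divr_gt0// ltr_wpDl// mulr_ge0.
move=> r t /andP[r0 r1] rr t01.
have z1 : normc (r%:C%C * expi t) < 1.
  by rewrite Normc.normcM normc_real normc_expi mulr1 ger0_norm.
set z := r%:C%C * expi t in z1 *.
have cPz := poisson_continuous z1.
have cHP : continuous (fun q => H (expi q) * poisson z q).
  by move=> q; apply: cvgM; [exact: cHe|exact: cPz].
have cHP' : continuous (fun q => H (expi t) * poisson z q).
  by move=> q; apply: cvgM; [exact: cvg_cst|exact: cPz].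
have cn : continuous (fun q => normc (expi q - expi t) ^+ 2).
  have cn1 : continuous (fun q => normc (0 + 1 * expi q - expi t)).
    apply: (@continuous_circle _ (fun w => normc (w - expi t))) => q e1 e10.
    exists e1 => // w; apply: le_lt_trans.
    rewrite ler_norml; have := normc_dist (w - expi t) (0 + 1 * expi q - expi t).
    have := normc_dist (0 + 1 * expi q - expi t) (w - expi t).
    rewrite (_ : w - expi t - _ = w - (0 + 1 * expi q)); last by ring.
    rewrite (_ : _ - _ - (w - expi t) = - (w - (0 + 1 * expi q))); last by ring.
    by rewrite normcN; lra.
  under [X in continuous X]eq_fun do rewrite -[expi _]mul1r -[1 * expi _]add0r.
  by move=> q; apply: cvgM; exact: cn1.
have cnP : continuous (fun q => normc (expi q - expi t) ^+ 2 * poisson z q).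
  by move=> q; apply: cvgM; [exact: cn|exact: cPz].
have cZ k h : continuous h -> continuous (fun q => k * h q).
  by move=> ch q; apply: cvgM; [exact: cvg_cst|exact: ch].
have <- : mean (fun q => H (expi q) * poisson z q - H (expi t) * poisson z q) =
    poisson_integral (fun t0 => H (expi t0)) z - H (expi t).
  by rewrite (meanB cHP cHP') (meanZ _ cPz) (mean_poisson z1) mulr1.
have cB := continuousB cHP cHP'.
apply: le_trans (le_norm_mean (continuous_integrable01 cB)) _.
have cM := continuousD (cZ (e / 2) _ cPz) (cZ c _ cnP).
apply: (@le_trans _ _ (mean (fun q => e / 2 * poisson z q +
    c * (normc (expi q - expi t) ^+ 2 * poisson z q)))).
  apply: le_mean; [exact: continuous_abs|exact: cM|].
  move=> q /andP[q0 q1]; have Pq := poisson_ge0 q z1.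
  rewrite -mulrBl normrM (ger0_norm Pq) mulrA -mulrDl ler_wpM2r//.
  have [near|far] := ltP (normc (expi q - expi t)) d.
    have := hd t (expi q); rewrite add0r mul1r => /(_ _ near).
    case/andP: t01 => t0 t1; rewrite t0 ltW// => /(_ isT).
    rewrite (_ : _ - _ = (H (expi q) - H (expi t))%:C%C); last first.
      by apply: complexP => /=; rewrite ?subrr.
    rewrite normc_real => /ltW h; apply: le_trans h _; rewrite lerDl.
    by rewrite mulr_ge0// sqr_ge0.
  have h1 : 2 * Q <= c * normc (expi q - expi t) ^+ 2.
    rewrite /c mulrAC ler_pdivlMr ?exprn_gt0// ler_wpM2l ?mulr_ge0//.
    by rewrite ler_pXn2r ?nnegrE ?normc_ge0// ltW.
  rewrite (le_trans (ler_normB _ _))//.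
  rewrite -[leLHS]add0r; apply: lerD; first by rewrite divr_ge0// ltW.
  by apply: le_trans h1; rewrite mulr_natl mulr2n; apply: lerD; exact: HQ.
rewrite (meanD (cZ (e / 2) _ cPz) (cZ c _ cnP)) (meanZ _ cPz) (meanZ _ cnP).
rewrite (mean_poisson z1) (@poisson_second_moment _ (expi t) r (normc_expi t)).
  exact: korovkin_constant.
by rewrite r0.
Qed.

End poisson_integral.

(** * Uniform L^1 bound on circles *)
Section log_tail.
Context {R : realType}.
Local Notation C := R[i].
Local Notation normc := (@Normc.normc R).
Local Notation mu := (@lebesgue_measure R).

Definition logp (x : R) : R := ln (Num.max 1 x).

Lemma logp_ge0 (x : R) : 0 <= logp x.
Proof. by rewrite ln_ge0// le_max lexx. Qed.

Lemma integral_inv (a b : R) : 0 < a -> a <= b ->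
  (\int[mu]_(t in `[a, b]) (t^-1)%:E = (ln (b / a))%:E)%E.
Proof.
move=> a0; rewrite le_eqVlt => /predU1P[<-|ab].
  by rewrite set_itv1 integral_set1 divff ?gt_eqF// ln1.
have b0 : 0 < b by exact: lt_trans ab.
have dln (x : R) : 0 < x -> is_derive x 1 (@ln R) x^-1 by exact: is_derive1_ln.
rewrite (@continuous_FTC2 _ (fun x => x^-1) (@ln R) a b ab).
- by rewrite ln_div// EFinB.
- apply: continuous_in_subspaceT => x; rewrite inE/= in_itv/= => /andP[ax _].
  by apply: inv_continuous; rewrite gt_eqF// (lt_le_trans a0).
- split.
  + move=> x; rewrite in_itv/= => /andP[ax _].
    by case: (dln x (lt_trans a0 ax)).
  + by apply: cvg_at_right_filter; exact: continuous_ln.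
  + by apply: cvg_at_left_filter; exact: continuous_ln.
- move=> x; rewrite in_itv/= => /andP[ax _].
  by rewrite derive1E; case: (dln x (lt_trans a0 ax)).
Qed.

Lemma integral_if (D : set R) (p : R -> bool) (c : R) :
  measurable D -> measurable (D `&` [set x | p x]) ->
  (\int[mu]_(x in D) (if p x then c else 0)%:E = mu (D `&` [set x | p x]) * c%:E)%E.
Proof.
move=> mD mDp; rewrite muleC -integral_cst// integral_mkcondr.
apply: eq_integral => x _; rewrite patchE.
have -> : (x \in [set x | p x]) = p x.
  by apply/idP/idP => [/set_mem|px]; [|exact/mem_set].
by case: (p x).
Qed.

(** On the domain [Num.max q t] is [t]. Off it, the maximum keeps the inverse continuous and
    nonnegative, so that the integrand used for Tonelli is measurable on the whole plane. *)
Lemma integral_inv_tail (q N : R) : 0 < q ->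
  (\int[mu]_(t in `[q, +oo[) (if t <= N then (Num.max q t)^-1 else 0)%:E =
   (logp (N / q))%:E)%E.
Proof.
move=> q0; have [Nq|qN] := ltP N q.
  rewrite integral0_eq => [|t /=]; last first.
    by rewrite in_itv/= andbT => qt; rewrite leNgt (lt_le_trans Nq).
  by rewrite /logp (max_idPl _) ?ln1// ler_pdivrMr// mul1r ltW.
rewrite /logp (max_idPr _); last by rewrite ler_pdivlMr// mul1r.
rewrite -integral_inv// (_ : `[q, N]%classic = `[q, +oo[ `&` [set t | t <= N]).
  rewrite integral_mkcondr; apply: eq_integral => t.
  rewrite inE/= in_itv/= andbT => qt; rewrite patchE (max_idPr qt).
  have -> : (t \in [set x | x <= N]) = (t <= N).
    by apply/idP/idP => [/set_mem|tN]; [|exact/mem_set].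
  by case: (t <= N).
apply/seteqP; split => t /=; rewrite !in_itv/= andbT; first by move=> /andP[].
by case=> -> ->.
Qed.

(** Layer cake: [distrib] is the integral over the circle of the indicator of t <= |f|, and for a
    fixed boundary point the integral of dt / t from q to |f| is log^+(|f| / q). *)
Lemma tail_quantity_logp (fb : R -> C) (q : R) : 0 < q ->
  measurable_fun (`[0, 1[%classic : set R) (fun t => normc (fb t)) ->
  tail_quantity fb q =
  (q%:E * \int[mu]_(t in `[0%R, 1%R[) (logp (normc (fb t) / q))%:E)%E.
Proof.
move=> q0 mfb; rewrite /tail_quantity; congr (_ * _)%E.
have mI : measurable (`[0, 1[ : set R) by exact: measurable_itv.
have mQ : measurable (`[q, +oo[ : set R) by exact: measurable_itv.
pose N := (fun t => normc (fb t)) \_ `[0, 1[%classic.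
have mN : measurable_fun setT N by exact/(measurable_restrictT _ mI).
have NE t : t \in `[0, 1[%classic -> N t = normc (fb t).
  by move=> h; rewrite /N patchE h.
have DE t : `[0, 1[%classic `&` [set x | t <= normc (fb x)] =
            `[0, 1[%classic `&` [set x | t <= N x].
  apply/seteqP; split => x [xI tx]; split; [exact: xI| |exact: xI|];
    by move: tx => /=; rewrite (NE _ (mem_set xI)).
pose F (x : R * R) : \bar R := (if x.1 <= N x.2 then (Num.max q x.1)^-1 else 0)%:E.
have maxq (t : R) : 0 < Num.max q t by rewrite lt_max q0.
have F0 x : (0 <= F x)%E.
  by rewrite lee_fin; case: ifP => // _; rewrite invr_ge0 ltW.
have mF : measurable_fun setT F.
  apply/measurable_EFinP; apply: measurable_fun_ifT => //=.
    apply: measurable_fun_ler; first exact: measurable_fst.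
    by apply: measurableT_comp => //; exact: measurable_snd.
  apply: (@measurableT_comp _ _ _ _ _ _ (fun t : R => (Num.max q t)^-1) setT) => //.
  apply: continuous_measurable_fun => t.
  apply: cvgV; first by rewrite gt_eqF.
  by apply: continuous_max; [exact: cvg_cst|exact: cvg_id].
have [_ _ FT] := tonelli_set mQ mI mF F0.
transitivity (\int[mu]_(t in `[q, +oo[) \int[mu]_(x in `[0%R, 1%R[) F (t, x))%E.
  apply: eq_integral => t; rewrite inE/= in_itv/= andbT => qt.
  have mDt : measurable (`[0, 1[%classic `&` [set x | t <= N x]).
    rewrite (_ : [set x | t <= N x] = N @^-1` `[t, +oo[).
      apply: measurableI; first exact: mI.
      by rewrite -[_ @^-1` _]setTI; apply: mN => //.
    by apply/seteqP; split => x /=; rewrite in_itv/= andbT.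
  rewrite /distrib DE -(integral_if _ mI mDt); apply: eq_integral => x xI.
  by rewrite /F /= (max_idPr qt).
rewrite FT; apply: eq_integral => x xI; rewrite -(NE _ xI).
exact: (integral_inv_tail (N x) q0).
Qed.

End log_tail.

(** * The logarithmic majorant and the excess of |Re f| over it *)

Section majorant.
Context {R : realType}.
Local Notation C := R[i].
Local Notation normc := (@Normc.normc R).
Local Notation Re := (@complex.Re R).
Local Notation mu := (@lebesgue_measure R).
Local Notation mean h := (\int[mu]_(t in `[0, 1[) h t).
Local Notation integrable01 h := (mu.-integrable `[0, 1[ (EFin \o h)).
Implicit Types (z w : C) (f : C -> C) (fb : R -> C).

Let mI : measurable (`[0, 1[%classic : set R).
Proof. exact: measurable_itv. Qed.

(** [f1] will be log|f| times the Poisson kernel, which takes the value -oo at zeros and is not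
    assumed integrable; hence the comparison of positive and negative parts separately. *)
Lemma integral_le_mean (f1 : R -> \bar R) (f2 : R -> R) :
  measurable_fun (`[0, 1[%classic : set R) f1 -> integrable01 f2 ->
  (forall t, 0 <= t < 1 -> (f1 t <= (f2 t)%:E)%E) ->
  (\int[mu]_(t in `[0%R, 1%R[) f1 t <= (mean f2)%:E)%E.
Proof.
move=> m1 i2 f12; rewrite -EFin_mean_integrable//.
have m2 : measurable_fun (`[0, 1[%classic : set R) (EFin \o f2).
  exact: measurable_int i2.
rewrite integralE [leRHS]integralE; apply: leeB.
  apply: ge0_le_integral => //.
  - exact: measurable_funepos.
  - exact: measurable_funepos m2.
  - move=> t /=; rewrite in_itv/= => /f12 h.
    by rewrite !funeposE ge_max !le_max h lexx orbT.
apply: ge0_le_integral => //.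
- exact: measurable_funeneg m2.
- exact: measurable_funeneg.
- move=> t /=; rewrite in_itv/= => /f12 h.
  by rewrite !funenegE ge_max !le_max leeN2 h lexx orbT.
Qed.

Lemma measurable_elog (N : R -> R) : measurable_fun (`[0, 1[%classic : set R) N ->
  measurable_fun (`[0, 1[%classic : set R) (fun t => elog (N t)).
Proof.
move=> mN; apply: measurable_fun_if => //.
- by apply: measurable_fun_eqr => //; exact: measurable_cst.
- apply/measurable_EFinP; apply: measurableT_comp; first exact: measurable_ln.
  by apply: measurable_funS mN => // ? [].
Qed.

(** On the circle log|f| is at most log^+(|f| / q) + log q, and the Poisson kernel is nonnegative
    with mean 1, so the constant log q passes through the integral and can be subtracted. *)
Lemma log_majorant f fb (q : R) z : 0 < q -> normc z < 1 ->
  measurable_fun (`[0, 1[%classic : set R) (fun t => normc (fb t)) ->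
  integrable01 (fun t => logp (normc (fb t) / q)) ->
  (elog (normc (f z)) <= \int[mu]_(t in `[0%R, 1%R[)
     (elog (normc (fb t)) * (Re ((expi t + z) / (expi t - z)))%:E))%E ->
  q <= normc (f z) ->
  ln (normc (f z) / q) <= poisson_integral (fun t => logp (normc (fb t) / q)) z.
Proof.
move=> q0 z1 mN li fz qf; have fz0 : 0 < normc (f z) by exact: lt_le_trans qf.
pose f2 t := logp (normc (fb t) / q) * poisson z t + ln q * poisson z t.
have cP := poisson_continuous z1.
have iP := integrable01Z (ln q) (continuous_integrable01 cP).
have iL := integrable_poisson li z1.
have i2 : integrable01 f2 by exact: integrable01D.
have : (elog (normc (f z)) <= (mean f2)%:E)%E.
  apply: le_trans fz _; apply: integral_le_mean => //.
    apply: emeasurable_funM; first exact: measurable_elog.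
    apply/measurable_EFinP; apply: measurable_funTS.
    exact: continuous_measurable_fun cP.
  move=> t _; rewrite -/(herglotz z t) -/(poisson z t) /f2 -mulrDl /elog.
  have P0 := poisson_ge0 t z1.
  (* At a zero of the boundary function the product is 0 if the kernel vanishes, by the convention
     for 0 times -oo, and -oo otherwise. *)
  case: ifPn => [_|N0].
    move: P0; rewrite le_eqVlt => /predU1P[<-|P0]; first by rewrite mule0 mulr0.
    by rewrite gt0_mulNye// leNye.
  rewrite -EFinM lee_fin ler_wpM2r// -lerBlDr -ln_div ?posrE//; last first.
    by rewrite lt_def N0 normc_ge0.
  rewrite ler_ln ?posrE; last 2 first.
  - by rewrite divr_gt0// lt_def N0 normc_ge0.
  - by rewrite lt_max ltr01.
  by rewrite le_max lexx orbT.
rewrite /elog gt_eqF// lee_fin /f2 (integrable_meanD iL iP) (meanZ _ cP).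
by rewrite (mean_poisson z1) mulr1 ln_div ?posrE// lerBlDr.
Qed.

Definition excess f (K : C -> R) (c : R) z : R :=
  Num.max 0 (Num.min `|Re (f z)| c - K z).

Lemma maxmin_lipschitz (a b c k l : R) :
  `|Num.max 0 (Num.min a c - k) - Num.max 0 (Num.min b c - l)| <= `|a - b| + `|k - l|.
Proof.
have := ler_norm (a - b); have := ler_norm (k - l).
have := ler_norm (b - a); have := ler_norm (l - k).
rewrite (distrC b) (distrC l) !maxElt !minElt ler_norml.
move=> h1 h2 h3 h4.
by case: (ltP a c) => ?; case: (ltP b c) => ?; case: ltP => ?; case: ltP => ?; lra.
Qed.

Lemma excess_rcont f (K : C -> R) (c : R) z : ccont f z -> rcont K z ->
  rcont (excess f K c) z.
Proof.
move=> cf cK e e0; have e20 : 0 < e / 2 by rewrite divr_gt0.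
have [d d0 hd] := cf _ e20; have [d' d'0 hd'] := rcontE cK e20.
exists (Num.min d d'); first by rewrite lt_min d0.
move=> w; rewrite lt_min => /andP[/hd h1 /hd' h2].
rewrite (_ : _ - _ = (excess f K c w - excess f K c z)%:C%C); last first.
  by apply: complexP => /=; rewrite ?subrr.
rewrite normc_real (le_lt_trans (maxmin_lipschitz _ _ _ _ _))// (splitr e) ltrD//.
apply: le_lt_trans h1; apply: le_trans (normc_Re _).
rewrite ReB; exact: ler_dist_dist.
Qed.

(* At a point where the excess is positive, |f| < c, so that |f| < 2 c on small
   circles around it and the truncation of |Re f| at 2 c is inactive there. *)
Lemma excess_submean f (K : C -> R) (c : R) :
  (forall z, normc z < 1 -> cdiff f z) ->
  (forall z, normc z < 1 -> rcont K z) ->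
  (forall z (p : R), 0 <= p -> normc z + p < 1 ->
     mean (fun q => K (z + p%:C%C * expi q)) = K z) ->
  0 < c -> (forall z, normc z < 1 -> c <= normc (f z) -> 2 * c <= K z) ->
  forall r : R, 0 <= r < 1 -> exists2 d : R, 0 < d & forall p, 0 < p < d ->
     forall t, 0 <= t <= 1 -> excess f K (2 * c) (r%:C%C * expi t) <=
       mean (fun q => excess f K (2 * c) (r%:C%C * expi t + p%:C%C * expi q)).
Proof.
move=> df cK mK c0 fK r /andP[r0 r1].
have nr t : normc (r%:C%C * expi t) = r.
  by rewrite Normc.normcM normc_real normc_expi mulr1 ger0_norm.
have cfr t : ccont f (0 + r%:C%C * expi t) by apply/cdiff_ccont/df; rewrite add0r nr.
have [d d0 hd] := circle_uniform cfr c0.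
exists (Num.min d (1 - r)); first by rewrite lt_min d0 subr_gt0.
move=> p; rewrite lt_min => /andP[p0 /andP[pd pr]] t t01.
have rp1 : r + p < 1 by lra.
set z := r%:C%C * expi t.
have z1 : normc z < 1 by rewrite nr.
have zq q : normc (z + p%:C%C * expi q) < 1.
  rewrite (le_lt_trans (le_normcD _ _))// nr Normc.normcM normc_real normc_expi mulr1.
  by rewrite gtr0_norm.
have fzq q : normc (f (z + p%:C%C * expi q) - f z) < c.
  have := hd t (z + p%:C%C * expi q) t01; rewrite add0r -/z; apply.
  rewrite addrAC subrr add0r Normc.normcM normc_real normc_expi mulr1.
  by rewrite gtr0_norm.
have cs : continuous (fun q => excess f K (2 * c) (z + p%:C%C * expi q)).
  apply: continuous_circle_real => q; apply: excess_rcont; last exact: cK.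
  exact/cdiff_ccont/df.
have s0 w : 0 <= excess f K (2 * c) w by rewrite /excess le_max lexx.
have [sz|] := leP (Num.min `|Re (f z)| (2 * c) - K z) 0.
  by rewrite {1}/excess (max_idPl sz); apply: Rintegral_ge0 => q _.
move=> sz; rewrite {1}/excess (max_idPr (ltW sz)).
have fzc : normc (f z) < c.
  rewrite ltNge; apply/negP => /(fK _ z1) h.
  have : Num.min `|Re (f z)| (2 * c) <= 2 * c by rewrite ge_min lexx orbT.
  lra.
(* With the sign [x] fixed at the centre, x Re f - K has the mean value property; it equals the
   excess at the centre and stays below it on the small circle. *)
have [x [x1 xE]] : exists x : R, `|x| = 1 /\ `|Re (f z)| = x * Re (f z).
  have [h|h] := leP 0 (Re (f z)); first by exists 1; rewrite normr1 mul1r ger0_norm.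
  by exists (-1); rewrite normrN normr1 mulN1r ltr0_norm.
have cR : continuous (fun q => Re (f (z + p%:C%C * expi q))).
  by apply: continuous_circle_Re => q; exact/cdiff_ccont/df.
have cKc : continuous (fun q => K (z + p%:C%C * expi q)).
  by apply: continuous_circle_real => q; exact: cK.
have cxR : continuous (fun q => x * Re (f (z + p%:C%C * expi q))).
  by move=> q; apply: cvgM; [exact: cvg_cst|exact: cR].
have -> : Num.min `|Re (f z)| (2 * c) - K z =
    mean (fun q => x * Re (f (z + p%:C%C * expi q)) - K (z + p%:C%C * expi q)).
  rewrite (meanB cxR cKc) (meanZ _ cR) mK ?nr//; last exact: ltW.
  rewrite (@mean_value_at _ f z (1 - r)); last 2 first.
  - by move=> w wz; apply: df; have := normc_dist w z; rewrite nr; lra.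
  - by rewrite ltW//=; lra.
  rewrite -xE (min_idPl _)//; have := normc_Re (f z); lra.
apply: le_mean => //; first exact: continuousB.
move=> q _; rewrite /excess le_max; apply/orP; right; rewrite lerD2r.
have h1 : x * Re (f (z + p%:C%C * expi q)) <= `|Re (f (z + p%:C%C * expi q))|.
  by rewrite (le_trans (ler_norm _))// normrM x1 mul1r.
rewrite le_min h1/= (le_trans h1)//; have := normc_Re (f (z + p%:C%C * expi q)).
have := normc_dist (f (z + p%:C%C * expi q)) (f z); have := fzq q; lra.
Qed.

End majorant.

(** * Convergence of the truncated function and of the excess at the boundary *)

Section radial_limit.
Context {R : realType}.
Local Notation C := R[i].
Local Notation normc := (@Normc.normc R).
Local Notation Re := (@complex.Re R).
Local Notation mu := (@lebesgue_measure R).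
Local Notation mean h := (\int[mu]_(t in `[0, 1[) h t).
Local Notation integrable01 h := (mu.-integrable `[0, 1[ (EFin \o h)).
Implicit Types (z w : C) (f : C -> C) (fb : R -> C).

Let mI : measurable (`[0, 1[%classic : set R).
Proof. exact: measurable_itv. Qed.

Definition radius (n : nat) : R := 1 - n.+1%:R^-1.

Lemma radius_itv n : 0 <= radius n < 1.
Proof.
rewrite /radius subr_ge0 ltrBlDr ltrDl invr_gt0 ltr0n andbT.
by rewrite invf_le1 ?ler1n// ltr0n.
Qed.

Lemma radius_near (e : R) : 0 < e ->
  exists N, forall n, (N <= n)%N -> 1 - radius n < e.
Proof.
move=> e0; have [N _ hN] := near_infty_natSinv_lt (PosNum e0).
by exists N => n /hN; rewrite /radius opprB addrCA subrr addr0.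
Qed.

Lemma nontangential_radial f t w : nontangential_limit f t w ->
  forall e : R, 0 < e -> exists N, forall n, (N <= n)%N ->
    normc (f ((radius n)%:C%C * expi t) - w) < e.
Proof.
move=> fw e e0; have [d [d0 hd]] := fw 2 (ltr1n _ 2) e e0.
have [N hN] := radius_near d0; exists N => n /hN nd.
have /andP[r0 r1] := radius_itv n.
have nr : normc ((radius n)%:C%C * expi t) = radius n.
  by rewrite Normc.normcM normc_real normc_expi mulr1 ger0_norm.
have nd' : normc ((radius n)%:C%C * expi t - expi t) = 1 - radius n.
  rewrite (_ : _ - _ = - ((1 - radius n)%:C%C * expi t)).
    by rewrite normcN Normc.normcM normc_real normc_expi mulr1 ger0_norm// subr_ge0 ltW.
  rewrite (_ : (1 - radius n)%:C%C = 1 - (radius n)%:C%C); first by ring.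
  by apply: complexP => /=; rewrite ?subr0.
apply: hd; rewrite ?nr// nd'//; lra.
Qed.

Lemma min_lipschitz (a b c : R) : `|Num.min a c - Num.min b c| <= `|a - b|.
Proof.
have := ler_norm (a - b); have := ler_norm (b - a).
rewrite (distrC b) !minElt ler_norml => h1 h2.
by case: (ltP a c) => ?; case: (ltP b c) => ?; lra.
Qed.

Definition trunc f (Q : R) w : R := Num.min `|Re (f w)| Q.

Lemma trunc_rcont f Q z : ccont f z -> rcont (trunc f Q) z.
Proof.
move=> cf e /cf[d d0 hd]; exists d => // w /hd.
rewrite (_ : (trunc f Q w)%:C%C - _ = (trunc f Q w - trunc f Q z)%:C%C); last first.
  by apply: complexP => /=; rewrite ?subrr.
rewrite normc_real; apply: le_lt_trans; rewrite (le_trans (min_lipschitz _ _ _))//.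
by apply: le_trans (normc_Re _); rewrite ReB; exact: ler_dist_dist.
Qed.

Lemma trunc_bounded f Q w : 0 <= Q -> `|trunc f Q w| <= Q.
Proof.
by move=> Q0; rewrite ger0_norm /trunc ?le_min ?normr_ge0// ge_min lexx orbT.
Qed.

Lemma measurable_trunc fb (Q : R) :
  measurable_fun (`[0, 1[%classic : set R) (fun t => Re (fb t)) ->
  measurable_fun (`[0, 1[%classic : set R) (fun t => Num.min `|Re (fb t)| Q).
Proof.
move=> mfb; apply: measurable_minr; last exact: measurable_cst.
exact: measurableT_comp.
Qed.

Lemma integrable01_bounded (h : R -> R) (Q : R) :
  measurable_fun (`[0, 1[%classic : set R) h ->
  (forall t, `|h t| <= Q) -> integrable01 h.
Proof.
move=> mh hQ.
have mu01 : (mu `[0%R, 1%R[%classic < +oo)%E.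
  by rewrite lebesgue_measure_itv/= lte_fin ltr01 -EFinB ltry.
apply: measurable_bounded_integrable => //.
exists Q; split; first exact: num_real.
by move=> M hM t _ /=; apply: le_trans (ltW hM).
Qed.

Lemma radial_L1 f fb (Q : R) : 0 <= Q ->
  (forall z, normc z < 1 -> cdiff f z) ->
  measurable_fun (`[0, 1[%classic : set R) (fun t => Re (fb t)) ->
  {ae mu, forall t : R, `[0, 1[%classic t -> nontangential_limit f t (fb t)} ->
  forall e : R, 0 < e -> exists N, forall n, (N <= n)%N ->
    mean (fun t => `|trunc f Q ((radius n)%:C%C * expi t) - Num.min `|Re (fb t)| Q|) <= e.
Proof.
move=> Q0 df mfb aef e e0.
pose h n t := trunc f Q ((radius n)%:C%C * expi t).
pose g t := Num.min `|Re (fb t)| Q.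
have ch n : continuous (h n).
  apply: continuous_circle0 => t; apply/trunc_rcont/cdiff_ccont/df.
  by have /andP[? ?] := radius_itv n; rewrite Normc.normcM normc_real normc_expi mulr1 ger0_norm.
have mh n : measurable_fun (`[0, 1[%classic : set R) (EFin \o h n).
  by apply/measurable_EFinP; apply: measurable_funTS; exact: continuous_measurable_fun.
have mg : measurable_fun (`[0, 1[%classic : set R) g by exact: measurable_trunc.
have mg' : measurable_fun (`[0, 1[%classic : set R) (EFin \o g) by exact/measurable_EFinP.
have iQ : mu.-integrable (`[0, 1[%classic : set R) (EFin \o cst Q).
  by apply: continuous_integrable01 => ?; exact: cst_continuous.
have hg : {ae mu, forall t, `[0, 1[%classic t -> (EFin \o h n) t @[n --> \oo] --> (EFin \o g) t}.
  have [A [mA A0 sA]] := aef; exists A; split; [exact: mA|exact: A0|].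
  move=> t nt; apply: sA => /= ht'; apply: nt => tI; have {ht'}ht := ht' tI.
  apply: cvg_comp; last exact: (@cvg_id _ (nbhs (g t)%:E)).
  apply/cvgrPdist_lt => e1 e10; have [N hN] := nontangential_radial ht e10.
  exists N => // n /= /hN h1; rewrite distrC (le_lt_trans (min_lipschitz _ _ _))//.
  by apply: le_lt_trans h1; apply: le_trans (normc_Re _); rewrite ReB; exact: ler_dist_dist.
have hQ : {ae mu, forall t n, `[0, 1[%classic t -> (`|(EFin \o h n) t| <= (EFin \o cst Q) t)%E}.
  by apply: aeW => t n _; rewrite lee_fin; exact: trunc_bounded.
have [_ + _] := @dominated_convergence _ _ R mu `[0, 1[%classic mI _ _ _ mh mg' hg iQ hQ.
move=> /fine_cvgP[_ /cvgrPdist_lt /(_ e e0)[N _ hN]].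
exists N => n /hN /=; rewrite sub0r normrN => /ltW; apply: le_trans.
by rewrite (le_trans _ (ler_norm _)).
Qed.

(** Write g for the truncated trace, h for the truncation on a fixed inner circle, D = |h - g| and P
    for the Poisson integral. At a point z over the angle t the excess is at most |trunc(z) - g| +
    |g - h| + |h - P[h](z)| + P[D](z). The first two terms are small in mean, the third uniformly,
    and the mean of the last over a circle is the mean of D. *)
Lemma excess_mean_small f fb (Q : R) (Psi : R -> R) : 0 <= Q ->
  (forall z, normc z < 1 -> cdiff f z) ->
  measurable_fun (`[0, 1[%classic : set R) (fun t => Re (fb t)) ->
  {ae mu, forall t : R, `[0, 1[%classic t -> nontangential_limit f t (fb t)} ->
  integrable01 Psi ->
  (forall t, 0 <= t < 1 -> Num.min `|Re (fb t)| Q <= Psi t) ->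
  forall p e : R, p < 1 -> 0 < e -> exists r : R, [/\ 0 <= r, p <= r, r < 1 &
    mean (fun t => excess f (poisson_integral Psi) Q (r%:C%C * expi t)) <= e].
Proof.
move=> Q0 df mfb aef Psii gPsi p e p1 e0.
pose g t := Num.min `|Re (fb t)| Q.
have e4 : 0 < e / 4 by rewrite divr_gt0.
have [N hN] := radial_L1 Q0 df mfb aef e4.
(* A dilate, hence continuous at the points of the unit circle, where the trace itself is only
   measurable. *)
pose H w := trunc f Q ((radius N)%:C%C * w).
have nr n t : normc ((radius n)%:C%C * expi t) < 1.
  by have /andP[? ?] := radius_itv n; rewrite Normc.normcM normc_real normc_expi mulr1 ger0_norm.
have cH t : rcont H (expi t).
  apply: (@ccont_comp _ (fun w => (trunc f Q w)%:C%C) (fun w => (radius N)%:C%C * w)).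
    by apply: ccontM; [exact: ccont_cst|exact: ccont_id].
  exact/trunc_rcont/cdiff_ccont/df.
have HQ t : `|H (expi t)| <= Q by exact: trunc_bounded.
have [r0 r01 hr0] := poisson_integral_uniform cH HQ e4.
have pr0 : 0 < 1 - Num.max p r0 by rewrite subr_gt0 gt_max p1.
have [M hM] := radius_near pr0.
pose n := maxn N M; pose r := radius n.
have /andP[rge rlt] := radius_itv n.
have rM : Num.max p r0 <= r by have := hM n (leq_maxr _ _); rewrite -/r; lra.
have pr : p <= r by rewrite (le_trans _ rM)// le_max lexx.
have r0r : r0 <= r by rewrite (le_trans _ rM)// le_max lexx orbT.
exists r; split => //.
pose h t := H (expi t); pose D t := `|h t - g t|.
have mg : measurable_fun (`[0, 1[%classic : set R) g by exact: measurable_trunc.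
have ig : integrable01 g.
  apply: (@integrable01_bounded g Q mg) => t.
  by rewrite ger0_norm /g ?le_min ?normr_ge0// ge_min lexx orbT.
have ch : continuous h.
  have := @continuous_circle0 _ H 1; under eq_fun do rewrite mul1r.
  by apply => t; rewrite mul1r.
have ih := continuous_integrable01 ch.
have iD : integrable01 D by exact/integrable01_abs/integrable01B.
have cf : continuous (fun t => trunc f Q (r%:C%C * expi t)).
  by apply: continuous_circle0 => s; apply/trunc_rcont/cdiff_ccont/df; exact: nr.
pose A t := `|trunc f Q (r%:C%C * expi t) - g t|.
have iA : integrable01 A.
  by apply/integrable01_abs/integrable01B => //; exact: continuous_integrable01.
have cKc (Phi : R -> R) : integrable01 Phi ->
    continuous (fun t => poisson_integral Phi (r%:C%C * expi t)).
  by move=> iPhi; apply: continuous_circle0 => t; apply: poisson_integral_rcont => //; exact: nr.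
have iKD := continuous_integrable01 (cKc _ iD).
have D0 t : 0 <= t < 1 -> 0 <= D t by move=> _; exact: normr_ge0.
have icst : integrable01 (cst (e / 4)).
  by apply: continuous_integrable01 => ?; exact: cst_continuous.
apply: (@le_trans _ _ (mean (fun t => (A t + D t) + (e / 4 + poisson_integral D (r%:C%C * expi t))))).
  apply: integrable_le_mean.
  - apply: continuous_integrable01; apply: continuous_circle0 => t.
    apply: excess_rcont; first by apply/cdiff_ccont/df; exact: nr.
    by apply: poisson_integral_rcont; [exact: Psii|exact: nr].
  - by apply: integrable01D; apply: integrable01D.
  move=> t t01; set z := r%:C%C * expi t.
  have z1 : normc z < 1 by exact: nr.
  have KD0 : 0 <= poisson_integral D z by exact: poisson_integral_ge0.
  have A0 : 0 <= A t by exact: normr_ge0.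
  have D0' : 0 <= D t by exact: normr_ge0.
  rewrite /excess ge_max; apply/andP; split; first by lra.
  (* Positivity of the kernel applied to h - D <= g <= Psi. *)
  have Kge : poisson_integral h z - poisson_integral D z <= poisson_integral Psi z.
    have i1 := integrable_poisson ih z1; have i2 := integrable_poisson iD z1.
    rewrite /poisson_integral -(integrable_meanB i1 i2).
    apply: integrable_le_mean; [exact: integrable01B|exact: integrable_poisson|].
    move=> s s01; rewrite -mulrBl ler_wpM2r ?poisson_ge0// (le_trans _ (gPsi s s01))//.
    by rewrite lerBlDl -lerBlDr ler_norm.
  have rI : 0 <= r < 1 by rewrite rge.
  have := hr0 r t rI r0r t01; rewrite -/z -/(h t) -[fun t => H (expi t)]/h => hK.
  have h1 := ler_norm (trunc f Q z - g t); have h2 := ler_norm (g t - h t).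
  have h3 := ler_norm (h t - poisson_integral h z).
  rewrite distrC in h2; rewrite distrC in h3.
  rewrite -/(trunc f Q z); rewrite -/(A t) in h1; rewrite -/(D t) in h2; lra.
rewrite (integrable_meanD (integrable01D iA iD) (integrable01D icst iKD)).
rewrite (integrable_meanD iA iD) (integrable_meanD icst iKD) mean_cst.
rewrite mean_poisson_integral ?rge//.
(* The same estimate is used twice: at the far index [n] for [A], and at [N] itself for [D], which
   accounts for two of the four quarters of [e]. *)
have h1 : mean A <= e / 4 by exact: (hN n (leq_maxl _ _)).
have h2 : mean D <= e / 4 by exact: (hN N (leqnn _)).
lra.
Qed.

End radial_limit.

(** * The bound at one level, then along the lower limit *)

Section circle_bound.
Context {R : realType}.
Local Notation C := R[i].
Local Notation normc := (@Normc.normc R).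
Local Notation Re := (@complex.Re R).
Local Notation Im := (@complex.Im R).
Local Notation mu := (@lebesgue_measure R).
Local Notation mean h := (\int[mu]_(t in `[0, 1[) h t).
Local Notation integrable01 h := (mu.-integrable `[0, 1[ (EFin \o h)).
Implicit Types (z w : C) (f : C -> C) (fb : R -> C).

Let mI : measurable (`[0, 1[%classic : set R).
Proof. exact: measurable_itv. Qed.

Lemma measurable_normc fb :
  measurable_fun (`[0, 1[%classic : set R) (fun t => Re (fb t)) ->
  measurable_fun (`[0, 1[%classic : set R) (fun t => Im (fb t)) ->
  measurable_fun (`[0, 1[%classic : set R) (fun t => normc (fb t)).
Proof.
move=> mR mIm.
rewrite (_ : (fun t => _) = fun t => Num.sqrt (Re (fb t) ^+ 2 + Im (fb t) ^+ 2)).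
  apply: (@measurableT_comp _ _ _ _ _ _ (@Num.sqrt R)).
    by apply: continuous_measurable_fun; exact: sqrt_continuous.
  by apply: measurable_funD; apply: measurable_funX.
by apply/funext => t; case: (fb t).
Qed.

Lemma integrable_logp fb (q : R) : 0 < q ->
  measurable_fun (`[0, 1[%classic : set R) (fun t => normc (fb t)) ->
  (tail_quantity fb q < +oo)%E ->
  integrable01 (fun t => logp (normc (fb t) / q)).
Proof.
move=> q0 mN; rewrite tail_quantity_logp// => fin.
apply/integrableP; split.
  apply/measurable_EFinP; rewrite /logp; apply: measurableT_comp.
    exact: measurable_ln.
  apply: measurable_maxr; first exact: measurable_cst.
  by apply: measurable_funM => //; exact: measurable_cst.
rewrite (_ : (\int[_]_(x in _) _)%E =
    (\int[mu]_(t in `[0%R, 1%R[) (logp (normc (fb t) / q))%:E)%E); last first.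
  by apply: eq_integral => t _ /=; rewrite ger0_norm// logp_ge0.
rewrite ltey; apply/eqP => E; move: fin.
by rewrite E gt0_muley// ltxx.
Qed.

Lemma circle_L1_bound f fb (q rho : R) :
  (forall z, normc z < 1 -> cdiff f z) ->
  {ae mu, forall t : R, `[0, 1[%classic t -> nontangential_limit f t (fb t)} ->
  measurable_fun (`[0, 1[%classic : set R) (fun t => Re (fb t)) ->
  measurable_fun (`[0, 1[%classic : set R) (fun t => Im (fb t)) ->
  (forall z, normc z < 1 -> (elog (normc (f z)) <= \int[mu]_(t in `[0%R, 1%R[)
     (elog (normc (fb t)) * (Re ((expi t + z) / (expi t - z)))%:E))%E) ->
  integrable01 (fun t => Re (fb t)) ->
  0 < q -> (tail_quantity fb q < +oo)%E -> 0 <= rho < 1 ->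
  (forall t, 0 <= t < 1 -> normc (f (rho%:C%C * expi t)) <= 2 * (2 * q)) ->
  ((mean (fun t => `|Re (f (rho%:C%C * expi t))|))%:E <=
   \int[mu]_(t in `[0%R, 1%R[) `|Re (fb t)|%:E + (4 / ln 2)%:E * tail_quantity fb q)%E.
Proof.
move=> df aef mR mIm fN iR q0 tq rho01 fq.
have mN := measurable_normc mR mIm.
have iL := integrable_logp q0 mN tq.
have ln20 : 0 < ln 2 :> R by rewrite ln_gt0// ltr1n.
pose c := 4 / ln 2 * q.
have c0 : 0 < c by rewrite mulr_gt0// divr_gt0.
pose lq t := logp (normc (fb t) / q).
pose Psi t := `|Re (fb t)| + c * lq t.
have iA := integrable01_abs iR; have icL := integrable01Z c iL.
have iPsi : integrable01 Psi := integrable01D iA icL.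
have Psi_ge t : 0 <= t < 1 -> Num.min `|Re (fb t)| (2 * (2 * q)) <= Psi t.
  move=> _; apply: (@le_trans _ _ `|Re (fb t)|); first by rewrite ge_min lexx.
  by rewrite lerDl; apply: mulr_ge0; [exact: ltW|exact: logp_ge0].
have Psi0 t : 0 <= t < 1 -> 0 <= Psi t.
  by move=> _; apply: addr_ge0 => //; apply: mulr_ge0; [exact: ltW|exact: logp_ge0].
have Q0 : 0 < 2 * (2 * q) by rewrite !mulr_gt0.
pose K := poisson_integral Psi.
have cK z : normc z < 1 -> rcont K z by exact: poisson_integral_rcont.
have mK z (p : R) : 0 <= p -> normc z + p < 1 -> mean (fun q => K (z + p%:C%C * expi q)) = K z.
  exact: poisson_integral_mean_value.
have fK z : normc z < 1 -> 2 * q <= normc (f z) -> 2 * (2 * q) <= K z.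
  move=> z1 qf; have qf' : q <= normc (f z) by lra.
  have := log_majorant q0 z1 mN iL (fN z z1) qf' => h.
  have l2 : ln 2 <= ln (normc (f z) / q).
    by rewrite ler_ln ?posrE ?divr_gt0//; [rewrite ler_pdivlMr|exact: lt_le_trans qf'].
  have -> : 2 * (2 * q) = c * ln 2 by rewrite /c; field; exact: lt0r_neq0.
  apply: (@le_trans _ _ (c * poisson_integral lq z)).
    by rewrite ler_pM2l// (le_trans l2).
  have iLz := integrable_poisson iL z1.
  rewrite /K /poisson_integral -(integrable_meanZ c iLz).
  apply: integrable_le_mean; [exact: integrable01Z|exact: integrable_poisson|].
  move=> t _; rewrite mulrA; apply: ler_wpM2r; first exact: poisson_ge0.
  by rewrite lerDr.
have q20 : 0 < 2 * q by rewrite mulr_gt0.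
have sub := excess_submean df cK mK q20 fK.
have ce z : normc z < 1 -> rcont (excess f K (2 * (2 * q))) z.
  by move=> z1; apply: excess_rcont; [exact/cdiff_ccont/df|exact: cK].
have e0 z : 0 <= excess f K (2 * (2 * q)) z by rewrite /excess le_max lexx.
have mono := submean_monotone e0 ce sub.
have /andP[rho0 rho1] := rho01.
have M0 : mean (fun t => excess f K (2 * (2 * q)) (rho%:C%C * expi t)) <= 0.
  apply/ler_addgt0Pr => e ep; rewrite add0r.
  have [r [r0 rhor r1 hr]] := excess_mean_small (ltW Q0) df mR aef iPsi Psi_ge rho1 ep.
  by apply: le_trans hr; apply: mono => //; rewrite rho0.
have nr t : normc (rho%:C%C * expi t) < 1.
  by rewrite Normc.normcM normc_real normc_expi mulr1 ger0_norm.
have cex : continuous (fun t => excess f K (2 * (2 * q)) (rho%:C%C * expi t)).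
  by apply: continuous_circle0 => t; apply: ce; exact: nr.
have cKr : continuous (fun t => K (rho%:C%C * expi t)).
  by apply: continuous_circle0 => t; apply: cK; exact: nr.
have cRf : continuous (fun t => Re (f (rho%:C%C * expi t))).
  apply: (@continuous_circle0 _ (fun w => Re (f w))) => t.
  have := cdiff_ccont (df _ (nr t)) => cf e /cf[d d0 hd]; exists d => // w /hd.
  rewrite (_ : (Re (f w))%:C%C - _ = (Re (f w - f (rho%:C%C * expi t)))%:C%C); last first.
    by apply: complexP => /=; rewrite ?ReB ?subrr.
  by rewrite normc_real; apply: le_lt_trans; exact: normc_Re.
have main : mean (fun t => `|Re (f (rho%:C%C * expi t))|) <= mean Psi.
  rewrite -(mean_poisson_integral iPsi Psi0 rho01) -[leRHS]addr0.
  apply: (@le_trans _ _ (mean (fun t => K (rho%:C%C * expi t)) +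
     mean (fun t => excess f K (2 * (2 * q)) (rho%:C%C * expi t)))); last first.
    by rewrite lerD2l.
  rewrite -(meanD cKr cex); apply: le_mean; [exact: continuous_abs|exact: continuousD|].
  move=> t t01; rewrite -lerBlDl /excess le_max; apply/orP; right.
  rewrite lerD2r le_min lexx /=; apply: le_trans (normc_Re _) _; exact: fq.
apply: (@le_trans _ _ (mean Psi)%:E); first by rewrite lee_fin.
rewrite (integrable_meanD iA icL) (integrable_meanZ c iL) EFinD.
rewrite tail_quantity_logp// (EFin_mean_integrable iA).
rewrite (EFin_mean_integrable iL) -!EFinM lee_fin /c mulrA.
by [].
Qed.

(** The bound at level [q] needs |f| <= 4 q on the circle. As the infimum of the tail quantity over
    [M, oo) is at most the lower limit for every [M], a nearly optimal [q] can be found beyond any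
    bound of |f| on that circle. *)
Lemma circle_L1_liminf f fb (rho : R) :
  (forall z, normc z < 1 -> cdiff f z) ->
  {ae mu, forall t : R, `[0, 1[%classic t -> nontangential_limit f t (fb t)} ->
  measurable_fun (`[0, 1[%classic : set R) (fun t => Re (fb t)) ->
  measurable_fun (`[0, 1[%classic : set R) (fun t => Im (fb t)) ->
  (forall z, normc z < 1 -> (elog (normc (f z)) <= \int[mu]_(t in `[0%R, 1%R[)
     (elog (normc (fb t)) * (Re ((expi t + z) / (expi t - z)))%:E))%E) ->
  integrable01 (fun t => Re (fb t)) ->
  (liminf_pinfty (tail_quantity fb) < +oo)%E -> 0 <= rho < 1 ->
  ((mean (fun t => `|Re (f (rho%:C%C * expi t))|))%:E <=
   \int[mu]_(t in `[0%R, 1%R[) `|Re (fb t)|%:E +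
     (4 / ln 2)%:E * liminf_pinfty (tail_quantity fb))%E.
Proof.
move=> df aef mR mIm fN iR Lfin rho01; have /andP[rho0 rho1] := rho01.
set L := liminf_pinfty _ in Lfin *.
have ln20 : 0 < ln 2 :> R by rewrite ln_gt0// ltr1n.
have c0 : 0 < 4 / ln 2 :> R by rewrite divr_gt0.
have tail0 (x : R) : 0 < x -> (0 <= tail_quantity fb x)%E.
  move=> x0; apply: mule_ge0; first by rewrite lee_fin ltW.
  apply: integral_ge0 => t /=; rewrite in_itv/= andbT => xt.
  by apply: mule_ge0; [exact: measure_ge0|rewrite lee_fin invr_ge0 (le_trans (ltW x0))].
have L0 : (0 <= L)%E.
  (* The supremum also ranges over negative [M], where the sign of the tail quantity is not
     controlled; [M] = 1 suffices for a lower bound. *)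
  apply: le_ereal_sup_tmp; exists (ereal_inf (tail_quantity fb @` `[1, +oo[)); first by exists 1.
  apply: le_ereal_inf_tmp => _ [x + <-]; rewrite /= in_itv/= andbT => x1.
  by apply: tail0; exact: lt_le_trans x1.
have Lf : L \is a fin_num by rewrite ge0_fin_numE.
have nr t : normc (rho%:C%C * expi t) < 1.
  by rewrite Normc.normcM normc_real normc_expi mulr1 ger0_norm.
have [B hB] : exists B : R, forall t, 0 <= t < 1 -> normc (f (rho%:C%C * expi t)) <= B.
  have cn : continuous (fun t => normc (f (rho%:C%C * expi t))).
    apply: (@continuous_circle0 _ (fun w => normc (f w))) => t.
    have := cdiff_ccont (df _ (nr t)) => cf e /cf[d d0 hd]; exists d => // w /hd.
    rewrite (_ : (normc (f w))%:C%C - _ = (normc (f w) - normc (f (rho%:C%C * expi t)))%:C%C);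
      last by apply: complexP => /=; rewrite ?subrr.
    rewrite normc_real; apply: le_lt_trans; rewrite ler_norml.
    have := normc_dist (f w) (f (rho%:C%C * expi t)).
    have := normc_dist (f (rho%:C%C * expi t)) (f w); rewrite normcB; lra.
  have [b _ hb] := @EVT_max _ _ 0 1 ler01 (continuous_subspaceT cn).
  exists (normc (f (rho%:C%C * expi b))) => t /andP[t0 t1].
  by apply: hb; rewrite in_itv/= t0 ltW.
apply/lee_addgt0Pr => e e0.
pose e' := e / (4 / ln 2).
have e'0 : 0 < e' by rewrite divr_gt0.
pose M := Num.max 1 B.
have : (ereal_inf (tail_quantity fb @` `[M, +oo[) < L + e'%:E)%E.
  apply: (@le_lt_trans _ _ L); last by rewrite lteDl// lte_fin.
  by apply: ereal_sup_ubound; exists M.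
move=> /ereal_inf_lt[_ [q + <-]]; rewrite /= in_itv/= andbT => Mq tq.
have q1 : 1 <= q by rewrite (le_trans _ Mq)// /M le_max lexx.
have q0 : 0 < q by exact: lt_le_trans q1.
have Bq : B <= q by rewrite (le_trans _ Mq)// /M le_max lexx orbT.
have tfin : (tail_quantity fb q < +oo)%E.
  by apply: (lt_trans tq); rewrite -(fineK Lf) -EFinD ltry.
apply: le_trans (circle_L1_bound df aef mR mIm fN iR q0 tfin rho01 _) _.
  by move=> t /hB h; lra.
rewrite !(EFin_mean_integrable (integrable01_abs iR)).
rewrite -addeA; apply: leeD; first exact: lexx.
apply: (@le_trans _ _ ((4 / ln 2)%:E * (L + e'%:E))%E).
  by rewrite lee_pmul2l ?lte_fin// ltW.
rewrite -(fineK Lf) -EFinD -!EFinM -EFinD lee_fin mulrDr lerD2l /e' mulrC divfK//.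
exact: lt0r_neq0.
Qed.

End circle_bound.

(** * Weak limits of densities *)
Section ultralimit.
Context {R : realType}.
Variables (U : set_system nat) (UU : UltraFilter U).

Let UP : ProperFilter U := ultra_proper.

(** The limit is the supremum of the levels that lie below [a n] for [U]-almost all n. A level
    slightly above it fails this, and for an ultrafilter failure means that the complement belongs
    to [U]. *)
Lemma ultra_bounded_cvg (a : nat -> R) (A : R) : (forall n, 0 <= a n <= A) ->
  exists l : R, a n @[n --> U] --> l.
Proof.
move=> aA; pose S := [set x : R | U [set n | x <= a n]].
have S0 : S 0 by apply: filterS filterT => n _ /=; have /andP[] := aA n.
have SA x : S x -> x <= A.
  by move=> /filter_ex[n /= /le_trans]; apply; have /andP[] := aA n.
exists (sup S); apply/cvgrPdist_lt => e e0.
have [x Sx xs] : exists2 x, S x & sup S - e < x.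
  by apply: sup_adherent => //; split; [exists 0|exists A].
have nS : ~ S (sup S + e / 2).
  move=> h; have : sup S + e / 2 <= sup S by apply: ub_le_sup => //; exists A.
  by rewrite gerDl leNgt divr_gt0.
have [//|h] := in_ultra_setVsetC [set n | sup S + e / 2 <= a n] UU.
apply: filterS (filterI Sx h) => n [/= h1 /negP]; rewrite -ltNge => h2.
rewrite ltr_norml; lra.
Qed.

Lemma ultra_le (a b : nat -> R) (l k : R) : a n @[n --> U] --> l ->
  b n @[n --> U] --> k -> (forall n, a n <= b n) -> l <= k.
Proof.
move=> /cvgrPdist_lt al /cvgrPdist_lt bk ab; apply/ler_addgt0Pr => e e0.
have e20 : 0 < e / 2 by rewrite divr_gt0.
have [n [/= h1 h2]] := filter_ex (filterI (al _ e20) (bk _ e20)).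
have := ab n; move: h1 h2; rewrite !ltr_norml; lra.
Qed.

End ultralimit.

(** * Summation by parts and Stieltjes sums *)

Section grid.
Context {R : realType}.
Implicit Types (g F D : R -> R) (x : nat -> R).

Lemma uniform_modulus g (a b : R) : a <= b -> continuous g ->
  forall e : R, 0 < e -> exists2 d, 0 < d & forall s t, a <= s <= b ->
    `|s - t| < d -> `|g s - g t| <= e.
Proof.
move=> ab cg e e0.
pose P (x y _ _ : R) := exists2 d, 0 < d & forall s t, x <= s <= y ->
    `|s - t| < d -> `|g s - g t| <= e.
suff: P a b 0 0 by [].
apply: rect_bisection => //.
  move=> x y u v xy _ [d d0 hd] _ [d' d'0 hd'] _.
  exists (Num.min d d'); first by rewrite lt_min d0.
  move=> s t /andP[xs sy]; rewrite lt_min => /andP[w1 w2].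
  have [sm|ms] := leP s ((x + y) / 2); first by apply: hd => //; rewrite xs.
  by apply: hd' => //; rewrite ltW.
move=> x v _ _; have /cvgrPdist_lt /(_ _ (divr_gt0 e0 (ltr0n _ 2)))[d /= d0 hd] := cg x.
exists (d / 2); first by rewrite divr_gt0.
move=> p q u1 u2 _ _ _ _ /andP[px xq] _ qp _; exists (d / 2); first by rewrite divr_gt0.
move=> s t /andP[ps sq] st.
have sx : `|x - s| < d by rewrite ltr_norml; lra.
have tx : `|x - t| < d by move: st; rewrite !ltr_norml; lra.
have := hd s sx; have := hd t tx; rewrite (distrC (g x) (g s)) => h1 h2.
rewrite -[g s](subrK (g x)) -addrA (le_trans (ler_normD _ _))// (splitr e).
by rewrite lerD// ltW.
Qed.

Lemma abel_sum (g D : nat -> R) m :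
  \sum_(i < m) g i.+1 * (D i.+1 - D i) =
  g m * D m - g 0%N * D 0%N - \sum_(i < m) D i * (g i.+1 - g i).
Proof.
elim: m => [|m IH]; first by rewrite !big_ord0; ring.
by rewrite !big_ord_recr /= IH; ring.
Qed.

(* [F'] plays the role of the right-continuous version of [F]. *)
Lemma abel_compare (g F F' : nat -> R) (om : R) m : 0 <= om ->
  (forall i, `|g i.+1 - g i| <= om) -> (forall i, F i <= F' i) ->
  (forall i, F' i <= F i.+1) -> F' 0%N = F 0%N -> F' m = F m ->
  `|\sum_(i < m) g i.+1 * (F' i.+1 - F' i) -
    \sum_(i < m) g i.+1 * (F i.+1 - F i)| <= om * (F m - F 0%N).
Proof.
move=> om0 gom FF' F'F e0 em.
rewrite -sumrB (eq_bigr (fun i : 'I_m => g i.+1 * ((F' i.+1 - F i.+1) - (F' i - F i)))); last first.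
  by move=> i _; ring.
(* Summation by parts moves the differences onto [g], where they are at most [om]; the factor F' i -
   F i is at most F (i+1) - F i, which telescopes. *)
rewrite (abel_sum g (fun i => F' i - F i)) e0 em !subrr !mulr0 subrr sub0r normrN.
rewrite (le_trans (ler_norm_sum _ _ _))//.
apply: (@le_trans _ _ (\sum_(i < m) om * (F i.+1 - F i))).
  apply: ler_sum => i _; rewrite normrM [`|F' i - F i|]ger0_norm ?subr_ge0//.
  rewrite mulrC; apply: ler_pM; [exact: normr_ge0|by rewrite subr_ge0|exact: gom|].
  by rewrite lerB.
rewrite -mulr_sumr ler_wpM2l//.
rewrite -(big_mkord xpredT (fun i => F i.+1 - F i)) telescope_sumr//.
Qed.

End grid.

Section stieltjes_sum.
Context {R : realType}.
Variable nu : {measure set (measurableTypeR R) -> \bar R}.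
Implicit Types (g w : R -> R) (x : nat -> R).

Lemma Rintegral_itv_split (h : R -> R) (a b c : R) : a <= b -> b <= c ->
  nu.-integrable `]a, c] (EFin \o h) ->
  \int[nu]_(t in `]a, c]) h t =
  \int[nu]_(t in `]a, b]) h t + \int[nu]_(t in `]b, c]) h t.
Proof.
move=> ab bc hi.
have E : (`]a, b] `|` `]b, c] = `]a, c] :> set R)%classic.
  by rewrite -itv_bndbnd_setU// bnd_simp.
rewrite -E Rintegral_setU ?E//.
apply/disj_set2P; rewrite -subset0 => t/=; rewrite !in_itv/=.
by move=> [/andP[_ tb] /andP[bt _]]; move: bt; rewrite ltNge tb.
Qed.

Lemma integrable_EFinB D h k : measurable D -> nu.-integrable D (EFin \o h) ->
  nu.-integrable D (EFin \o k) -> nu.-integrable D (EFin \o (fun t => h t - k t)).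
Proof. by move=> mD hi ki; apply: eq_integrable (integrableB mD hi ki). Qed.

Lemma stieltjes_cell g w (a b om : R) : (forall t, 0 <= w t) ->
  nu.-integrable `]a, b] (EFin \o w) ->
  nu.-integrable `]a, b] (EFin \o (fun t => g t * w t)) ->
  (forall t, a < t <= b -> `|g t - g b| <= om) ->
  `|\int[nu]_(t in `]a, b]) (g t * w t) - g b * \int[nu]_(t in `]a, b]) w t|
  <= om * \int[nu]_(t in `]a, b]) w t.
Proof.
move=> w0 wi gwi gom.
have mI : measurable (`]a, b]%classic : set (measurableTypeR R)).
  exact: measurable_itv.
have Zi (k : R) : nu.-integrable `]a, b] (EFin \o (fun t => k * w t)).
  rewrite (_ : _ \o _ = (fun t => k%:E * (EFin \o w) t)%E).
    exact: integrableZl.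
  by apply/funext => t /=; rewrite EFinM.
rewrite -[X in _ - X]RintegralZl//.
rewrite -RintegralB//.
have Bi : nu.-integrable `]a, b] (EFin \o (fun t => g t * w t - g b * w t)).
  by apply: integrable_EFinB => //; exact: Zi.
apply: le_trans (le_normr_Rintegral mI Bi) _.
rewrite -RintegralZl//; apply: le_Rintegral => //.
  exact: (integrable_norm Bi).
move=> t; rewrite /= in_itv/= => tab.
by rewrite -mulrBl normrM (ger0_norm (w0 t)) ler_wpM2r ?gom.
Qed.

(** The weight allows two uses: Lebesgue measure with a density of the sequence, and the limit
    measure with weight 1. Both integrals are thereby compared with sums over the same grid. *)
Lemma stieltjes_sum g w x (om : R) m : (forall t, 0 <= w t) ->
  (forall i, x i <= x i.+1) ->
  nu.-integrable `]x 0%N, x m] (EFin \o w) ->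
  nu.-integrable `]x 0%N, x m] (EFin \o (fun t => g t * w t)) ->
  (forall i t, x i < t <= x i.+1 -> `|g t - g (x i.+1)| <= om) ->
  `|\int[nu]_(t in `]x 0%N, x m]) (g t * w t) -
    \sum_(i < m) g (x i.+1) * \int[nu]_(t in `]x i, x i.+1]) w t|
  <= om * \int[nu]_(t in `]x 0%N, x m]) w t.
Proof.
move=> w0 xS; elim: m => [|m IH] wi gwi gom.
  by rewrite set_itvoc0 !Rintegral_set0 big_ord0 mulr0 subrr normr0.
have x0m : x 0%N <= x m by elim: {IH wi gwi} m => // m /le_trans; exact.
have s1 : (`]x 0%N, x m] `<=` `]x 0%N, x m.+1])%classic.
  by apply: subset_itvl; rewrite bnd_simp.
have s2 : (`]x m, x m.+1] `<=` `]x 0%N, x m.+1])%classic.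
  by apply: subset_itvr; rewrite bnd_simp.
have iS (a b : R) h : (`]a, b] `<=` `]x 0%N, x m.+1])%classic ->
    nu.-integrable `]x 0%N, x m.+1] (EFin \o h) ->
    nu.-integrable `]a, b] (EFin \o h).
  by move=> s hi; apply: integrableS hi => //; exact: measurable_itv.
rewrite (Rintegral_itv_split x0m (xS m) wi) (Rintegral_itv_split x0m (xS m) gwi).
rewrite big_ord_recr/= opprD addrACA (le_trans (ler_normD _ _))// mulrDr.
apply: lerD; first by apply: IH => //; exact: iS.
by apply: stieltjes_cell => //; [exact: iS|exact: iS|exact: gom].
Qed.

End stieltjes_sum.

Section cumulative_regularization.
Context {R : realType}.
Variable G : R -> R.
Hypothesis G_nd : {homo G : x y / x <= y}.
Hypothesis G_ge0 : forall x, 0 <= G x.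

(** For monotone [G] this is G(x+). A pointwise limit of cumulative functions need not be
    right-continuous, as a Lebesgue-Stieltjes measure requires. *)
Definition right_limit (x : R) : R := inf (G @` `]x, +oo[).

Lemma right_limit_ub x y : x < y -> right_limit x <= G y.
Proof.
move=> xy; apply: ge_inf; last by exists y => //=; rewrite in_itv/= xy.
by exists 0 => _ [t _ <-].
Qed.

Lemma right_limit_has_inf x : has_inf (G @` `]x, +oo[).
Proof.
split; last by exists 0 => _ [t _ <-].
by exists (G (x + 1)); exists (x + 1) => //=; rewrite in_itv/= andbT ltrDl.
Qed.

Lemma right_limit_lb x : G x <= right_limit x.
Proof.
apply: lb_le_inf; first by have [] := right_limit_has_inf x.
by move=> _ [t /= + <-]; rewrite in_itv/= andbT => /ltW /G_nd.
Qed.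

Lemma right_limit_nondecreasing : nondecreasing right_limit.
Proof.
move=> x y; rewrite le_eqVlt => /predU1P[->//|xy].
exact: le_trans (right_limit_ub xy) (right_limit_lb y).
Qed.

Lemma right_limit_right_continuous : right_continuous right_limit.
Proof.
move=> x; apply/cvgrPdist_lt => e e0.
have [_ [y /= + <-] ye] := inf_adherent e0 (right_limit_has_inf x).
rewrite in_itv/= andbT => xy.
near=> z.
have xz : x < z by near: z; exact: nbhs_right_gt.
have zy : z < y by near: z; exact: nbhs_right_lt.
have h1 := right_limit_ub zy; have h2 := right_limit_nondecreasing (ltW xz).
by rewrite distrC ger0_norm ?subr_ge0// ltrBlDl (le_lt_trans h1).
Unshelve. all: by end_near. Qed.

HB.instance Definition _ := isCumulative.Build R _ R right_limit
  right_limit_nondecreasing right_limit_right_continuous.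

Definition right_limit_measure : {measure set (measurableTypeR R) -> \bar R} :=
  lebesgue_stieltjes_measure (right_limit : cumulative R R).

Lemma right_limit_measureE (a b : R) : a <= b ->
  right_limit_measure (`]a, b]%classic : set R) = (right_limit b - right_limit a)%:E.
Proof.
move=> ab; rewrite /right_limit_measure/= /lebesgue_stieltjes_measure.
rewrite /measure_extension measurable_mu_extE/=; last exact: is_ocitv.
by rewrite wlength_itv_bnd.
Qed.

End cumulative_regularization.

Lemma norm_sum4 (R : realDomainType) (a b c d k e : R) :
  `|a| <= k -> `|b| <= k -> `|c| < e -> `|d| <= k -> 3 * k < e ->
  `|a + b + c + d| < e + e.
Proof. rewrite !ler_norml !ltr_norml; lra. Qed.

(** * Helly selection along an ultrafilter *)

Section density_limit.
Context {R : realType}.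
Local Notation mu := (@lebesgue_measure R).
Local Notation mean h := (\int[mu]_(t in `[0, 1[) h t).
Variables (U : set_system nat) (UU : UltraFilter U).
Variables (p : nat -> R -> R) (A : R).
Hypothesis p_cont : forall n, continuous (p n).
Hypothesis p_ge0 : forall n t, 0 <= p n t.
Hypothesis p_mean : forall n, mean (p n) <= A.

Let UP : ProperFilter U := ultra_proper.
Let I := `[0, 1[%classic : set R.
Let mI : measurable I. Proof. exact: measurable_itv. Qed.

(** Extension by 0 leaves room to the left of 0: mass that gathers at 0 becomes a jump inside ]-1,
    1], which cells ]a, b] with a >= 0 would miss. *)
Let w n : R -> R := p n \_ I.

Let w_ge0 n t : 0 <= w n t.
Proof. by rewrite /w patchE; case: ifP. Qed.

Let gw_integrable (g : R -> R) n (D : set R) : continuous g -> measurable D ->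
  mu.-integrable D (EFin \o (fun t => g t * w n t)).
Proof.
move=> cg mD; apply: (@integrableS _ _ _ mu setT) => //.
rewrite (_ : _ \o _ = (EFin \o (fun t => g t * p n t)) \_ I); last first.
  by apply/funext => t /=; rewrite /w !patchE; case: ifP => // _; rewrite mulr0.
rewrite -integrable_mkcond//.
apply: continuous_integrable01 => t; apply: cvgM; [exact: cg|exact: p_cont].
Qed.

Let w_integrable n (D : set R) : measurable D -> mu.-integrable D (EFin \o w n).
Proof.
move=> mD; have c1 : continuous (cst 1 : R -> R) by move=> ?; exact: cst_continuous.
have := gw_integrable n c1 mD; congr (mu.-integrable _ _).
by apply/funext => t /=; rewrite mul1r.
Qed.

Let gw_mean (g : R -> R) n : \int[mu]_(t in `]-1, 1]) (g t * w n t) =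
  mean (fun t => g t * p n t).
Proof.
rewrite (_ : (fun t => g t * w n t) = (fun t => g t * p n t) \_ I); last first.
  by apply/funext => t /=; rewrite /w !patchE; case: ifP => // _; rewrite mulr0.
rewrite -Rintegral_mkcondr; congr (Rintegral _ _ _).
apply/seteqP; split => t /=; rewrite !in_itv/=; first by case.
by rewrite /I/= in_itv/= => /andP[t0 t1]; split; rewrite ?t0//; lra.
Qed.

Let F n (x : R) := \int[mu]_(t in `]-1, x]) w n t.

Let F_ge0 n x : 0 <= F n x.
Proof. by apply: Rintegral_ge0. Qed.

Let FB n (x y : R) : -1 <= x -> x <= y -> F n y - F n x = \int[mu]_(t in `]x, y]) w n t.
Proof.
move=> x1 xy; have wi := w_integrable n (measurable_itv `]-1, y]).
by rewrite /F (Rintegral_itv_split x1 xy wi) [X in X - _]addrC addrK.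
Qed.

Let F_nd n (x y : R) : x <= y -> F n x <= F n y.
Proof.
move=> xy; have [x1|x1] := leP (-1) x.
  by rewrite -subr_ge0 FB//; exact: Rintegral_ge0.
by rewrite {1}/F set_itv_ge ?Rintegral_set0// -leNgt bnd_simp ltW.
Qed.

Let F0 n (x : R) : x < 0 -> F n x = 0.
Proof.
move=> x0; rewrite /F /Rintegral; rewrite (eq_integral (cst 0%E)).
  by rewrite integral0.
move=> t; rewrite inE/= in_itv/= => /andP[_ tx]; rewrite /w patchE.
by case: ifP => //; rewrite inE /I/= in_itv/= leNgt (le_lt_trans tx x0).
Qed.

Let F1 n (x : R) : 1 <= x -> F n x = mean (p n).
Proof.
move=> x1; rewrite -[RHS](_ : F n 1 = _); last first.
  rewrite /F; have := gw_mean (cst 1) n.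
  rewrite (_ : (fun t => cst 1 t * w n t) = w n); last first.
    by apply/funext => t; rewrite mul1r.
  by rewrite (_ : (fun t => cst 1 t * p n t) = p n)//; apply/funext => t; rewrite mul1r.
apply/eqP; rewrite -subr_eq0 FB//.
rewrite /Rintegral (eq_integral (cst 0%E)) ?integral0//.
move=> t; rewrite inE/= in_itv/= => /andP[tx _]; rewrite /w patchE.
by case: ifP => //; rewrite inE /I/= in_itv/= (ltNge t) (ltW tx) andbF.
Qed.

Let F_le n x : F n x <= A.
Proof.
have [x1|x1] := leP 1 x; first by rewrite F1.
by rewrite (le_trans (F_nd n (ltW x1)))// F1.
Qed.

(** The mesh is 1/(N+1), and 1 is reached after 2 (N+1) steps. The minimum freezes the sequence
    there, as the lemmas on sums ask for conditions at every index. *)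
Let grid N i : R := Num.min 1 (-1 + i%:R / N.+1%:R).

Let grid0 N : grid N 0 = -1.
Proof. by rewrite /grid mul0r addr0; apply/min_idPr; lra. Qed.

Let gridN N : grid N (2 * N.+1) = 1.
Proof.
rewrite /grid natrM mulfK ?pnatr_eq0//; apply/min_idPl; lra.
Qed.

Let grid_nd N i : grid N i <= grid N i.+1.
Proof.
rewrite /grid le_min ge_min lexx/= ge_min; apply/orP; right.
by rewrite lerD2l ler_pM2r ?invr_gt0// ler_nat.
Qed.

Let grid_ge N i : -1 <= grid N i.
Proof. by elim: i => [|i /le_trans]; [rewrite grid0|apply]. Qed.

Let grid_le N i : grid N i <= 1.
Proof. by rewrite /grid ge_min lexx. Qed.

Let grid_step N i : grid N i.+1 - grid N i <= N.+1%:R^-1.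
Proof.
have step (a d : R) : 0 < d -> Num.min 1 (a + d) - Num.min 1 a <= d.
  by move=> d0; case: (leP 1 (a + d)) => h1; case: (leP 1 a) => h2; lra.
by rewrite /grid -[i.+1%:R]natr1 mulrDl mul1r addrA step// invr_gt0.
Qed.

Let grid_lt N i : grid N i < 1 -> grid N i < grid N i.+1.
Proof.
have step (a d : R) : 0 < d -> Num.min 1 a < 1 -> Num.min 1 a < Num.min 1 (a + d).
  by move=> d0; case: (leP 1 (a + d)) => h1; case: (leP 1 a) => h2; lra.
by rewrite /grid -[i.+1%:R]natr1 mulrDl mul1r addrA; apply: step; rewrite invr_gt0.
Qed.

Let sum_cvg (a : nat -> nat -> R) (b : nat -> R) m :
  (forall i, a i n @[n --> U] --> b i) ->
  (\sum_(i < m) a i n) @[n --> U] --> \sum_(i < m) b i.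
Proof.
move=> ab; elim: m => [|m IH].
  rewrite big_ord0; under eq_fun do rewrite big_ord0; exact: cvg_cst.
rewrite big_ord_recr/=; under eq_fun do rewrite big_ord_recr/=.
by apply: cvgD => //; exact: ab.
Qed.

Let modulus (g : R -> R) (om : R) : continuous g -> 0 < om -> exists N, forall i t,
  grid N i <= t <= grid N i.+1 -> `|g t - g (grid N i.+1)| <= om.
Proof.
move=> cg om0.
have le11 : -1 <= 1 :> R by lra.
have [d d0 hd] := uniform_modulus le11 cg om0.
have [N _ hN] := near_infty_natSinv_lt (PosNum d0).
exists N => i t /andP[t1 t2].
have g1 := grid_ge N i; have g2 := grid_le N i.+1; have g3 : grid N i.+1 - grid N i < d.
  by apply: (le_lt_trans (grid_step N i)); exact: (hN N (leqnn N)).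
apply: hd; first by apply/andP; split; lra.
by rewrite ltr_norml; lra.
Qed.

(** The cumulative functions [F n] converge along [U] at every point, to [G], whose right-continuous
    version [H] defines [nu]. For continuous [g] both integrals are close to Stieltjes sums over one
    fixed grid, and the finitely many terms of these sums converge; replacing [G] by [H] costs no
    more than the oscillation of [g] on a cell, even where they differ. *)
Theorem density_limit : exists nu : {measure set (measurableTypeR R) -> \bar R},
  (nu (`](-1)%R, 1%R]%classic : set R) < +oo)%E /\
  forall g : R -> R, continuous g ->
    nu.-integrable `]-1, 1] (EFin \o g) /\
    mean (fun t => g t * p n t) @[n --> U] --> \int[nu]_(t in `]-1, 1]) g t.
Proof.
have /choice[G FG] : forall x, exists l : R, F n x @[n --> U] --> l.
  move=> x; apply: (ultra_bounded_cvg UU (A := A)) => n.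
  by rewrite F_ge0 F_le.
have G_nd : {homo G : x y / x <= y}.
  by move=> x y xy; apply: (ultra_le UU (FG x) (FG y)) => n; exact: F_nd.
have cst_cvg (k : R) : k @[_ --> U] --> k by exact: cvg_cst.
have G_ge0 x : 0 <= G x by apply: (ultra_le UU (cst_cvg 0) (FG x)).
have G_le x : G x <= A by apply: (ultra_le UU (FG x) (cst_cvg A)).
have G0 x : x < 0 -> G x = 0.
  move=> x0; apply/eqP; rewrite eq_le G_ge0 andbT.
  by apply: (ultra_le UU (FG x) (cst_cvg 0)) => n; rewrite F0.
have G1 x : 1 <= x -> G x = G 1.
  move=> x1; apply/eqP; rewrite eq_le (G_nd _ _ x1) andbT.
  by apply: (ultra_le UU (FG x) (FG 1)) => n; rewrite (F1 n x1) (F1 n (lexx _)).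
pose H := right_limit G; pose nu := right_limit_measure G_nd G_ge0.
(* [G] vanishes to the left of 0 and is constant from 1 on, so regularization changes nothing at the
   two ends and no mass is lost. *)
have Hm1 : H (-1) = G (-1).
  apply/eqP; rewrite eq_le right_limit_lb// andbT.
  rewrite (le_trans (@right_limit_ub _ _ G_ge0 (-1) (- (1/2)) _))//; first by lra.
  by rewrite !G0//; lra.
have H1 : H 1 = G 1.
  apply/eqP; rewrite eq_le right_limit_lb// andbT.
  by rewrite (le_trans (@right_limit_ub _ _ G_ge0 1 2 _)) ?G1//; lra.
have nuE a b : a <= b -> nu (`]a, b]%classic : set R) = (H b - H a)%:E.
  by move=> ab; rewrite right_limit_measureE.
have nufin : (nu (`](-1)%R, 1%R]%classic : set R) < +oo)%E.
  by rewrite nuE ?ltry//; lra.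
have mJ : measurable (`]-1, 1]%classic : set (measurableTypeR R)).
  exact: measurable_itv.
have gi (g : R -> R) : continuous g -> nu.-integrable `]-1, 1] (EFin \o g).
  move=> cg; apply: measurable_bounded_integrable => //.
    by apply: measurable_funTS; exact: continuous_measurable_fun.
  have le11 : -1 <= 1 :> R by lra.
  have cng : continuous (fun t => `|g t|).
    by move=> t; apply: (continuous_comp (cg t)); exact: norm_continuous.
  have [c _ hc] := EVT_max le11 (continuous_subspaceT cng).
  exists `|g c|; split; first exact: num_real.
  move=> M hM t /=; rewrite in_itv/= => /andP[t1 t2].
  by apply: le_trans (ltW hM); apply: hc; rewrite in_itv/= (ltW t1).
exists nu; split => // g cg; split; first exact: gi.
set J := Rintegral _ _ _.
have A0 : 0 <= A := le_trans (F_ge0 0 1) (F_le 0 1).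
apply/cvgrPdist_lt => e e0.
(* Three of the four errors are at most [om * A] and share one half of [e]; the convergence of the
   sums takes the other half. The added 1 covers A = 0. *)
pose om := e / (2 * (3 * A + 1)).
have om0 : 0 < om by rewrite divr_gt0//; lra.
have omA : 3 * (om * A) < e / 2.
  have -> : e / 2 = 3 * (om * A) + om.
    by rewrite /om; field; rewrite gt_eqF//; lra.
  by rewrite ltrDl.
have [N hN] := modulus cg om0.
have hN' i t : grid N i < t <= grid N i.+1 -> `|g t - g (grid N i.+1)| <= om.
  by move=> /andP[/ltW t1 t2]; apply: hN; rewrite t1.
pose x := grid N; pose m := (2 * N.+1)%N.
pose S (K : R -> R) := \sum_(i < m) g (x i.+1) * (K (x i.+1) - K (x i)).
have e1 n : `|mean (fun t => g t * p n t) - S (F n)| <= om * A.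
  have := @stieltjes_sum R mu g (w n) x om m (w_ge0 n) (grid_nd N).
  rewrite /x /m grid0 gridN => /(_ (w_integrable n mJ) (gw_integrable n cg mJ) hN').
  rewrite gw_mean => h; apply: le_trans (le_trans h _).
    rewrite le_eqVlt; apply/orP; left; apply/eqP; congr (`| _ - _ |).
    by apply: eq_bigr => i _; congr (_ * _); apply: FB; [exact: grid_ge|exact: grid_nd].
  by rewrite ler_wpM2l ?(ltW om0)//; exact: F_le.
have e2 : S (F n) @[n --> U] --> S G.
  apply: (sum_cvg (a := fun i n => g (x i.+1) * (F n (x i.+1) - F n (x i)))
    (b := fun i => g (x i.+1) * (G (x i.+1) - G (x i)))) => i.
  apply: cvgM; first exact: cvg_cst.
  by apply: cvgB; exact: FG.
have e3 : `|S H - S G| <= om * A.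
  have := @abel_compare R (fun i => g (x i)) (fun i => G (x i)) (fun i => H (x i)) om m.
  rewrite /x /m grid0 gridN => h; apply: (le_trans (h _ _ _ _ _ _)) => //.
  - exact: ltW.
  - by move=> i; rewrite distrC hN// lexx grid_nd.
  - by move=> i; exact: right_limit_lb.
  - move=> i; have := grid_le N i; rewrite le_eqVlt => /predU1P[gi1|/grid_lt gi1].
      by rewrite gi1 H1 G_nd// -gi1 grid_nd.
    exact: right_limit_ub.
  - by rewrite ler_wpM2l ?(ltW om0)// (G0 (-1)) ?subr0//; lra.
have e4 : `|J - S H| <= om * A.
  have := @stieltjes_sum R nu g (cst 1) x om m (fun _ => ler01) (grid_nd N).
  have ci : nu.-integrable `]-1, 1] (EFin \o cst 1).
    by apply: gi => ?; exact: cst_continuous.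
  have g1 : (fun t => g t * cst 1 t) = g by apply/funext => t; rewrite mulr1.
  rewrite /x /m grid0 gridN g1 => /(_ ci (gi g cg) hN').
  have cE (a b : R) : a <= b -> \int[nu]_(t in `]a, b]) cst 1 t = H b - H a.
    by move=> ab; rewrite Rintegral_cst// mul1r nuE.
  rewrite cE; last by lra.
  move=> h; apply: le_trans (le_trans h _).
    rewrite le_eqVlt; apply/orP; left; apply/eqP; congr (`| _ - _ |).
    by apply: eq_bigr => i _; congr (_ * _); rewrite cE//; exact: grid_nd.
  by rewrite ler_wpM2l ?(ltW om0)// Hm1 H1 (G0 (-1)) ?subr0//; lra.
have e20 : 0 < e / 2 by rewrite divr_gt0.
have /cvgrPdist_lt /(_ _ e20) := e2; apply: filterS => n he2.
rewrite (_ : J - _ = (J - S H) + (S H - S G) + (S G - S (F n)) +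
  (S (F n) - mean (fun t => g t * p n t))); last by ring.
have e1' : `|S (F n) - mean (fun t => g t * p n t)| <= om * A by rewrite distrC.
by rewrite [ltRHS]splitr; exact: norm_sum4 e4 e3 he2 e1' omA.
Qed.

End density_limit.

(** * Transfer of the limits to the circle *)

Section weak_limit.
Context {R : realType}.
Local Notation mu := (@lebesgue_measure R).
Local Notation mean h := (\int[mu]_(t in `[0, 1[) h t).

(* Translation by an integer on ]-1, 1], and no other point goes to [0, 1[. *)
Let wrap (t : R) : R := t + \1_(`]-1, 0[%classic : set R) t - \1_([set (1 : R)]) t.

Let measurable_wrap : measurable_fun [set: R] wrap.
Proof.
apply: measurable_funB; last exact: measurable_indic.
by apply: measurable_funD => //; exact: measurable_indic.
Qed.

Let wrapE t : wrap t = t + (-1 < t < 0)%R%:R - (t == 1)%:R.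
Proof.
rewrite /wrap !indicE; congr (_ + _%:R - _%:R).
  by congr nat_of_bool; apply/idP/idP; rewrite inE/= in_itv.
by congr nat_of_bool; apply/idP/eqP; rewrite inE.
Qed.

Let wrap_preimage : wrap @^-1` `[0, 1[ = `]-1, 1]%classic.
Proof.
apply/seteqP; split => t /=; rewrite !in_itv/= wrapE.
  case: (ltP (-1) t) => h1 /=; case: (ltP t 0) => h2 /=; case: eqP => h3;
    by rewrite /= ?subr0 ?addr0; lra.
case: (ltP (-1) t) => h1 //=; case: (ltP t 0) => h2 /=; case: eqP => h3;
  by rewrite /= ?subr0 ?addr0; lra.
Qed.

Variables (U : set_system nat) (UU : UltraFilter U).

(** The measure is the image under [wrap] of the limit on ]-1, 1]; mass gathered at 1 goes to 0, the
    same point of the circle, which is harmless for periodic [g]. *)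
Theorem weak_limit (p : nat -> R -> R) (A : R) : (forall n, continuous (p n)) ->
  (forall n t, 0 <= p n t) -> (forall n, mean (p n) <= A) ->
  exists nu : {measure set R -> \bar R}, (nu `[0%R, 1%R[%classic < +oo)%E /\
  forall g : R -> R, continuous g -> (forall t, g (t + 1) = g t) ->
    mean (fun t => g t * p n t) @[n --> U] -->
    fine (\int[nu]_(t in `[0%R, 1%R[) (g t)%:E)%E.
Proof.
move=> p_cont p_ge0 p_mean.
have [nu [nufin hnu]] := density_limit UU p_cont p_ge0 p_mean.
have mw : measurable_fun [set: measurableTypeR R] (wrap : measurableTypeR R -> R).
  exact: measurable_wrap.
unshelve refine (ex_intro _ (pushforward nu wrap : {measure set R -> \bar R}) _).
  exact: measurable_wrap.
split; first by rewrite /= /pushforward wrap_preimage.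
move=> g cg gp; have [gi ghU] := hnu g cg.
have wrapg t : -1 < t <= 1 -> g (wrap t) = g t.
  move=> t1; rewrite wrapE; case: (ltP t 0) => t0; rewrite /= ?andbT ?andbF.
    have /andP[-> _] := t1; rewrite lt_eqF ?subr0//; lra.
  rewrite /= addr0; case: eqP => [->|_]; last by rewrite subr0.
  by rewrite -(gp (1 - 1)) subrK.
have gE t : (`]-1, 1]%classic : set R) t -> ((EFin \o g) \o wrap) t = (g t)%:E.
  by move=> /= ht; rewrite wrapg// -in_itv.
have gwi : nu.-integrable (wrap @^-1` `[0, 1[) ((EFin \o g) \o wrap).
  rewrite wrap_preimage; apply: eq_integrable gi => //.
  by move=> t; rewrite inE => /gE.
rewrite (integral_pushforward mw _ gwi)//; last first.
  by apply/measurable_EFinP; exact: continuous_measurable_fun.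
rewrite wrap_preimage.
rewrite (_ : (\int[nu]_(x in _) _)%E = (\int[nu]_(t in `](-1)%R, 1%R]) (g t)%:E)%E)//.
by apply: eq_integral => t; rewrite inE => /gE.
Qed.

Theorem signed_weak_limit (u : nat -> R -> R) (A : R) : (forall n, continuous (u n)) ->
  (forall n, mean (fun t => `|u n t|) <= A) ->
  exists nu1 nu2 : {measure set R -> \bar R},
    (nu1 `[0%R, 1%R[%classic + nu2 `[0%R, 1%R[%classic <= A%:E)%E /\
    forall g : R -> R, continuous g -> (forall t, g (t + 1) = g t) ->
    mean (fun t => g t * u n t) @[n --> U] -->
    fine (\int[nu1]_(t in `[0%R, 1%R[) (g t)%:E)%E -
    fine (\int[nu2]_(t in `[0%R, 1%R[) (g t)%:E)%E.
Proof.
move=> cu uA; pose cabs n := continuous_abs (cu n).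
pose p n t := 2^-1 * (`|u n t| + u n t); pose q n t := 2^-1 * (`|u n t| - u n t).
have c2 : continuous (cst 2^-1 : R -> R) by move=> ?; exact: cst_continuous.
have cp n : continuous (p n).
  by move=> t; apply: cvgM; [exact: c2|exact: (continuousD (cabs n) (cu n))].
have cq n : continuous (q n).
  by move=> t; apply: cvgM; [exact: c2|exact: (continuousB (cabs n) (cu n))].
have i2 : 0 <= 2^-1 :> R by rewrite invr_ge0.
have p0 n t : 0 <= p n t.
  by apply: mulr_ge0 => //; have := ler_norm (- u n t); rewrite normrN; lra.
have q0 n t : 0 <= q n t.
  by apply: mulr_ge0 => //; have := ler_norm (u n t); lra.
have pqE n t : p n t + q n t = `|u n t| by rewrite /p /q; field.
have pqB n t : p n t - q n t = u n t by rewrite /p /q; field.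
have pA n : mean (p n) <= A.
  apply: le_trans (uA n); apply: le_mean => // t _.
  by have := q0 n t; have := pqE n t; lra.
have qA n : mean (q n) <= A.
  apply: le_trans (uA n); apply: le_mean => // t _.
  by have := p0 n t; have := pqE n t; lra.
have [nu1 [fin1 h1]] := weak_limit cp p0 pA.
have [nu2 [fin2 h2]] := weak_limit cq q0 qA.
exists nu1, nu2; split; last first.
  move=> g cg gp.
  have gcont (h : R -> R) : continuous h -> continuous (fun t => g t * h t).
    by move=> ch t; apply: cvgM; [exact: cg|exact: ch].
  have E n : mean (fun t => g t * u n t) =
      mean (fun t => g t * p n t) - mean (fun t => g t * q n t).
    rewrite -(meanB (gcont _ (cp n)) (gcont _ (cq n))).
    by apply: eq_Rintegral => t _; rewrite -pqB mulrBr.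
  by under eq_fun do rewrite E; apply: cvgB; [exact: h1|exact: h2].
have cone : continuous (cst 1 : R -> R) by move=> ?; exact: cst_continuous.
have mass (nu : {measure set R -> \bar R}) (r : nat -> R -> R) :
    (nu `[0%R, 1%R[%classic < +oo)%E ->
    mean (fun t => cst 1 t * r n t) @[n --> U] -->
    fine (\int[nu]_(t in `[0%R, 1%R[) (cst 1 t)%:E)%E ->
    mean (r n) @[n --> U] --> fine (nu `[0%R, 1%R[%classic).
  have one : fine (\int[nu]_(t in `[0%R, 1%R[) (cst 1 t)%:E)%E = fine (nu `[0%R, 1%R[%classic).
    have mI : measurable (`[0, 1[%classic : set R) by exact: measurable_itv.
    by have := Rintegral_cst nu mI 1; rewrite mul1r.
  move=> nufin; rewrite one.
  apply: cvg_trans; apply: near_eq_cvg; near=> n.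
  by apply: eq_Rintegral => t _; rewrite mul1r.
(* The limit is taken in the sum of the two means, which is the mean of |u|: the masses are bounded
   by A together, while separate bounds would give 2 A. *)
have m12 : mean (p n) + mean (q n) @[n --> U] -->
    fine (nu1 `[0%R, 1%R[%classic) + fine (nu2 `[0%R, 1%R[%classic).
  by apply: cvgD; [exact: mass fin1 (h1 _ cone _)|exact: mass fin2 (h2 _ cone _)].
have Acst : A @[_ --> U] --> A by exact: cvg_cst.
rewrite -(@fineK _ (nu1 _)) ?ge0_fin_numE// -(@fineK _ (nu2 _)) ?ge0_fin_numE//.
rewrite -EFinD lee_fin; apply: (ultra_le UU m12 Acst) => n /=.
rewrite -(meanD (cp n) (cq n)); apply: le_trans (uA n).
by rewrite le_eqVlt; apply/orP; left; apply/eqP; apply: eq_Rintegral.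
Unshelve. all: by end_near. Qed.

End weak_limit.

(** * Herglotz representation *)
Section total_variation.
Context {R : realType}.
Variables nu1 nu2 : {measure set R -> \bar R}.
Local Open Scope ereal_scope.

Let sum_measure (nu : {measure set R -> \bar R}) n (E : 'I_n -> set R) D :
  (forall i, measurable (E i)) -> trivIset [set: 'I_n] E ->
  \bigcup_(i in [set: 'I_n]) E i = D -> \sum_(i < n) nu (E i) = nu D.
Proof.
move=> mE tE <-; rewrite measure_fin_bigcup//; last exact: finite_finset.
rewrite (fsbigE (index_enum 'I_n)) ?index_enum_uniq//.
  by apply: eq_bigl => i; rewrite in_setT.
by move=> i _; rewrite mem_index_enum.
Qed.

Lemma signed_total_variation_le :
  signed_total_variation nu1 nu2 <= nu1 `[0%R, 1%R[%classic + nu2 `[0%R, 1%R[%classic.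
Proof.
apply: ge_ereal_sup => _ [n [E [mE tE DE ->]]].
rewrite -(sum_measure nu1 mE tE DE) -(sum_measure nu2 mE tE DE) -big_split/=.
apply: lee_sum => i _; apply: le_trans (lee_abs_sub _ _) _.
by rewrite !gee0_abs.
Qed.

End total_variation.

(** * The Schwarz formula for dilates *)

Section weak_limits_of_dilates.
Context {R : realType}.
Local Notation C := R[i].
Local Notation normc := (@Normc.normc R).
Local Notation Re := (@complex.Re R).
Local Notation Im := (@complex.Im R).
Local Notation mu := (@lebesgue_measure R).
Local Notation mean h := (\int[mu]_(t in `[0, 1[) h t).

Lemma dilate_schwarz_formula f (r : R) z c : (forall w, normc w < 1 -> cdiff f w) ->
  0 <= r < 1 -> Im (f 0) = 0 -> normc z < 1 ->
  mean (fun t => Re (f (r%:C%C * expi t)) * Re (c * herglotz z t)) =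
  Re (c * f (r%:C%C * z)).
Proof.
move=> df /andP[r0 r1] f0 z1.
(* [B] exceeds 1 and r B <= 1, so f(r w) is differentiable on a disc larger than the unit disc. *)
pose B := 2 / (1 + r); have rp : 0 < 1 + r by rewrite ltr_wpDr.
have B1 : 1 < B by rewrite /B ltr_pdivlMr//; lra.
have rB : r * B <= 1 by rewrite /B mulrA ler_pdivrMr//; lra.
have := @schwarz_formula R (fun w => f (r%:C%C * w)) B z c B1.
rewrite mulr0 f0 mulr0 addr0; apply => // w wB.
apply: (@cdiff_comp _ f (fun w => r%:C%C * w)).
  by apply: cdiffM; [exact: cdiff_cst|exact: cdiff_id].
apply: df; rewrite Normc.normcM normc_real ger0_norm//.
have [->|rn0] := eqVneq r 0; first by rewrite mul0r.
by apply: lt_le_trans rB; rewrite ltr_pM2l// lt_neqAle eq_sym rn0.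
Qed.

Lemma dilate_continuous f (r : R) : (forall w, normc w < 1 -> cdiff f w) ->
  0 <= r < 1 -> continuous (fun t => Re (f (r%:C%C * expi t))).
Proof.
move=> df /andP[r0 r1].
have := @continuous_circle_Re R f 0 r%:C%C.
under eq_fun do rewrite add0r; apply=> t; rewrite add0r.
by apply/cdiff_ccont/df; rewrite Normc.normcM normc_expi mulr1 normc_real ger0_norm.
Qed.

Lemma dilate_cvg (U : set_system nat) f z c : Filter U -> \oo `<=` U ->
  cdiff f z -> Re (c * f ((radius n)%:C%C * z)) @[n --> U] --> Re (c * f z).
Proof.
move=> UF UN /cdiff_ccont cf.
have : ccont (fun w => c * f w) z by apply: ccontM => //; exact: ccont_cst.
move=> ccf; apply/cvgrPdist_lt => e /ccf[d d0 hd].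
have z1 : 0 < normc z + 1 by rewrite ltr_wpDl// normc_ge0.
have [N hN] := radius_near (divr_gt0 d0 z1).
apply: UN; exists N => // n /= /hN; rewrite ltr_pdivlMr// => nd.
rewrite distrC -ReB; apply: le_lt_trans (normc_Re _) (hd _ _).
have /andP[r0 r1] := @radius_itv R n.
rewrite (_ : _ - z = (1 - radius n)%:C%C * - z); last first.
  rewrite (_ : (1 - radius n)%:C%C = 1 - (radius n)%:C%C); last first.
    by apply: complexP => /=; ring.
  by ring.
rewrite Normc.normcM normcN normc_real ger0_norm ?subr_ge0 ?(ltW r1)//.
by apply: le_lt_trans nd; rewrite ler_wpM2l ?lerDl// subr_ge0 ltW.
Qed.

End weak_limits_of_dilates.

Theorem mainTheorem2 (R : realType) :
  exists C : R, 0 < C /\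
  forall (f : R[i] -> R[i]) (fb : R -> R[i]),
    (* f analytic in the unit disc *)
    holomorphic_on_disc f ->
    (* fb = the non-tangential boundary values of f, a.e. on T *)
    {ae (@lebesgue_measure R), forall theta : R,
        `[0, 1[%classic theta -> nontangential_limit f theta (fb theta)} ->
    measurable_fun (`[0, 1[%classic : set R) (fun theta => complex.Re (fb theta)) ->
    measurable_fun (`[0, 1[%classic : set R) (fun theta => complex.Im (fb theta)) ->
    (* (a) f in N_+ *)
    (forall z : R[i], Normc.normc z < 1 ->
       (elog (Normc.normc (f z)) <=
        \int[lebesgue_measure]_(theta in `[0%R, 1%R[)
           (elog (Normc.normc (fb theta)) *
            (complex.Re ((expi theta + z) / (expi theta - z)))%:E))%E) ->
    (* (b) Re f in L^1(T) and f(0) real *)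
    lebesgue_measure.-integrable `[0, 1[ (fun theta => (complex.Re (fb theta))%:E) ->
    complex.Im (f 0) = 0 ->
    (* (c) liminf_{R -> oo} R int_R^oo m_f(t)/t dt < oo *)
    (liminf_pinfty (tail_quantity fb) < +oo)%E ->
    (* conclusion: mu = mu1 - mu2 finite real Borel measure on T *)
    exists mu1 mu2 : {measure set R -> \bar R},
      (mu1 `[0%R, 1%R[%classic < +oo)%E /\ (mu2 `[0%R, 1%R[%classic < +oo)%E /\
      (forall z : R[i], Normc.normc z < 1 ->
         f z = cintegral mu1 (fun theta => (expi theta + z) / (expi theta - z))
             - cintegral mu2 (fun theta => (expi theta + z) / (expi theta - z))) /\
      (signed_total_variation mu1 mu2 <=
         \int[lebesgue_measure]_(theta in `[0%R, 1%R[) `|complex.Re (fb theta)|%:E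
         + C%:E * liminf_pinfty (tail_quantity fb))%E.
Proof.
have ln2 : 0 < ln 2 :> R by rewrite ln_gt0//; lra.
exists (4 / ln 2); split; first by rewrite divr_gt0.
move=> f fb hol aef mR mIm Na iR f0 Lfin.
have df z : Normc.normc z < 1 -> cdiff f z by move=> /hol[l /cdiff_local].
set RHS := (_ + _)%E.
have hA n : ((\int[lebesgue_measure]_(t in `[0, 1[)
    `|complex.Re (f ((radius n)%:C%C * expi t))|)%:E <= RHS)%E.
  by apply: circle_L1_liminf => //; exact: (@radius_itv R n).
have RHSy : (RHS < +oo)%E.
  rewrite lte_add_pinfty//.
    by have /integrableP[_] := iR; apply: le_lt_trans; rewrite le_eqVlt eqxx.
  by rewrite lte_mul_pinfty// lee_fin divr_ge0// ltW.
pose A := fine RHS.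
have RHSE : RHS = A%:E.
  rewrite /A fineK// fin_numE -ltey RHSy andbT gt_eqF//.
  exact: lt_le_trans (ltNyr _) (hA 0%N).
have [U [UU UN]] : exists U : set_system nat, UltraFilter U /\ \oo `<=` U.
  exact: ultraFilterLemma.
pose u n t := complex.Re (f ((radius n)%:C%C * expi t)).
have cu n : continuous (u n) by apply: dilate_continuous => //; exact: (@radius_itv R n).
have uA n : \int[lebesgue_measure]_(t in `[0, 1[) `|u n t| <= A.
  by rewrite -lee_fin -RHSE; exact: hA.
have [nu1 [nu2 [nuA nu_lim]]] := signed_weak_limit UU cu uA.
have nuy : (nu1 `[0%R, 1%R[%classic + nu2 `[0%R, 1%R[%classic < +oo)%E.
  exact: le_lt_trans nuA (ltry A).
exists nu1, nu2; split; first by apply: le_lt_trans nuy; rewrite leeDl.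
split; first by apply: le_lt_trans nuy; rewrite leeDr.
split; last by rewrite RHSE; apply: le_trans nuA; exact: signed_total_variation_le.
move=> z z1.
(* Weak limits are available for real test functions only; the real parts for all factors [c] encode
   the complex identity, recovered below with 1 and -i. *)
have limit c : complex.Re (c * f z) =
    fine (\int[nu1]_(t in `[0%R, 1%R[) (complex.Re (c * herglotz z t))%:E)%E -
    fine (\int[nu2]_(t in `[0%R, 1%R[) (complex.Re (c * herglotz z t))%:E)%E.
  have per t : complex.Re (c * herglotz z (t + 1)) = complex.Re (c * herglotz z t).
    by rewrite /herglotz expiD1.
  have lim1 := nu_lim _ (@herglotz_continuous R c z z1) per.
  have UF : ProperFilter U := @ultra_proper _ U UU.
  have lim2 := @dilate_cvg R U f z c UF UN (df z z1).
  have E n : \int[lebesgue_measure]_(t in `[0, 1[) (complex.Re (c * herglotz z t) * u n t) =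
      complex.Re (c * f ((radius n)%:C%C * z)).
    rewrite -(@dilate_schwarz_formula R f (radius n) z c df (@radius_itv R n) f0 z1).
    by apply: eq_Rintegral => t _; rewrite mulrC.
  (* Both sides are limits along [U] of one sequence; the right one by weak convergence, the left
     one because [U] contains the neighbourhoods of infinity, where the radii tend to 1. *)
  by apply/eqP; rewrite eq_le (ultra_le UU lim2 lim1) ?(ultra_le UU lim1 lim2)// => n; rewrite E.
apply: complexP.
  have := limit 1; rewrite mul1r => ->.
  rewrite ReB /cintegral; congr (fine _ - fine _);
    by apply: eq_integral => t _; rewrite mul1r.
have ImE w : complex.Re ((0 -i* 1)%C * w) = complex.Im w.
  by case: w => a b /=; ring.
have := limit (0 -i* 1)%C; rewrite ImE => ->.
rewrite ImB /cintegral; congr (fine _ - fine _);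
  by apply: eq_integral => t _; rewrite ImE.
Qed.
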